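(* Let $n,k\in\mathbb{N}$, and let $\mathcal{V}_{ns}$ be the universal nonsignalling vector space with $n$ inputs and $k$ outputs, with generators $Q(a,b|x,y)$, $a,b\in\{1,\dots,k\}$, $x,y\in\{1,\dots,n\}$, and unit $e_{ns}$. Let $D_{ns}$ and $D_{qc}$ be the nonsignalling and quantum commuting cones on $\mathcal{V}_{ns}$ (all defined in the context). If $p=\{p(a,b|x,y)\}$ is a correlation with $n$ inputs and $k$ outputs, then $p\in C_{qc}(n,k)$ (respectively, $p\in C_{ns}(n,k)$) if and only if there exists a state $\phi:(\mathcal{V}_{ns},D_{qc},e_{ns})\to\mathbb{C}$ (respectively, a state $\phi:(\mathcal{V}_{ns},D_{ns},e_{ns})\to\mathbb{C}$) such that $p(a,b|x,y)=\phi(Q(a,b|x,y))$ for all $a,b\in\{1,\dots,k\}$ and $x,y\in\{1,\dots,n\}$.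
   Context: Correlations. Write $[m]=\{1,\dots,m\}$. A correlation with $n$ inputs and $k$ outputs is a tuple $p=\{p(a,b|x,y):a,b\in[k],x,y\in[n]\}$ of nonnegative reals with $\sum_{a,b}p(a,b|x,y)=1$ for all $x,y$. It is nonsignalling ($p\in C_{ns}(n,k)$) if $\sum_d p(a,d|x,w)$ is independent of $w$ for all $a,x$ and $\sum_c p(c,b|z,y)$ is independent of $z$ for all $b,y$. It is quantum commuting ($p\in C_{qc}(n,k)$) if there exist a Hilbert space $H$, C*-algebras $\mathcal{A},\mathcal{B}\subseteq B(H)$ with $z_1z_2=z_2z_1$ for all $z_1\in\mathcal{A},z_2\in\mathcal{B}$, projection-valued measures $\{E_{x,a}\}_{a=1}^k\subseteq\mathcal{A}$ and $\{F_{y,b}\}_{b=1}^k\subseteq\mathcal{B}$ (projections summing to the identity) for each $x,y\in[n]$, and a state $\phi:\mathcal{A}\mathcal{B}\to\mathbb{C}$ with $p(a,b|x,y)=\phi(E_{x,a}F_{y,b})$ for all $a,b,x,y$. The vector space $\mathcal{V}_{ns}$. Let $\widetilde V=\mathbb{C}^{n^2k^2}$ with canonical basis $\{\widetilde Q(a,b|x,y)\}$, and let $J\subseteq\widetilde V$ be the span of all vectors $\sum_{a,b}\widetilde Q(a,b|x,y)-\sum_{a,b}\widetilde Q(a,b|x',y')$, $\sum_c\widetilde Q(a,c|x,z)-\sum_c\widetilde Q(a,c|x,w)$, and $\sum_d\widetilde Q(d,b|z,y)-\sum_d\widetilde Q(d,b|w,y)$. Then $\mathcal{V}_{ns}=\widetilde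 V/J$, $Q(a,b|x,y)=\widetilde Q(a,b|x,y)+J$, and $e_{ns}=\sum_{a,b}Q(a,b|x,y)$ (independent of $x,y$). The involution is $(\sum r(a,b|x,y)Q(a,b|x,y))^*=\sum\overline{r(a,b|x,y)}Q(a,b|x,y)$. The cone $D_{ns}$ is $\{\sum t(a,b|x,y)Q(a,b|x,y): t(a,b|x,y)\ge 0\}$. A state on $(\mathcal{V}_{ns},D,e_{ns})$ is a linear functional $\phi$ with $\phi(D)\subseteq[0,\infty)$ and $\phi(e_{ns})=1$. Maximal matrix ordering. For an Archimedean order unit space $(\mathcal{V},C,e)$, let $D_m^{max}$ be the set of all $a^*va\in M_m(\mathcal V)$ with $a\in M_{r,m}(\mathbb{C})$, $v=v_1\oplus\dots\oplus v_r$, $v_i\in C$, $r\in\mathbb{N}$; and $C_m^{max}=\{v\in M_m(\mathcal{V})_h: v+\epsilon(I_m\otimes e)\in D_m^{max}\ \forall\epsilon>0\}$. Let $\mathcal{D}_{ns}$ be the matrix ordering $\{C_m^{max}\}_m$ obtained from $(\mathcal{V}_{ns},D_{ns},e_{ns})$. The cones associated to positive contractions. $I_m$ is the identity matrix and $J_m$ is the $m\times m$ matrix with all entries $1$; $\otimes$ denotes the Kronecker product (of scalar matrices and one matrix over the vector space); $q^\perp=e-q$. For a matrix ordering $\mathcal{C}$ on $\mathcal{V}$ and elements $q_1,\dots,q_M$ with $0\le q_i\le e$, put $P_i^M=I_{2^{i-1}}\otimes(q_i\oplus q_i^\perp)\otimes J_{2^{M-i}}$ and $Q_i^M=I_{2^{i-1}}\otimes(q_i^\perp\oplus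 q_i)\otimes J_{2^{M-i}}$ in $M_{2^M}(\mathcal{V})$. Then $\mathcal{C}(q_1,\dots,q_M)_m$ is the set of $x=x^*\in M_{m2^M}(\mathcal{V})$ such that for all $\epsilon_1,\dots,\epsilon_M>0$ there exist $t_1,\dots,t_M>0$ with $$x+\sum_{i=1}^M\epsilon_iI_m\otimes P_i^M+\sum_{i=1}^Mt_iI_m\otimes Q_i^M\in\mathcal{C}_{m2^M},$$ with the property that if one replaces $\epsilon_i$ with $\epsilon_i'<\epsilon_i$ then there exists $t_i'>t_i$ such that this membership still holds. For $L\in\mathbb{N}$, $\mathcal{C}(q_1,\dots,q_M)^L$ denotes $\mathcal{C}(q_1,\dots,q_M,\dots,q_1,\dots,q_M)$, with the list $q_1,\dots,q_M$ repeated $L$ times (so its $m$-th cone lies in $M_{m2^{ML}}(\mathcal{V})$). Finally, $\mathcal{C}(q_1,\dots,q_M)^\infty_m$ is the set of $x\in M_m(\mathcal{V})$ such that for every $\epsilon>0$ there is $L\in\mathbb{N}$ with $(x+\epsilon I_m\otimes e)\otimes J_{2^{ML}}\in\mathcal{C}(q_1,\dots,q_M)^L_m$. The cone $D_{qc}$. $D_{qc}=\mathcal{D}_{ns}(p_1,\dots,p_N)^\infty_1$, where $N=n^2k^2$ and $p_1,\dots,p_N$ is some fixed enumeration of the generators $Q(a,b|x,y)$ (the cone does not depend on the enumeration). *)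

(* Defs.v *)
From HB Require Import structures.
From mathcomp Require Import all_boot all_order all_algebra.
From mathcomp Require Import ring_quotient generic_quotient complex mxtens.
From mathcomp Require Import boolp classical_sets reals topology normedtype.

Set Implicit Arguments.
Unset Strict Implicit.
Unset Printing Implicit Defensive.

Import Order.TTheory GRing.Theory Num.Theory Num.Def.

Local Open Scope classical_set_scope.
Local Open Scope complex_scope.
Local Open Scope ring_scope.

Section QuotientSpace.
Variables (K : fieldType) (vT : vectType K) (U : {vspace vT}).

Definition quotv := Quotient.quot (pred_of_vspace U).

HB.instance Definition _ := GRing.Zmodule.on quotv.
HB.instance Definition _ := EqQuotient.on quotv.

Definition pi_quotv (v : vT) : quotv := \pi_quotv%qT v.

Lemma pi_quotv_eq u v : (pi_quotv u == pi_quotv v) = (u - v \in U).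
Proof. by rewrite /pi_quotv -Quotient.idealrBE. Qed.

Lemma pi_quotvK (u : quotv) : pi_quotv (repr u) = u.
Proof. exact: reprK. Qed.

Fact pi_quotv_is_zmod_morphism : zmod_morphism pi_quotv.
Proof. exact: raddfB. Qed.

HB.instance Definition _ :=
  GRing.isZmodMorphism.Build vT quotv pi_quotv pi_quotv_is_zmod_morphism.

Definition scale_quotv (c : K) (u : quotv) : quotv := pi_quotv (c *: repr u).

Lemma scale_pi_quotv c v : scale_quotv c (pi_quotv v) = pi_quotv (c *: v).
Proof.
apply/eqP; rewrite pi_quotv_eq -scalerBr memvZ// -pi_quotv_eq.
by rewrite pi_quotvK.
Qed.

Fact scale_quotvA a b v : scale_quotv a (scale_quotv b v) = scale_quotv (a * b) v.
Proof. by rewrite -[v]pi_quotvK !scale_pi_quotv scalerA. Qed.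

Fact scale_quotv1 : left_id 1 scale_quotv.
Proof. by move=> v; rewrite -[v]pi_quotvK scale_pi_quotv scale1r. Qed.

Fact scale_quotvDr : right_distributive scale_quotv +%R.
Proof.
move=> c u v; rewrite -[u]pi_quotvK -[v]pi_quotvK !scale_pi_quotv -raddfD /=.
by rewrite scale_pi_quotv scalerDr raddfD.
Qed.

Fact scale_quotvDl v : {morph scale_quotv^~ v : a b / a + b}.
Proof.
by move=> a b; rewrite -[v]pi_quotvK !scale_pi_quotv scalerDl raddfD.
Qed.

HB.instance Definition _ := GRing.Zmodule_isLmodule.Build K quotv
  scale_quotvA scale_quotv1 scale_quotvDr scale_quotvDl.

Fact pi_quotv_is_scalable : scalable pi_quotv.
Proof. by move=> c v; rewrite -scale_pi_quotv. Qed.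

HB.instance Definition _ :=
  GRing.isScalable.Build K vT quotv *:%R pi_quotv pi_quotv_is_scalable.

End QuotientSpace.

Section NonsignallingSpace.
Variables (R : realType) (n k : nat).

(* (a, b, x, y) stands for the generator Q(a, b | x, y). *)
Definition idx : finType := ('I_k * 'I_k * 'I_n * 'I_n)%type.

Definition Vtilde : vectType R[i] := {ffun idx -> R[i]^o}.

Definition Qtilde (a b : 'I_k) (x y : 'I_n) : Vtilde :=
  [ffun t => (t == (a, b, x, y))%:R].

Definition Jgen_unit (t : 'I_n * 'I_n * 'I_n * 'I_n) : Vtilde :=
  let: (x, y, x', y') := t in
  \sum_a \sum_b Qtilde a b x y - \sum_a \sum_b Qtilde a b x' y'.

Definition Jgen_left (t : 'I_k * 'I_n * 'I_n * 'I_n) : Vtilde :=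
  let: (a, x, z, w) := t in \sum_c Qtilde a c x z - \sum_c Qtilde a c x w.

Definition Jgen_right (t : 'I_k * 'I_n * 'I_n * 'I_n) : Vtilde :=
  let: (b, y, z, w) := t in \sum_d Qtilde d b z y - \sum_d Qtilde d b w y.

Definition Jns : {vspace Vtilde} :=
  <<codom Jgen_unit ++ codom Jgen_left ++ codom Jgen_right>>%VS.

Definition Vns : lmodType R[i] := quotv Jns.

Definition Q (a b : 'I_k) (x y : 'I_n) : Vns := pi_quotv Jns (Qtilde a b x y).

Definition Qidx (t : idx) : Vns := let: (a, b, x, y) := t in Q a b x y.

(* The value does not depend on the pair of inputs, see [e_nsE]; the default  *)
(* value 0 is only reached for n = 0.                                         *)
Definition e_ns : Vns :=
  if [pick x : 'I_n] is Some x then \sum_a \sum_b Q a b x x else 0.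

Lemma e_nsE (x y : 'I_n) : e_ns = \sum_a \sum_b Q a b x y.
Proof.
have pi_sum x' y' : \sum_a \sum_b Q a b x' y' =
    pi_quotv Jns (\sum_a \sum_b Qtilde a b x' y').
  by rewrite raddf_sum; apply: eq_bigr => a _; rewrite raddf_sum.
rewrite /e_ns; case: pickP => [z _|/(_ x)//].
apply/eqP; rewrite !pi_sum pi_quotv_eq; apply: memv_span.
by rewrite mem_cat; apply/orP; left; apply/codomP; exists (z, z, x, y).
Qed.

Definition conj_ffun (v : Vtilde) : Vtilde := [ffun t => (v t)^*].

(* The entrywise conjugation preserves J, so the choice of representative is  *)
(* irrelevant, see [star_pi] and [starE].                                     *)
Definition star (v : Vns) : Vns := pi_quotv Jns (conj_ffun (repr v)).

Fact conj_ffunD u v : conj_ffun (u + v) = conj_ffun u + conj_ffun v.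
Proof. by apply/ffunP => t; rewrite !ffunE rmorphD. Qed.

Fact conj_ffunN u : conj_ffun (- u) = - conj_ffun u.
Proof. by apply/ffunP => t; rewrite !ffunE rmorphN. Qed.

Fact conj_ffunZ c u : conj_ffun (c *: u) = c^* *: conj_ffun u.
Proof. by apply/ffunP => t; rewrite !ffunE rmorphM. Qed.

Fact conj_ffun_sum (I : finType) (F : I -> Vtilde) :
  conj_ffun (\sum_i F i) = \sum_i conj_ffun (F i).
Proof.
apply: (big_morph conj_ffun conj_ffunD).
by apply/ffunP => t; rewrite !ffunE rmorph0.
Qed.

Fact conj_ffun_Qtilde a b x y : conj_ffun (Qtilde a b x y) = Qtilde a b x y.
Proof. by apply/ffunP => t; rewrite !ffunE rmorph_nat. Qed.

Fact conj_ffun_Jns v : v \in Jns -> conj_ffun v \in Jns.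
Proof.
rewrite [in v \in _]/Jns => /coord_span ->; rewrite conj_ffun_sum.
apply: memv_suml => i _; rewrite conj_ffunZ memvZ//.
set g := nth _ _ _.
have gX : g \in codom Jgen_unit ++ codom Jgen_left ++ codom Jgen_right.
  by apply: mem_nth; rewrite !size_cat !size_codom.
suff -> : conj_ffun g = g by exact: memv_span.
have conjss (I I' : finType) (F : I -> I' -> Vtilde) :
    (forall i j, conj_ffun (F i j) = F i j) ->
    conj_ffun (\sum_i \sum_j F i j) = \sum_i \sum_j F i j.
  by move=> H; rewrite conj_ffun_sum; apply: eq_bigr => ? _;
     rewrite conj_ffun_sum; apply: eq_bigr.
have conjs (I : finType) (F : I -> Vtilde) :
    (forall i, conj_ffun (F i) = F i) -> conj_ffun (\sum_i F i) = \sum_i F i.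
  by move=> H; rewrite conj_ffun_sum; apply: eq_bigr.
move: gX; rewrite !mem_cat => /or3P[] /codomP[[[[? ?] ?] ?] ->] /=;
  rewrite conj_ffunD conj_ffunN ?conjss ?conjs// => *;
  exact: conj_ffun_Qtilde.
Qed.

Lemma star_pi v : star (pi_quotv Jns v) = pi_quotv Jns (conj_ffun v).
Proof.
apply/eqP; rewrite /star pi_quotv_eq -conj_ffunN -conj_ffunD.
by apply: conj_ffun_Jns; rewrite -pi_quotv_eq pi_quotvK.
Qed.

Lemma starE (r : idx -> R[i]) :
  star (\sum_t r t *: Qidx t) = \sum_t (r t)^* *: Qidx t.
Proof.
have QidxE t : Qidx t = pi_quotv Jns (Qtilde t.1.1.1 t.1.1.2 t.1.2 t.2).
  by case: t => -[[]].
have piE (s : idx -> R[i]) : \sum_t s t *: Qidx t = pi_quotv Jns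
    (\sum_t s t *: Qtilde t.1.1.1 t.1.1.2 t.1.2 t.2).
  by rewrite raddf_sum; apply: eq_bigr => t _; rewrite QidxE -linearZ.
rewrite !piE star_pi conj_ffun_sum; congr (pi_quotv _ _).
by apply: eq_bigr => t _; rewrite conj_ffunZ conj_ffun_Qtilde.
Qed.

End NonsignallingSpace.

Section MatrixOrderings.
Variables (R : realType) (V : lmodType R[i]) (st : V -> V).

Definition matrix_ordering := forall m : nat, set 'M[V]_m.

Definition mx_star m (X : 'M[V]_m) : 'M[V]_m := \matrix_(i, j) st (X j i).

Definition mx_compress r m (a : 'M[R[i]]_(r, m)) (X : 'M[V]_r) : 'M[V]_m :=
  \matrix_(i, j) \sum_s \sum_t ((a s i)^* * a t j) *: X s t.

(* Kronecker products A (x) X and X (x) A of a scalar matrix A and a matrix X *)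
(* over V, with the index conventions of mxtens.                              *)
Definition kronl m p (A : 'M[R[i]]_m) (X : 'M[V]_p) : 'M[V]_(m * p) :=
  \matrix_(i, j) (A (mxtens_unindex i).1 (mxtens_unindex j).1
                  *: X (mxtens_unindex i).2 (mxtens_unindex j).2).

Definition kronr m p (X : 'M[V]_m) (A : 'M[R[i]]_p) : 'M[V]_(m * p) :=
  \matrix_(i, j) (A (mxtens_unindex i).2 (mxtens_unindex j).2
                  *: X (mxtens_unindex i).1 (mxtens_unindex j).1).

Section Maximal.
Variables (C : set V) (e : V).

Definition Dmax : matrix_ordering := fun m =>
  [set X | exists (r : nat) (a : 'M[R[i]]_(r, m)) (v : 'rV[V]_r),
     (forall i, C (v 0 i)) /\ X = mx_compress a (diag_mx v)].

Definition Cmax : matrix_ordering := fun m =>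
  [set X | mx_star X = X /\
     forall eps : R, 0 < eps -> Dmax (X + (eps%:C *: e)%:M)].

End Maximal.

Fact tower_size M (i : 'I_M) : (2 ^ i * 2 * 2 ^ (M - i.+1) = 2 ^ M)%N.
Proof. by rewrite -expnSr -expnD subnKC. Qed.

(* I_(2^i) (x) (u (+) v) (x) J_(2^(M-i-1)); the indices i start at 0. *)
Definition tower M (i : 'I_M) (u v : V) : 'M[V]_(2 ^ M) :=
  castmx (tower_size i, tower_size i)
    (kronr (kronl 1%:M (block_mx u%:M 0 0 v%:M : 'M[V]_(1 + 1)))
           (const_mx 1)).

Section Contractions.
Variables (C : matrix_ordering) (e : V).

Definition Pmx (q : seq V) (i : 'I_(size q)) : 'M[V]_(2 ^ size q) :=
  tower i q`_i (e - q`_i).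

Definition Qmx (q : seq V) (i : 'I_(size q)) : 'M[V]_(2 ^ size q) :=
  tower i (e - q`_i) q`_i.

Definition perturb (q : seq V) m (X : 'M[V]_(m * 2 ^ size q))
    (eps t : 'I_(size q) -> R) : 'M[V]_(m * 2 ^ size q) :=
  X + \sum_i kronl ((eps i)%:C)%:M (Pmx i) + \sum_i kronl ((t i)%:C)%:M (Qmx i).

(* One pair (eps i, t i) is replaced at a time, the others being kept, and    *)
(* the new eps' stays positive.                                               *)
Definition cone_of (q : seq V) m : set 'M[V]_(m * 2 ^ size q) :=
  [set X | mx_star X = X /\
     forall eps : 'I_(size q) -> R, (forall i, 0 < eps i) ->
     exists t : 'I_(size q) -> R,
       [/\ forall i, 0 < t i,
           C (perturb X eps t) &
           forall (i : 'I_(size q)) (eps' : R), 0 < eps' < eps i ->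
           exists t' : R, t i < t' /\
             C (perturb X [eta eps with i |-> eps'] [eta t with i |-> t'])]].

Definition cone_oo (q : seq V) : matrix_ordering := fun m =>
  [set X | forall eps : R, 0 < eps -> exists L : nat, (0 < L)%N /\
     cone_of (kronr (X + (eps%:C *: e)%:M)
                    (const_mx 1 : 'M_(2 ^ size (flatten (nseq L q)))))].

End Contractions.

Definition is_state (D : set V) (e : V) (phi : {scalar V}) :=
  (forall v, D v -> 0 <= phi v) /\ phi e = 1.

End MatrixOrderings.

Section Cones.
Variables (R : realType) (n k : nat).

Definition D_ns : set (Vns R n k) :=
  [set v | exists t : idx n k -> R,
     (forall i, 0 <= t i) /\ v = \sum_i (t i)%:C *: Qidx R i].

Definition matrix_D_ns : matrix_ordering (Vns R n k) :=
  Cmax (@star R n k) D_ns (e_ns R n k).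

(* s enumerates the generators. *)
Definition D_qc (s : seq (idx n k)) : set (Vns R n k) :=
  [set v | cone_oo (@star R n k) matrix_D_ns (e_ns R n k)
             [seq Qidx R i | i <- s] (const_mx v : 'M_1)].

End Cones.

(* The inner product is linear in its first argument. *)
Record hilbertSpace (R : realType) := HilbertSpace {
  hilbert_sort :> completeNormedModType R[i];
  hdot : {dot hilbert_sort for (@conjC R[i])};
  hdot_norm : forall u, `|u| ^+ 2 = hdot u u
}.

Section Operators.
Variables (R : realType) (H : hilbertSpace R).
Local Notation "''[' u , v ]" := (hdot H u v).

Definition bounded_operator (T : H -> H) :=
  linear T /\ exists M : R, forall u, `|T u| <= M%:C * `|u|.

Definition adjoint_of (T S : H -> H) := forall u v, '[T u, v] = '[u, S v].

Definition positive_operator (T : H -> H) := forall u, 0 <= '[T u, u].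

Definition projection (T : H -> H) := T \o T = T /\ adjoint_of T T.

(* C*-subalgebras of B(H): norm-closed *-subalgebras, not assumed unital *)
Record cstar_algebra (A : set (H -> H)) : Prop := CstarAlgebra {
  cstar_bounded : A `<=` bounded_operator;
  cstar0 : A (fun=> 0);
  cstarD : forall S T, A S -> A T -> A (fun u => S u + T u);
  cstarZ : forall (c : R[i]) T, A T -> A (fun u => c *: T u);
  cstarM : forall S T, A S -> A T -> A (S \o T);
  cstar_adj : forall T, A T -> exists2 S, adjoint_of T S & A S;
  cstar_closed : forall T, bounded_operator T ->
    (forall eps : R, 0 < eps ->
       exists2 S, A S & forall u, `|T u - S u| <= eps%:C * `|u|) ->
    A T
}.

(* The C*-algebra AB: for commuting A and B, the generated C*-algebra is the  *)
(* norm closure of the linear span of the products.                           *)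
Definition cstar_prod (A B : set (H -> H)) : set (H -> H) :=
  smallest cstar_algebra [set S \o T | S in A & T in B].

Definition cstar_state (A : set (H -> H)) (phi : (H -> H) -> R[i]) :=
  [/\ forall (c : R[i]) S T, A S -> A T ->
        phi (fun u => c *: S u + T u) = c * phi S + phi T,
      forall T, A T -> positive_operator T -> 0 <= phi T &
      phi idfun = 1].

Definition pvm (k : nat) (A : set (H -> H)) (E : 'I_k -> H -> H) :=
  [/\ forall a, A (E a), forall a, projection (E a) &
      forall u, \sum_a E a u = u].

End Operators.

Section Correlations.
Variables (R : realType) (n k : nat).

(* p a b x y stands for p(a, b | x, y). *)
Implicit Type p : 'I_k -> 'I_k -> 'I_n -> 'I_n -> R.

Definition correlation p :=
  (forall a b x y, 0 <= p a b x y) /\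
  (forall x y, \sum_a \sum_b p a b x y = 1).

Definition C_ns p :=
  [/\ correlation p,
      forall a x w w', \sum_d p a d x w = \sum_d p a d x w' &
      forall b y z z', \sum_c p c b z y = \sum_c p c b z' y].

Definition C_qc p :=
  correlation p /\
  exists (H : hilbertSpace R) (A B : set (H -> H))
         (E F : 'I_n -> 'I_k -> H -> H) (phi : (H -> H) -> R[i]),
    [/\ cstar_algebra A /\ cstar_algebra B,
        forall S T, A S -> B T -> S \o T = T \o S,
        (forall x, pvm A (E x)) /\ (forall y, pvm B (F y)),
        cstar_state (cstar_prod A B) phi &
        forall a b x y, (p a b x y)%:C = phi (E x a \o F y b)].

End Correlations.

(* Main.v *)
Require Import Defs.
From HB Require Import structures.
From mathcomp Require Import all_boot all_order all_algebra.
From mathcomp Require Import complex mxtens zify ring lra.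
From mathcomp Require Import boolp classical_sets functions reals topology
  normedtype.

Set Implicit Arguments.
Unset Strict Implicit.
Unset Printing Implicit Defensive.

Import Order.TTheory GRing.Theory Num.Theory.
Import numFieldNormedType.Exports.

Local Open Scope classical_set_scope.
Local Open Scope complex_scope.
Local Open Scope ring_scope.

(* A functional on the nonsignalling space is determined by its values on the  *)
(* generators, which gives the statement about C_ns at once.                  *)
(*                                                                            *)
(* From a quantum commuting model to a state: for commuting projections       *)
(* T_i = E_{x,a} F_{y,b} and a vector u, let xi_c be the image of u under the *)
(* product of the T_i or 1 - T_i chosen by the bits of c. Evaluating a matrix *)
(* of C(p_1, ..., p_N)^L on the vectors xi_c annihilates the terms in Q_i and *)
(* turns x (x) J into <x u, u>, which is therefore nonnegative.               *)
(*                                                                            *)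
(* From a state to a quantum commuting model: x (x) J + t sum_i Q_i in the    *)
(* maximal cone implies that x lies in D_qc, and J (x) e + t sum_i Q_i is an  *)
(* order unit for large t. Hence, for each L, a state on D_qc extends to a    *)
(* positive functional vanishing on every Q_i, that is, to positive           *)
(* semidefinite matrices G_i. By Cauchy-Schwarz the vanishing means that each *)
(* generator acts as a projection on the vectors indexed by words of length   *)
(* less than L in the generators, so that the G_i yield a kernel of moments   *)
(* of such words. An ultrafilter limit in L removes the bound on the length.  *)
(* On the reproducing kernel Hilbert space of the limit, whose elements are   *)
(* functions of words, the generator t acts by g(w) |-> g(t w), an idempotent *)
(* contraction, hence an orthogonal projection. The inner product is obtained *)
(* from the parallelogram law, and commuting C*-algebras from commutants.     *)


(** * Linear maps out of the nonsignalling space *)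

(** By the universal property [Vns_lift], linear maps out of the nonsignalling space are
    nonsignalling families indexed by the generators. As [D_ns] consists of the nonnegative
    combinations of generators, this settles the nonsignalling equivalence ([C_nsP]). The same
    property turns a quantum commuting model into a linear map v |-> [rep T v] into operators;
    [rep_Dqc] shows that it sends [D_qc] to positive operators, and composition with the state of
    the model gives the functional ([C_qc_state]).

    The converse rests on a sufficient condition for membership in [D_qc]: x (x) J plus a multiple
    of the sum of the Q_i lies in the maximal cone ([cone_of_intro], [state_ge0]). Multiples of J
    (x) e and of that sum dominate all Hermitian matrices ([order_unit]), so a finite-dimensional
    Hahn-Banach argument extends the state to matrices ([moment_matrices]). The extension is
    nonpositive on each Q_i, which forces bit i of an index to record the outcome of the measurement
    {q_i, e - q_i}. Adding up the basis vectors with prescribed bits gives a vector for each short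
    word, and the letters act on these as projections ([etaw_null]). Their Gram kernel has the
    required relations up to length L ([kern_moments]), and [moments_limit] removes L. The kernel
    finally yields a Hilbert space with projections T_t adding up to the identity for each pair of
    inputs; nonsignalling makes their marginals commute ([C_qc_moments], [C_qc_model]). *)

Section Nonsignalling.
Variables (n k : nat).

(** The values range over any commutative monoid because the notion is applied to the generators, to
    real moments and to vectors [T t u]. *)
Definition nonsignalling (W : nmodType) (T : idx n k -> W) :=
  (forall a x z w, \sum_c T (a, c, x, z) = \sum_c T (a, c, x, w)) /\
  (forall b y z w, \sum_d T (d, b, z, y) = \sum_d T (d, b, w, y)).

Lemma nonsignalling_unit (W : nmodType) (T : idx n k -> W) x y x' y' :
  nonsignalling T ->
  \sum_a \sum_b T (a, b, x, y) = \sum_a \sum_b T (a, b, x', y').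
Proof.
case=> TL TR; transitivity (\sum_a \sum_b T (a, b, x, y')).
  by apply: eq_bigr => a _; apply: TL.
by rewrite exchange_big [RHS]exchange_big; apply: eq_bigr => b _; apply: TR.
Qed.

End Nonsignalling.

Section Universal.
Variables (R : realType) (n k : nat).
Local Notation V := (Vns R n k).
Local Notation Qg := (@Qidx R n k).

Lemma QidxE t : Qg t = pi_quotv (Jns R n k) [ffun i => (i == t)%:R].
Proof. by case: t => -[[a b] x] y. Qed.

Lemma Vns_expand (v : V) : v = \sum_t (repr v : Vtilde R n k) t *: Qg t.
Proof.
rewrite -[LHS](pi_quotvK v); set w := repr v.
have -> : \sum_t (w : Vtilde R n k) t *: Qg t =
    pi_quotv (Jns R n k) (\sum_t (w : Vtilde R n k) t *: [ffun i =>
      (i == t)%:R]).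
  by rewrite linear_sum; apply: eq_bigr => t _; rewrite linearZ QidxE.
congr (pi_quotv _ _); apply/ffunP => i; rewrite sum_ffunE (bigD1 i)//= big1.
  by rewrite addr0 !ffunE eqxx /GRing.scale/= mulr1.
by move=> j ji; rewrite !ffunE eq_sym (negPf ji) scaler0.
Qed.

Lemma Q_nonsignalling : nonsignalling Qg.
Proof.
have eqJ (I : finType) (G H : I -> Vtilde R n k) :
    \sum_i G i - \sum_i H i \in Jns R n k ->
    \sum_i pi_quotv (Jns R n k) (G i) = \sum_i pi_quotv (Jns R n k) (H i).
  by move=> GH; rewrite -!raddf_sum; apply/eqP; rewrite pi_quotv_eq.
split=> [a x z w|b y z w]; apply: eqJ; apply: memv_span; rewrite !mem_cat.
  by apply/or3P/Or32/codomP; exists (a, x, z, w).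
by apply/or3P/Or33/codomP; exists (b, y, z, w).
Qed.

(** The linear extension to the free space kills the vectors spanning J: two families by hypothesis,
    and the unit relations because they follow from the marginal ones by changing one input at a
    time ([nonsignalling_unit]). *)
Lemma Vns_lift (W : lmodType R[i]) (T : idx n k -> W) : nonsignalling T ->
  exists2 f : V -> W, linear f & forall t, f (Qg t) = T t.
Proof.
move=> nsT; pose F (w : Vtilde R n k) := \sum_t w t *: T t.
have linF c u v : F (c *: u + v) = c *: F u + F v.
  rewrite /F scaler_sumr -big_split; apply: eq_bigr => t _.
  by rewrite !ffunE scalerDl scalerA.
have F0 : F 0 = 0 by rewrite /F big1// => t _; rewrite ffunE scale0r.
have FD u v : F (u + v) = F u + F v by rewrite -[u]scale1r linF !scale1r.
have FZ c u : F (c *: u) = c *: F u by rewrite -[c *: u]addr0 linF F0 addr0.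
have FB u v : F (u - v) = F u - F v by rewrite FD -[- v]scaleN1r FZ scaleN1r.
have Fsum (I : finType) (G : I ->
  Vtilde R n k) : F (\sum_i G i) = \sum_i F (G i).
  by apply: (big_morph F FD F0).
have FQ a b x y : F (Qtilde R a b x y) = T (a, b, x, y).
  rewrite /F (bigD1 (a, b, x, y))//= big1 ?addr0 ?ffunE ?eqxx ?scale1r//.
  by move=> t tn; rewrite ffunE (negPf tn) scale0r.
have FJ w : w \in Jns R n k -> F w = 0.
  rewrite [in _ \in _]/Jns => /coord_span ->; rewrite Fsum big1// => i _.
  rewrite FZ; set g := nth _ _ _.
  have : g \in codom (@Jgen_unit R n k) ++ codom (@Jgen_left R n k)
               ++ codom (@Jgen_right R n k).
    by apply: mem_nth; rewrite !size_cat !size_codom.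
  suff gF : forall g, g \in codom (@Jgen_unit R n k) ++ codom (@Jgen_left R n k)
               ++ codom (@Jgen_right R n k) -> F g = 0.
    by move/gF ->; rewrite scaler0.
  have Fsub u v (z : W) : F u = z -> F v = z -> F (u - v) = 0.
    by move=> uz vz; rewrite FB uz vz subrr.
  have F1 (I : finType) (G : I -> Vtilde R n k) (t : I -> idx n k) :
      (forall j, F (G j) = T (t j)) -> F (\sum_j G j) = \sum_j T (t j).
    by move=> FG; rewrite Fsum; apply: eq_bigr => j _; apply: FG.
  have F2 x y : F (\sum_a \sum_b Qtilde R a b x y) = \sum_a \sum_b T (a, b, x,
    y).
    by rewrite Fsum; apply: eq_bigr => a _; apply: F1 => b; apply: FQ.
  case: (nsT) => TL TR.
  move=> {}g; rewrite !mem_cat => /or3P[] /codomP[[[[a b] c] d] ->].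
  - by apply: Fsub (F2 a b) _; rewrite F2; apply: nonsignalling_unit.
  - apply: Fsub (F1 _ _ _ (fun e => FQ a e b c)) _.
    by rewrite (F1 _ _ _ (fun e => FQ a e b d)); apply: TL.
  - apply: Fsub (F1 _ _ _ (fun e => FQ e a c b)) _.
    by rewrite (F1 _ _ _ (fun e => FQ e a d b)); apply: TR.
have Frepr w : F (repr (pi_quotv (Jns R n k) w)) = F w.
  by apply/eqP; rewrite -subr_eq0 -FB FJ// -pi_quotv_eq pi_quotvK.
exists (fun v => F (repr v)).
  by move=> c u v; rewrite -linF -[X in F (repr X)]/(c *: u + v)
    -[u in LHS]pi_quotvK
    -[v in LHS]pi_quotvK -linearP Frepr.
by move=> [[[a b] x] y]; rewrite Frepr FQ.
Qed.

Lemma C_nsP (p : 'I_k -> 'I_k -> 'I_n -> 'I_n -> R) : (0 < n)%N ->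
  correlation p ->
  C_ns p <-> exists phi : {scalar V}, is_state (@D_ns R n k) (e_ns R n k) phi /\
       forall a b x y, (p a b x y)%:C = phi (Q R a b x y).
Proof.
move=> n_gt0 hp; have x0 := Ordinal n_gt0; split.
  move=> [_ pL pR].
  pose T (t : idx n k) : R[i]^o := (p t.1.1.1 t.1.1.2 t.1.2 t.2)%:C.
  have nsT : nonsignalling T.
    split=> [a x z w|b y z w]; rewrite -!(rmorph_sum (real_complex R))/=;
      congr (_%:C).
      exact: pL.
    exact: pR.
  have [f linf fQ] := Vns_lift nsT.
  pose phi : {scalar V} := HB.pack f (GRing.isLinear.Build _ _ _ _ f linf).
  have phiQ a b x y : phi (Q R a b x y) = (p a b x y)%:C := fQ (a, b, x, y).
  exists phi; split=> //; split=> [v [t [t0 ->]]|].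
    rewrite linear_sum; apply: sumr_ge0 => -[[[a b] x] y] _.
    by rewrite linearZ/= [X in _ * X](_ : _ = (p a b x y)%:C) ?mulr_ge0//
      ?ler0c ?t0 //; case: hp => p0 _; rewrite ?p0 //; apply: fQ (a, b, x, y).
  rewrite (e_nsE _ _ x0 x0) linear_sum.
  under eq_bigr do (rewrite linear_sum; under eq_bigr do rewrite phiQ).
  under eq_bigr do rewrite -rmorph_sum.
  by rewrite -rmorph_sum; case: hp => _ ->.
move=> [phi [_ phiQ]]; have [QL QR] := Q_nonsignalling.
split=> // [a x w w'|b y z z']; apply: (@complexI R); rewrite !rmorph_sum/=.
  transitivity (phi (\sum_d Qg (a, d, x, w))).
    by rewrite linear_sum; apply: eq_bigr => d _; apply: phiQ.
  by rewrite (QL _ _ _ w') linear_sum; apply: eq_bigr => d _; rewrite phiQ.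
transitivity (phi (\sum_c Qg (c, b, z, y))).
  by rewrite linear_sum; apply: eq_bigr => d _; apply: phiQ.
by rewrite (QR _ _ _ z') linear_sum; apply: eq_bigr => d _; rewrite phiQ.
Qed.

End Universal.

(** * The reproducing kernel Hilbert space of a real kernel *)

Section KernelSpace.
Variables (R : realType) (W : Type).

(** A list of weighted points is a formal linear combination of points of [W], and this is the
    bilinear extension of the kernel. Equal combinations need not be identified, since only their
    values matter. *)
Definition kform (m : W -> W -> R) (l l' : seq (R * W)) : R :=
  \sum_(z <- l) \sum_(z' <- l') z.1 * z'.1 * m z.2 z'.2.

Record psd_kernel := PsdKernel {
  kfun :> W -> W -> R;
  kfunC : forall x y, kfun x y = kfun y x;
  kform_ge0 : forall l, 0 <= kform kfun l l
}.

Definition lscale (c : R) (l : seq (R * W)) := [seq (c * z.1, z.2) | z <- l].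

Definition leval (l : seq (R * W)) (g : W -> R) := \sum_(z <- l) z.1 * g z.2.

Lemma leval_cat l l' g : leval (l ++ l') g = leval l g + leval l' g.
Proof. by rewrite /leval big_cat. Qed.

Lemma leval_scale c l g : leval (lscale c l) g = c * leval l g.
Proof.
by rewrite /leval big_map mulr_sumr; apply: eq_bigr => z _; rewrite mulrA.
Qed.

Lemma levalD l g h : leval l (g + h) = leval l g + leval l h.
Proof. by rewrite /leval -big_split; apply: eq_bigr => z _;
  rewrite /= -mulrDr. Qed.

Lemma levalB l g h : leval l (g - h) = leval l g - leval l h.
Proof. by rewrite /leval -sumrB; apply: eq_bigr => z _; rewrite -mulrBr. Qed.

Lemma levalZ l c (g : W -> R^o) : leval l (c *: g) = c * leval l g.
Proof.
by rewrite /leval mulr_sumr; apply: eq_bigr => z _; rewrite mulrCA.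
Qed.

Variable m : psd_kernel.
Local Notation K := (kform m).

Lemma kformC l l' : K l l' = K l' l.
Proof.
rewrite /kform exchange_big; apply: eq_bigr => z _; apply: eq_bigr => z' _.
by rewrite kfunC [z'.1 * _]mulrC.
Qed.

Lemma kformDl l1 l2 l : K (l1 ++ l2) l = K l1 l + K l2 l.
Proof. by rewrite /kform big_cat. Qed.

Lemma kformDr l1 l2 l : K l (l1 ++ l2) = K l l1 + K l l2.
Proof. by rewrite kformC kformDl ![K l _]kformC. Qed.

Lemma kformZl c l l' : K (lscale c l) l' = c * K l l'.
Proof.
rewrite /kform big_map mulr_sumr; apply: eq_bigr => z _ /=.
by rewrite mulr_sumr; apply: eq_bigr => z' _; rewrite !mulrA.
Qed.

Lemma kformZr c l l' : K l (lscale c l') = c * K l l'.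
Proof. by rewrite kformC kformZl kformC. Qed.

Definition kE := (kformDl, kformDr, kformZl, kformZr, leval_cat, leval_scale).

(* The squared norm of the functional [l |-> leval l g] for the seminorm       *)
(* [sqrt (K l l)], as the Legendre transform of [K].                           *)
Definition kbound (g : W -> R) (M : R) := forall l, 2 * leval l g - K l l <= M.

Definition ksq (g : W -> R) := sup [set 2 * leval l g - K l l | l in setT].

Definition kbounded (g : W -> R^o) := `[< exists M, kbound g M >].

Lemma ksq_le g M : kbound g M -> ksq g <= M.
Proof.
move=> gM; apply: ge_sup; first by exists (2 * leval [::] g - K [::] [::]),
  [::].
by move=> _ [l _ <-]; apply: gM.
Qed.

Lemma ksq_ub g : kbounded g -> kbound g (ksq g).
Proof.
move/asboolP => [M gM] l; apply: ub_le_sup; last by exists l.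
by exists M => _ [l' _ <-]; apply: gM.
Qed.

Lemma kboundedI g M : kbound g M -> kbounded g.
Proof. by move=> gM; apply/asboolP; exists M. Qed.

Lemma kbound_scale (g : W -> R^o) c M : kbound g M ->
  kbound (c *: g) (c ^+ 2 * M).
Proof.
move=> gM l; rewrite levalZ; have [->|c0] := eqVneq c 0.
  by rewrite !mul0r mulr0 expr0n/= mul0r sub0r oppr_le0 kform_ge0.
have := gM (lscale c^-1 l); rewrite !kE => H.
have -> : 2 * (c * leval l g) - K l l =
  c ^+ 2 * (2 * (c^-1 * leval l g) - c^-1 * (c^-1 * K l l)) by field.
by rewrite ler_pM2l// exprn_even_gt0.
Qed.

(* The bounds are applied at [(u + v) / 2] and [(u - v) / 2]. *)
Lemma kbound_parallelogram (g h : W -> R^o) M N : kbound g M -> kbound h N ->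
  forall u v, (2 * leval u (g + h) - K u u) + (2 * leval v (g - h) - K v v)
     <= 2 * M + 2 * N.
Proof.
move=> gM hN u v; rewrite levalD levalB.
have := gM (lscale 2^-1 (u ++ v)).
have := hN (lscale 2^-1 (u ++ lscale (-1) v)).
rewrite !kE [K v u]kformC; lra.
Qed.

Lemma kbounded_submod : submod_closed kbounded.
Proof.
split=> [|c g h /asboolP[M gM] /asboolP[N hN]]; apply/asboolP.
  exists 0 => l; rewrite /leval big1 ?mulr0 ?sub0r ?oppr_le0 ?kform_ge0// =>
    z _.
  by rewrite mulr0.
exists (2 * (c ^+ 2 * M) + 2 * N) => l.
have := kbound_parallelogram (kbound_scale c gM) hN l [::].
by rewrite [leval [::] _]big_nil [K [::] [::]]big_nil mulr0 subr0 addr0.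
Qed.

HB.instance Definition _ := GRing.isSubmodClosed.Build R (W -> R^o) kbounded
  kbounded_submod.

(** The reproducing kernel space is realised as functions on [W] inducing a bounded functional on
    formal combinations, which avoids quotienting by null combinations and completing. *)
Record rkhs := Rkhs { rk_fun :> W -> R^o; _ : rk_fun \in kbounded }.
HB.instance Definition _ := [isSub for rk_fun].
HB.instance Definition _ := [Choice of rkhs by <:].
HB.instance Definition _ := [SubChoice_isSubLmodule of rkhs by <:].

End KernelSpace.

(** * An inner product from the parallelogram law *)

Section AdditiveBounded.
Variable R : realType.

(** The additive function g(x) = f(x) - x f(1) vanishes on integers, so its bound on [0, 1) holds
    everywhere. A bounded additive function is zero, because g(n x) = n g(x). *)
Lemma additive_bounded_linear (f : R -> R) (C : R) :
  {morph f : x y / x + y} -> (forall x, `|x| <= 1 -> `|f x| <= C) ->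
  forall x, f x = x * f 1.
Proof.
move=> fD fC x; pose g y := f y - y * f 1.
have gB : zmod_morphism g.
  move=> y z; have : f (y - z) + f z = f y by rewrite -fD subrK.
  by rewrite /g => <-; ring.
pose G : {additive R -> R} := HB.pack g (GRing.isZmodMorphism.Build _ _ g gB).
have C0 : 0 <= C by apply: le_trans (fC 0 _); rewrite ?normr0.
have gC y : `|g y| <= C + C.
  have -> : g y = g (y - (Num.floor y)%:~R).
    rewrite gB [X in _ - X](_ : _ = 0) ?subr0//.
    by rewrite -[g _]/(G _) raddfMz/= /g mul1r subrr mul0rz.
  have /andP[y0 y1] := floor_itv y; rewrite intrD in y1.
  set t := y - _; have t1 : `|t| <= 1 by rewrite /t ger0_norm ?subr_ge0//; lra.
  rewrite /g (le_trans (ler_normB _ _))// lerD ?fC// normrM.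
  by apply: le_trans (fC 1 _); rewrite ?normr1// ler_piMl.
suff : g x == 0 by rewrite subr_eq0 => /eqP.
rewrite -normr_eq0; apply: contraT; rewrite -normr_gt0 normr_id => gx0.
have [n nC] : exists n : nat, C + C < n%:R * `|g x|.
  exists (Num.bound ((C + C) / `|g x|)).
  by rewrite -ltr_pdivrMr// archi_boundP// divr_ge0 ?addr_ge0.
apply: contraTT (gC (x *+ n)) => _; rewrite -ltNge.
have -> : g (x *+ n) = g x *+ n by exact: (raddfMn G).
by rewrite normrMn -mulr_natl.
Qed.

End AdditiveBounded.

Section JordanVonNeumann.
Variables (R : realType) (E : lmodType R) (q : E -> R).

Lemma addr_addB (x y : E) : (x + y) + (x - y) = 2 *: x.
Proof. by rewrite addrACA subrr addr0 scaler_nat. Qed.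

Lemma addr_subB (x y : E) : (x + y) - (x - y) = 2 *: y.
Proof. by rewrite opprB addrC addrA subrK scaler_nat. Qed.

Hypothesis qZ : forall c x, q (c *: x) = c ^+ 2 * q x.
Hypothesis qP : forall x y, q (x + y) + q (x - y) = 2 * q x + 2 * q y.
Hypothesis q_ge0 : forall x, 0 <= q x.

Definition polar (x y : E) : R := (q (x + y) - q (x - y)) / 4.

Lemma polarN x : q (- x) = q x.
Proof. by rewrite -scaleN1r qZ sqrrN expr1n mul1r. Qed.

Lemma polarC x y : polar x y = polar y x.
Proof. by rewrite /polar [y + x]addrC -(polarN (y - x)) opprB. Qed.

Lemma polarxx x : polar x x = q x.
Proof.
have -> : polar x x = (q (2 *: x) - q (0 *: x)) / 4.
  by rewrite scaler_nat mulr2n scale0r -(subrr x).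
by rewrite !qZ; lra.
Qed.

(** For fixed z, the difference [D] satisfies Jensen's equation D(u + v) + D(u - v) = 2 D(u) and
    D(0) = 0. Taking u and v to be the half sum and half difference of x and y gives additivity. *)
Lemma polarDl x y z : polar (x + y) z = polar x z + polar y z.
Proof.
pose D u := q (u + z) - q (u - z).
have DD u v : D (u + v) + D (u - v) = 2 * D u.
  have := qP (u + z) v; have := qP (u - z) v; rewrite /D.
  by rewrite ![u + z + _]addrAC ![u - z + _]addrAC; lra.
have D0 : D 0 = 0 by rewrite /D add0r sub0r polarN subrr.
have D2 u : D (2 *: u) = 2 * D u.
  by rewrite -(DD u u) subrr D0 addr0 scaler_nat mulr2n.
have : D (x + y) = D x + D y.
  have := DD (2^-1 *: (x + y)) (2^-1 *: (x - y)).
  rewrite -scalerDr -scalerBr addr_addB addr_subB !scalerA mulVf ?pnatr_eq0//.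
  by rewrite !scale1r -D2 scalerA divff ?pnatr_eq0// scale1r => ->.
by rewrite /polar /D; lra.
Qed.

(** The map c |-> [polar (c *: x) y] is additive, and the parallelogram law bounds it by [q x + q y]
    on [-1, 1], so it is linear. *)
Lemma polarZl c x y : polar (c *: x) y = c * polar x y.
Proof.
have -> := @additive_bounded_linear _ (fun c => polar (c *: x) y) (q x + q y).
- by rewrite scale1r.
- by move=> a b; rewrite scalerDl polarDl.
move=> a a1; have := qP (a *: x) y; rewrite qZ.
have a2 : a ^+ 2 <= 1 by rewrite -real_normK ?num_real// expr_le1.
have : a ^+ 2 * q x <= q x by rewrite ler_piMl.
have := q_ge0 (a *: x + y); have := q_ge0 (a *: x - y).
by move=> ? ? ? ?; rewrite ler_norml /polar; apply/andP; split; lra.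
Qed.

End JordanVonNeumann.

(** * Real Hilbert spaces and completeness of the kernel space *)

Section RealHilbert.

(** Completeness is phrased with filters and squared distances, so that a topology is only
    introduced on the complexification. *)
Record real_hilbert (R : realType) := RealHilbert {
  rh_sort :> lmodType R;
  rdot : rh_sort -> rh_sort -> R;
  rdotC : forall x y, rdot x y = rdot y x;
  rdotDl : forall x y z, rdot (x + y) z = rdot x z + rdot y z;
  rdotZl : forall c x y, rdot (c *: x) y = c * rdot x y;
  rdot_ge0 : forall x, 0 <= rdot x x;
  rdot_eq0 : forall x, rdot x x = 0 -> x = 0;
  rdot_complete : forall F : set_system rh_sort, ProperFilter F ->
    (forall e : R, 0 < e -> exists x,
      F [set y | rdot (y - x) (y - x) <= e ^+ 2]) ->
    exists x, forall e : R, 0 < e -> F [set y | rdot (y - x) (y - x) <= e ^+ 2]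
}.

Variables (R : realType) (W : Type) (m : psd_kernel R W).
Local Notation K := (kform m).
Local Notation E := (rkhs m).
Definition rsq (g : E) := ksq m g.
Local Notation q := rsq.

Lemma rkhs_bounded (g : E) : kbounded m g.
Proof. exact: valP g. Qed.

Lemma rkhs_ub (g : E) : kbound m g (q g).
Proof. exact/ksq_ub/rkhs_bounded. Qed.

Lemma ksq_ge0 (g : E) : 0 <= q g.
Proof. by have := rkhs_ub g [::]; rewrite /leval /kform !big_nil; lra. Qed.

Lemma ksqZ_le c (g : E) : q (c *: g) <= c ^+ 2 * q g.
Proof. by apply: ksq_le; apply: kbound_scale; apply: rkhs_ub. Qed.

Lemma ksqZ c (g : E) : q (c *: g) = c ^+ 2 * q g.
Proof.
apply/eqP; rewrite eq_le ksqZ_le/=; have [->|c0] := eqVneq c 0.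
  by rewrite expr0n mul0r scale0r ksq_ge0.
have := ksqZ_le c^-1 (c *: g); rewrite scalerA mulVf// scale1r exprVn.
by rewrite ler_pdivlMl// exprn_even_gt0.
Qed.

Lemma ksq_parallelogram_le (g h : E) : q (g + h) + q (g - h)
  <= 2 * q g + 2 * q h.
Proof.
have P := kbound_parallelogram (rkhs_ub g) (rkhs_ub h).
rewrite -lerBrDr; apply: ksq_le => u; rewrite lerBrDl -lerBrDr.
by apply: ksq_le => v; rewrite lerBrDl; apply: P.
Qed.

(** The reverse inequality is the direct one applied to [g + h] and [g - h], whose sum and
    difference are 2 g and 2 h. *)
Lemma ksq_parallelogram (g h : E) : q (g + h) + q (g - h) = 2 * q g + 2 * q h.
Proof.
apply/eqP; rewrite eq_le ksq_parallelogram_le/=.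
have := ksq_parallelogram_le (g + h) (g - h).
by rewrite addr_addB addr_subB !ksqZ; lra.
Qed.

(** Evaluation at a point is continuous: test the bound on the point [w] alone, with weight e or -e
    according to the sign of [g w]. *)
Lemma ksq_eval (g : E) e w : 0 < e -> q g <= e ^+ 2 ->
  `|g w| <= e * ((1 + m w w) / 2).
Proof.
move=> e0 ge; have Hc c : 2 * (c * g w) - c * (c * m w w) <= e ^+ 2.
  have := le_trans (rkhs_ub g [:: (c, w)]) ge.
  by rewrite /leval /kform !big_seq1/= !mulrA.
have m0 : 0 <= m w w.
  by have := kform_ge0 m [:: (1, w)]; rewrite /kform !big_seq1/= !mul1r.
have [g0|g0] := leP 0 (g w).
  have := Hc e; have -> : 2 * (e * g w) - e * (e * m w w)
    = e * (2 * g w - e * m w w) by ring.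
  by rewrite expr2 ler_pM2l// ger0_norm//; lra.
have := Hc (- e); have -> : 2 * (- e * g w) - - e * (- e * m w w) =
  e * (- 2 * g w - e * m w w) by ring.
by rewrite expr2 ler_pM2l// ltr0_norm//; lra.
Qed.

Lemma ksq_eq0 (g : E) : q g = 0 -> g = 0.
Proof.
move=> g0; apply/val_inj/funext => w /=; apply/eqP; rewrite -normr_le0.
have m0 : 0 <= m w w.
  by have := kform_ge0 m [:: (1, w)]; rewrite /kform !big_seq1/= !mul1r.
apply/ler_addgt0Pl => e e0; rewrite addr0.
have := @ksq_eval g (e / ((1 + m w w) / 2)) w.
by rewrite divfK ?gt_eqF//; [apply; rewrite ?g0 ?sqr_ge0// divr_gt0//|]; lra.
Qed.

Lemma leval_cvg (F : set_system E) (FF : ProperFilter F) (h : W -> R) :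
  (forall w, (g w : R) @[g --> F] --> (h w : R)) ->
  forall l, leval l g @[g --> F] --> leval l h.
Proof.
move=> Fh; elim=> [|z l IH].
  under eq_cvg do rewrite /leval big_nil.
  by rewrite /leval big_nil; exact: cvg_cst.
under eq_cvg do rewrite /leval big_cons.
rewrite /leval big_cons; apply: cvgD IH.
by apply: cvgMl_tmp; apply: Fh.
Qed.

Lemma half_sq_le (e a b c d : R) : a <= (e / 2) ^+ 2 -> b <= (e / 2) ^+ 2 ->
  0 <= d -> d + c <= 2 * a + 2 * b -> c <= e ^+ 2.
Proof. by lra. Qed.

(** A Cauchy filter converges pointwise by [ksq_eval]. For each fixed combination l the inequality
    defining [kbound] passes to the pointwise limit, which is therefore a bounded function and a
    limit in norm. *)
Lemma rkhs_complete (F : set_system E) : ProperFilter F ->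
  (forall e : R, 0 < e -> exists x, F [set y : E | q (y - x) <= e ^+ 2]) ->
  exists x, forall e : R, 0 < e -> F [set y : E | q (y - x) <= e ^+ 2].
Proof.
move=> FF Fc.
have Fw w : cvg ((g w : R) @[g --> F]).
  apply: R_complete; apply: cauchy_exP => e e0.
  have m0 : 0 < (1 + m w w) / 2.
    by have := kform_ge0 m [:: (1, w)]; rewrite /kform !big_seq1/= !mul1r; lra.
  have [x Fx] := Fc (e / 2 / ((1 + m w w) / 2))
    (divr_gt0 (divr_gt0 e0 (ltr0Sn R 1)) m0).
  exists (x w); suff : F [set y : E | ball (x w : R) e (y w)] by [].
  apply: filterS Fx => y /= yx; rewrite /ball/= distrC.
  have := ksq_eval w (divr_gt0 (divr_gt0 e0 (ltr0Sn R 1)) m0) yx.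
  by rewrite divfK ?gt_eqF// => /le_lt_trans; apply; lra.
pose h : W -> R^o := fun w => lim ((g w : R) @[g --> F]).
have Fl l : leval l (g : E) @[g --> F] --> leval l h.
  by apply: leval_cvg => w; apply: Fw.
have near_h e x : F [set y : E | q (y - x) <= e ^+ 2] ->
  kbound m (h - x) (e ^+ 2).
  move=> Fx l; rewrite levalB.
  have cv : (2 * (leval l (y : E) - leval l x) - K l l : R) @[y --> F]
      --> (2 * (leval l h - leval l x) - K l l : R).
    by apply: cvgB; [apply: cvgMl_tmp; apply: cvgB => //;
      exact: cvg_cst|exact: cvg_cst].
  apply: (cvgr_to_le cv); apply: filterS Fx => y /= yx; rewrite -levalB.
  exact: le_trans (rkhs_ub (y - x) l) yx.
have hb : kbounded m h.
  have [x Fx] := Fc 1 ltr01.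
  have /kboundedI hx := near_h _ _ Fx.
  rewrite -(subrK (x : W -> R^o) h); apply: (rpredD (V := W -> R^o)) => //.
  exact: rkhs_bounded.
exists (Rkhs hb) => e e0.
have [x Fx] := Fc (e / 2) (divr_gt0 e0 (ltr0Sn R 1)).
have hx : q (Rkhs hb - x) <= (e / 2) ^+ 2 by exact/ksq_le/near_h.
apply: filterS Fx => y /= yx.
have : y - x - (Rkhs hb - x) = y - Rkhs hb by rewrite opprB addrA subrK.
move=> /(congr1 rsq) <-; apply: half_sq_le yx hx (ksq_ge0 _) _.
exact: ksq_parallelogram_le.
Qed.

Definition rkhs_hilbert : real_hilbert R.
Proof.
apply: (@RealHilbert R E (polar q)).
- by apply: polarC => *; apply: ksqZ.
- by apply: polarDl => *; [apply: ksqZ|apply: ksq_parallelogram].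
- by apply: polarZl => *; [apply: ksqZ|apply: ksq_parallelogram|apply: ksq_ge0].
- by move=> x; rewrite polarxx ?ksq_ge0//; exact: ksqZ.
- by move=> x; rewrite polarxx; [exact: ksq_eq0|exact: ksqZ].
- move=> F FF; have qE x : polar q x x = q x by apply: polarxx; exact: ksqZ.
  have setE (x : E) e : [set y : E | polar q (y - x) (y - x) <= e ^+ 2] =
      [set y : E | q (y - x) <= e ^+ 2].
    by apply/seteqP; split=> y /=; rewrite qE.
  move=> Fc; have [e e0|x Fx] := @rkhs_complete F FF.
    by have [x Fx] := Fc e e0; exists x; rewrite -setE.
  by exists x => e e0; rewrite setE; apply: Fx.
Defined.

End RealHilbert.

Section RealHilbertTheory.
Variables (R : realType) (E : real_hilbert R).
Local Notation r := (@rdot R E).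

Lemma rdotDr (x y z : E) : r x (y + z) = r x y + r x z.
Proof. by rewrite ![r x _]rdotC rdotDl. Qed.

Lemma rdotZr c (x y : E) : r x (c *: y) = c * r x y.
Proof. by rewrite ![r x _]rdotC rdotZl. Qed.

Lemma rdotNl (x y : E) : r (- x) y = - r x y.
Proof. by rewrite -scaleN1r rdotZl mulN1r. Qed.

Lemma rdotNr (x y : E) : r x (- y) = - r x y.
Proof. by rewrite -scaleN1r rdotZr mulN1r. Qed.

Definition rdotE := (rdotDl, rdotDr, rdotZl, rdotZr, rdotNl, rdotNr).

End RealHilbertTheory.

(** * Complexification of a real Hilbert space *)

Section Complexification.
Variables (R : realType) (E : real_hilbert R).
Local Notation r := (@rdot R E).

(** The pair (x, y) stands for x + i y. *)
Definition cplx : Type := (E * E)%type.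
HB.instance Definition _ := GRing.Zmodule.copy cplx (E * E)%type.

Implicit Types (u v w : cplx) (c d : R[i]).

Definition cscale c u : cplx :=
  (complex.Re c *: u.1 - complex.Im c *: u.2,
   complex.Re c *: u.2 + complex.Im c *: u.1).

Fact cscaleA c d u : cscale c (cscale d u) = cscale (c * d) u.
Proof.
case: c d => a b [a' b']; rewrite /cscale/=; congr pair.
  rewrite scalerBr scalerDr !scalerA scalerBl scalerDl !opprD.
  by rewrite [- _ - _ in LHS]addrC addrACA.
rewrite scalerBr scalerDr !scalerA scalerBl scalerDl.
by rewrite [X in _ + X]addrC addrACA.
Qed.

Fact cscale1 : left_id 1 cscale.
Proof. by case=> x y; rewrite /cscale/= !scale1r !scale0r subr0 addr0. Qed.

Fact cscaleDr : right_distributive cscale +%R.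
Proof.
move=> c [x y] [x' y']; rewrite /cscale/=; congr pair => /=.
  by rewrite !scalerDr opprD addrACA.
by rewrite !scalerDr addrACA.
Qed.

Fact cscaleDl u : {morph cscale^~ u : c d / c + d}.
Proof.
move=> [a b] [a' b']; rewrite /cscale/=; congr pair => /=.
  by rewrite !scalerDl opprD addrACA.
by rewrite !scalerDl addrACA.
Qed.

HB.instance Definition _ := GRing.Zmodule_isLmodule.Build R[i] cplx
  cscaleA cscale1 cscaleDr cscaleDl.

Definition csq u : R := r u.1 u.1 + r u.2 u.2.

Definition cdot u v : R[i] :=
  (r u.1 v.1 + r u.2 v.2) +i* (r u.2 v.1 - r u.1 v.2).

Definition cnorm u : R[i] := (Num.sqrt (csq u))%:C.

Lemma csq_ge0 u : 0 <= csq u. Proof. by rewrite addr_ge0 ?rdot_ge0. Qed.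

Lemma csqZ c u : csq (c *: u) = (complex.Re c ^+ 2 + complex.Im c ^+ 2) * csq u.
Proof.
rewrite /csq/= !rdotE [r u.2 u.1]rdotC; ring.
Qed.

Lemma csq_eq0 u : csq u = 0 -> u = 0.
Proof.
case: u => x y /eqP; rewrite paddr_eq0 ?rdot_ge0//= => /andP[/eqP x0 /eqP y0].
by rewrite (rdot_eq0 x0) (rdot_eq0 y0).
Qed.

Lemma sqrt_csqD u v :
  Num.sqrt (csq (u + v)) <= Num.sqrt (csq u) + Num.sqrt (csq v).
Proof.
pose P := r u.1 v.1 + r u.2 v.2.
have sqD t : csq u + 2 * t * P + t ^+ 2 * csq v >= 0.
  have := csq_ge0 (u + t%:C *: v).
  rewrite /csq/= !scale0r !subr0 !addr0 !rdotE [r v.1 _]rdotC [r v.2 _]rdotC /P.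
  by rewrite [X in 0 <= X -> _](_ : _ = csq u + 2 * t * P + t ^+ 2 * csq v)//
    /csq /P; ring.
(* Cauchy-Schwarz for the real part [P] of the inner product: the quadratic of [sqD] is evaluated at
   its minimum t = - P / csq v. *)
have CS : P ^+ 2 <= csq u * csq v.
  have [v0|v0] := eqVneq (csq v) 0.
    have -> : P = 0; last by rewrite expr0n/= v0 mulr0.
    by rewrite /P (csq_eq0 v0) /= -(scale0r (0 : E)) !rdotE !mul0r addr0.
  have vgt0 : 0 < csq v by rewrite lt_neqAle eq_sym v0 csq_ge0.
  have := sqD (- P / csq v); rewrite -(pmulr_lge0 _ vgt0).
  rewrite [X in 0 <= X -> _](_ : _ = csq u * csq v - P ^+ 2) ?subr_ge0//.
  by field.
rewrite -(@ler_pXn2r _ 2)// ?nnegrE ?addr_ge0 ?sqrtr_ge0//.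
rewrite sqrrD !sqr_sqrtr ?csq_ge0//.
have -> : csq (u + v) = csq u + P *+ 2 + csq v.
  by rewrite /csq/= !rdotE [r v.1 _]rdotC [r v.2 _]rdotC /P; ring.
rewrite lerD2r lerD2l lerMn2r orbC -sqrtrM ?csq_ge0//.
by rewrite (le_trans (ler_norm _))// -sqrtr_sqr ler_wsqrtr.
Qed.

Fact cnormD u v : cnorm (u + v) <= cnorm u + cnorm v.
Proof. by rewrite /cnorm -rmorphD/= lecR sqrt_csqD. Qed.

Fact cnormZ c u : cnorm (c *: u) = `|c| * cnorm u.
Proof.
rewrite /cnorm csqZ sqrtrM ?addr_ge0 ?sqr_ge0// rmorphM/=; congr (_ * _).
by case: c => a b; rewrite normc_def.
Qed.

Fact cnorm0_eq0 u : cnorm u = 0 -> u = 0.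
Proof.
move/complexI => /eqP; rewrite sqrtr_eq0 => u0.
by apply: csq_eq0; apply/eqP; rewrite eq_le u0 csq_ge0.
Qed.

HB.instance Definition _ := Lmodule_isNormed.Build R[i] cplx
  cnormD cnormZ cnorm0_eq0.

Lemma cnormE u : `|u| = (Num.sqrt (csq u))%:C. Proof. by []. Qed.

Lemma norm_sqE u : `|u| ^+ 2 = (csq u)%:C.
Proof. by rewrite cnormE -rmorphXn/= sqr_sqrtr ?csq_ge0. Qed.

Lemma cplx_complete (F : set_system cplx) : ProperFilter F -> cauchy F -> cvg F.
Proof.
move=> FF /cauchyP Fc.
have {}Fc (e : R) : 0 < e -> exists u, F [set v | csq (v - u) <= e ^+ 2].
  move=> e0; have [|u Fu] := Fc e%:C; first by rewrite ltcR.
  exists u; apply: filterS Fu => v; rewrite -ball_normE/= cnormE ltcR => uv.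
  have -> : csq (v - u) = csq (u - v).
    by rewrite -[v - u]opprB -scaleN1r csqZ/=; ring.
  by rewrite -(sqr_sqrtr (csq_ge0 _)) ler_pXn2r ?nnegrE ?sqrtr_ge0 ?ltW.
have [x Fx] : exists x, forall e : R, 0 < e -> 
    F [set v : cplx | r (v.1 - x) (v.1 - x) <= e ^+ 2].
  apply: (rdot_complete (F := fmap (fun v : cplx => v.1) F)) => e e0.
  have [u Fu] := Fc e e0; exists u.1.
  suff : F [set v : cplx | r (v.1 - u.1) (v.1 - u.1) <= e ^+ 2] by [].
  apply: filterS Fu => v /=.
  by apply: le_trans; rewrite /csq/= lerDl rdot_ge0.
have [y Fy] : exists y, forall e : R, 0 < e -> 
    F [set v : cplx | r (v.2 - y) (v.2 - y) <= e ^+ 2].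
  apply: (rdot_complete (F := fmap (fun v : cplx => v.2) F)) => e e0.
  have [u Fu] := Fc e e0; exists u.2.
  suff : F [set v : cplx | r (v.2 - u.2) (v.2 - u.2) <= e ^+ 2] by [].
  apply: filterS Fu => v /=.
  by apply: le_trans; rewrite /csq/= lerDr rdot_ge0.
apply/cvg_ex; exists ((x, y) : cplx); apply/cvgrPdist_lt => -[e e'].
rewrite ltcE/= => /andP[/eqP -> e0].
have e20 : 0 < e / 2 by rewrite divr_gt0.
near=> v; rewrite distrC cnormE -[_ +i* 0]/(e%:C) ltcR.
rewrite -[e in _ < e]ger0_norm ?(ltW e0)// -sqrtr_sqr ltr_sqrt ?exprn_gt0//.
have v1 : r (v.1 - x) (v.1 - x) <= (e / 2) ^+ 2 by near: v; apply: Fx.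
have v2 : r (v.2 - y) (v.2 - y) <= (e / 2) ^+ 2 by near: v; apply: Fy.
rewrite /csq/=; apply: le_lt_trans (lerD v1 v2) _.
have : 0 < e ^+ 2 by rewrite exprn_gt0.
by rewrite expr_div_n; lra.
Unshelve. all: by end_near. Qed.

HB.instance Definition _ := Uniform_isComplete.Build cplx cplx_complete.

Fact cdot_hermitian u v : cdot u v = (-1) ^+ false * (cdot v u)^*.
Proof.
rewrite expr0 mul1r /cdot/=; congr Complex.
  by rewrite rdotC [r u.2 _]rdotC.
by rewrite opprB [r u.2 _]rdotC [r u.1 _]rdotC.
Qed.

Fact cdot_linearl v : linear_for *%R (cdot^~ v).
Proof.
move=> [a b] u w; apply/eqP; rewrite eq_complex /cdot/= !rdotE; apply/andP.
by split; apply/eqP; ring.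
Qed.

Fact cdot_linearr u : linear_for (@Num.conj R[i] \; *%R) (cdot u).
Proof.
move=> c v w; rewrite cdot_hermitian cdot_linearl/= [cdot u v]cdot_hermitian.
by rewrite [cdot u w]cdot_hermitian !expr0 !mul1r rmorphD rmorphM.
Qed.

Fact cdot_gt0 u : u != 0 -> 0 < cdot u u.
Proof.
move=> u0; rewrite /cdot [r u.2 u.1]rdotC subrr -[_ +i* 0]/((csq u)%:C) ltcR.
rewrite lt_neqAle csq_ge0 andbT eq_sym; apply: contra_neq u0; exact: csq_eq0.
Qed.

HB.instance Definition _ := bilinear_isBilinear.Build R[i] cplx cplx R[i]
  *%R (@Num.conj R[i] \; *%R) cdot (cdot_linearl, cdot_linearr).
HB.instance Definition _ := isHermitianSesquilinear.Build R[i] cplx false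
  (@Num.conj R[i]) cdot cdot_hermitian.
HB.instance Definition _ := isDotProduct.Build R[i] cplx cdot cdot_gt0.

Lemma cdot_norm u : `|u| ^+ 2 = cdot u u.
Proof. by rewrite norm_sqE /cdot [r u.2 u.1]rdotC subrr. Qed.

Definition cplx_hilbert : hilbertSpace R := @HilbertSpace R cplx cdot cdot_norm.

End Complexification.

(** * Commutants and commuting projection-valued measures *)

Section HilbertOperators.
Variables (R : realType) (H : hilbertSpace R).
Local Notation "''[' u , v ]" := (hdot H u v).
Implicit Types (T S : H -> H) (u v : H).

Lemma ge0_complexE (c : R[i]) : 0 <= c -> exists2 x : R, 0 <= x & c = x%:C.
Proof.
by case: c => a b; rewrite lecE/= => /andP[/eqP -> a0]; exists a.
Qed.

Lemma hdotC u v : '[u, v] = ('[v, u])^*%C.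
Proof. by have := @hermitian_subproof _ _ _ _ (hdot H) u v;
  rewrite expr0 mul1r. Qed.

Lemma hdot_eq0 u : (forall v, '[u, v] = 0) -> u = 0.
Proof.
move=> u0; apply/eqP; apply: contraT => un0.
have : 0 < '[u, u] by exact: neq0_dnorm_gt0.
by rewrite u0 ltxx.
Qed.

Lemma hdot_eqr u v : (forall w, '[w, u] = '[w, v]) -> u = v.
Proof.
move=> uv; apply/eqP; rewrite -subr_eq0; apply/eqP/hdot_eq0 => w.
by rewrite hdotC linearBr/= uv subrr rmorph0.
Qed.

Lemma hdot_CS u v : `|'[u, v]| <= `|u| * `|v|.
Proof.
have [->|v0] := eqVneq v 0; first by rewrite linear0r !normr0 mulr0.
have vgt0 : 0 < '[v, v] by exact: neq0_dnorm_gt0.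
pose c := '[u, v] / '[v, v].
have [w wv uw] : exists2 w, '[w, v] = 0 & u = w + c *: v.
  exists (u - c *: v); last by rewrite subrK.
  by rewrite linearBl/= linearZl/= divfK ?gt_eqF ?subrr.
have uE : '[u, u] = '[w, w] + `|c| ^+ 2 * '[v, v].
  rewrite uw linearDl/= !linearDr/= !linearZl/= !linearZr/= wv mulr0 addr0.
  by rewrite [X in c * X]hdotC wv conjc0 mulr0 add0r mulrA normCK.
rewrite -(@ler_pXn2r _ 2)// ?nnegrE ?mulr_ge0// exprMn !hdot_norm uE mulrDl.
have -> : `|'[u, v]| ^+ 2 = `|c| ^+ 2 * '[v, v] * '[v, v].
  by rewrite -mulrA -expr2 -(ger0_norm (ltW vgt0))
    -exprMn -normrM divfK ?gt_eqF.
by rewrite lerDr mulr_ge0 ?(ltW vgt0)// -hdot_norm exprn_ge0.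
Qed.

Lemma adjoint_ofC T S : adjoint_of T S -> adjoint_of S T.
Proof. by move=> TS u v; rewrite hdotC -TS -hdotC. Qed.

Lemma adjoint_linear T S : adjoint_of T S -> linear S.
Proof.
move=> TS c u v; apply: hdot_eqr => w.
by rewrite -TS !linearDr/= !linearZr/= !TS.
Qed.

Lemma adjoint_bounded T S (e : R[i]) : adjoint_of T S ->
  (forall u, `|T u| <= e * `|u|) -> forall u, `|S u| <= e * `|u|.
Proof.
move=> TS Te u; have [->|Su0] := eqVneq (S u) 0.
  by rewrite normr0; apply: le_trans (Te u).
rewrite -(ler_pM2l (x := `|S u|)) ?normr_gt0// -expr2 hdot_norm -TS.
apply: le_trans (_ : `|'[T (S u), u]| <= _).
  by rewrite TS -hdot_norm ger0_norm ?exprn_ge0.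
apply: le_trans (hdot_CS _ _) _; rewrite mulrCA mulrA ler_wpM2r//.
Qed.

Lemma bounded_operator_const T : bounded_operator T ->
  exists2 M : R, 0 <= M & forall u, `|T u| <= M%:C * `|u|.
Proof.
move=> [_ [M TM]]; exists `|M| => // u; apply: le_trans (TM u) _.
by rewrite ler_wpM2r// lecR ler_norm.
Qed.

Lemma le_eps0 (V : normedModType R[i]) (u : V) (c : R[i]) : 0 <= c ->
  (forall e : R, 0 < e -> `|u| <= e%:C * c) -> u = 0.
Proof.
move=> c0 ue; apply/eqP; rewrite -normr_le0; apply/ler_addgt0Pl => -[e e'].
rewrite ltcE/= => /andP[/eqP -> e0]; rewrite -[_ +i* 0]/(e%:C) addr0.
have [x x0 xE] := ge0_complexE c0.
apply: le_trans (ue (e / (x + 1)) _) _; first by rewrite divr_gt0// ltr_wpDl.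
rewrite xE -rmorphM/= lecR mulrAC ler_pdivrMr ?ltr_wpDl// ler_pM2l//.
by rewrite lerDl.
Qed.

Lemma bounded_comp T S : bounded_operator T -> bounded_operator S ->
  bounded_operator (T \o S).
Proof.
move=> bT bS; split; first by move=> c u v /=; rewrite bS.1 bT.1.
have [M M0 TM] := bounded_operator_const bT.
have [N N0 SN] := bounded_operator_const bS.
exists (M * N) => u /=; apply: le_trans (TM _) _.
by rewrite rmorphM/= -mulrA ler_wpM2l ?SN// lecR.
Qed.

Lemma bounded_add T S : bounded_operator T -> bounded_operator S ->
  bounded_operator (fun u => T u + S u).
Proof.
move=> bT bS; split.
  by move=> c u v /=; rewrite bS.1 bT.1 scalerDr addrACA.
have [M M0 TM] := bounded_operator_const bT.
have [N N0 SN] := bounded_operator_const bS.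
exists (M + N) => u /=; apply: le_trans (ler_normD _ _) _.
by rewrite rmorphD/= mulrDl lerD.
Qed.

Lemma bounded_scale c T : bounded_operator T ->
  bounded_operator (fun u => c *: T u).
Proof.
move=> bT; split.
  by move=> a u v /=; rewrite bT.1 scalerDr !scalerA mulrC.
have [M M0 TM] := bounded_operator_const bT.
have [x x0 cx] := ge0_complexE (normr_ge0 c).
exists (x * M) => u /=; rewrite normrZ rmorphM/= cx.
by rewrite -mulrA ler_wpM2l// lecR.
Qed.

Lemma bounded_zero : bounded_operator (fun=> 0 : H).
Proof.
split; first by move=> c u v; rewrite scaler0 addr0.
by exists 0 => u; rewrite normr0 mul0r.
Qed.

(** The definition asks for an adjoint, so no Riesz representation theorem is invoked, and the
    adjoint must commute with [X] as well, which makes the commutant stable under adjoints for an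
    arbitrary set [X]. *)
Definition commutant (X : set (H -> H)) : set (H -> H) :=
  [set T | bounded_operator T /\ exists2 T', adjoint_of T T' &
     forall S, X S -> T \o S = S \o T /\ T' \o S = S \o T'].

(* [T'] is the pointwise limit of the adjoints of operators close to [T]. *)
Lemma commutant_limit (X : set (H -> H)) T :
  (forall e : R, 0 < e ->
    exists2 S, commutant X S & forall u, `|T u - S u| <= e%:C * `|u|) ->
  exists T', forall e : R, 0 < e -> exists S S',
    [/\ adjoint_of S S', forall Y, X Y -> S \o Y = Y \o S /\ S' \o Y = Y \o S',
        forall u, `|T u - S u| <= e%:C * `|u| &
        forall u, `|T' u - S' u| <= e%:C * `|u| ].
Proof.
move=> Tlim.
have /choice [Sk Skh] : forall k : nat, exists S : (H -> H) * (H -> H),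
    [/\ adjoint_of S.1 S.2,
        forall Y, X Y -> S.1 \o Y = Y \o S.1 /\ S.2 \o Y = Y \o S.2 &
        forall u, `|T u - S.1 u| <= (k.+1%:R^-1 : R)%:C * `|u| ].
  move=> k; have k0 : 0 < (k.+1%:R^-1 : R) by rewrite invr_gt0.
  by have [S [bS [S' SS' SX]] TS] := Tlim _ k0; exists (S, S').
(* Passing to adjoints preserves operator bounds, so the adjoints form a Cauchy sequence in norm,
   just as the operators do. *)
have Sd k l u : `|(Sk k).2 u - (Sk l).2 u| <= (k.+1%:R^-1 + l.+1%:R^-1 : R)%:C *
  `|u|.
  have [ak _ Tk] := Skh k; have [al _ Tl] := Skh l.
  have := @adjoint_bounded (fun u => (Sk k).1 u - (Sk l).1 u) (fun u =>
    (Sk k).2 u - (Sk l).2 u).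
  apply => [v w|v]; first by rewrite linearBl/= linearBr/= ak al.
  rewrite rmorphD mulrDl -(subrKA (T v)); apply: le_trans (ler_normD _ _) _.
  by rewrite lerD// distrC.
have inv_lt (e : R) : 0 < e -> exists k : nat, forall l, (k <= l)%N ->
  l.+1%:R^-1 <= e.
  move=> e0; exists (Num.bound e^-1) => l kl; rewrite invf_ple ?posrE//.
  apply: ltW; apply: lt_le_trans (archi_boundP _) _;
    first by rewrite invr_ge0 ltW.
  by rewrite ler_nat ltnW.
have cS u : cvg ((Sk k).2 u @[k --> \oo]).
  apply: cauchy_cvg; apply: cauchy_exP => -[e e'].
  rewrite ltcE/= => /andP[/eqP -> e0]; rewrite -[_ +i* 0]/(e%:C).
  have [c [c0 uc]] : exists c : R, 0 < c /\ `|u| < c%:C.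
    have [x x0 ->] := ge0_complexE (normr_ge0 u).
    by exists (x + 1); rewrite ltr_wpDl// ltcR ltrDl.
  have [k kP] := inv_lt (e / c / 2) (divr_gt0 (divr_gt0 e0 c0) (ltr0Sn _ 1)).
  exists ((Sk k).2 u); exists k => // l /= kl; rewrite -ball_normE/=.
  apply: le_lt_trans (Sd _ _ _) _.
  have kc : k.+1%:R^-1 + l.+1%:R^-1 <= e / c.
    by rewrite (splitr (e / c)) lerD ?kP.
  apply: le_lt_trans (_ : _ <= (e / c)%:C * `|u|) _;
    first by rewrite ler_wpM2r// lecR.
  have -> : e%:C = (e / c)%:C * c%:C by rewrite -rmorphM/= divfK ?gt_eqF.
  by rewrite ltr_pM2l// ltcR divr_gt0.
pose T' u := lim ((Sk k).2 u @[k --> \oo]).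
exists T' => e e0; have [k kP] := inv_lt (e / 2) (divr_gt0 e0 (ltr0Sn _ 1)).
have [ak Xk Tk] := Skh k; exists (Sk k).1, (Sk k).2; split=> //.
  move=> u; apply: le_trans (Tk u) _; rewrite ler_wpM2r// lecR.
  by apply: le_trans (kP k _) _; rewrite // ler_pdivrMr// ler_peMr ?ler1n// ltW.
move=> u; have := cS u => cu.
apply/ler_addgt0Pl => d d0.
have /cvgrPdist_lt /(_ d d0) [j _ jP] := cu.
pose l := maxn j k; have := jP l; rewrite /= leq_maxl => /(_ isT) Tl.
rewrite -(subrKA ((Sk l).2 u)); apply: le_trans (ler_normD _ _) _.
apply: lerD; first exact: ltW.
apply: le_trans (Sd _ _ _) _; rewrite ler_wpM2r// lecR.
by rewrite (splitr e) lerD ?kP ?leq_maxr.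
Qed.

Lemma commutant_cstar (X : set (H -> H)) : X `<=` @bounded_operator R H ->
  cstar_algebra (commutant X).
Proof.
move=> bX; split.
- by move=> T [].
- split; first exact: bounded_zero.
  exists (fun=> 0); first by move=> u v; rewrite linear0l linear0r.
  move=> S XS; have S0 : S 0 = 0.
    by have := (bX _ XS).1 (-1) 0 0; rewrite scaler0 addr0 scaleN1r addNr.
  by split; apply/funext => u /=; rewrite S0.
- move=> S T [bS [S' SS' SX]] [bT [T' TT' TX]]; split; first exact: bounded_add.
  exists (fun u => S' u + T' u).
    by move=> u v; rewrite linearDl/= linearDr/= SS' TT'.
  move=> Y XY.
  have YD u v : Y (u + v) = Y u + Y v.
    by rewrite -[u]scale1r (bX _ XY).1 !scale1r.
  have [e1 e2] := SX _ XY; have [e3 e4] := TX _ XY.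
  split; apply/funext => u /=; rewrite YD.
    by congr (_ + _); [exact: (congr1 (@^~ u) e1)|exact: (congr1 (@^~ u) e3)].
  by congr (_ + _); [exact: (congr1 (@^~ u) e2)|exact: (congr1 (@^~ u) e4)].
- move=> c T [bT [T' TT' TX]]; split; first exact: bounded_scale.
  exists (fun u => c^*%C *: T' u).
    by move=> u v; rewrite linearZl/= linearZr/= TT'; congr (_ * _);
      rewrite -[LHS]conjcK.
  move=> Y XY; have [e3 e4] := TX _ XY.
  have YZ a u : Y (a *: u) = a *: Y u.
    have Y0 : Y 0 = 0.
      by have := (bX _ XY).1 (-1) 0 0; rewrite scaler0 addr0 scaleN1r addNr.
    by rewrite -[a *: u]addr0 (bX _ XY).1 Y0 addr0.
  split; apply/funext => u /=; rewrite YZ; congr (_ *: _).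
    exact: (congr1 (@^~ u) e3).
  exact: (congr1 (@^~ u) e4).
- move=> S T [bS [S' SS' SX]] [bT [T' TT' TX]]; split;
  first exact: bounded_comp.
  exists (T' \o S'); first by move=> u v /=; rewrite SS' TT'.
  move=> Y XY; have [e1 e2] := SX _ XY; have [e3 e4] := TX _ XY; split.
    by rewrite -compA e3 compA e1.
  by rewrite -compA e2 compA e4.
- move=> T [bT [T' TT' TX]]; exists T' => //; split.
    split; first exact: adjoint_linear TT'.
    have [M M0 TM] := bounded_operator_const bT.
    by exists M; apply: adjoint_bounded TT' TM.
  exists T; first exact: adjoint_ofC.
  by move=> Y XY; have [] := TX _ XY.
- move=> T bT /commutant_limit[T' TT']; split=> //; exists T'.
    move=> u v; apply/eqP; rewrite -subr_eq0; apply/eqP.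
    apply: (@le_eps0 _ _ (`|u| * `|v| + `|u| * `|v|));
      first by rewrite addr_ge0// mulr_ge0.
    move=> e e0; have [S [S' [SS' _ TS TS']]] := TT' e e0.
    have -> : '[T u, v] - '[u, T' v] = '[T u - S u, v] - '[u, T' v - S' v].
      by rewrite linearBl/= linearBr/= SS' opprB addrA subrK.
    apply: le_trans (ler_normB _ _) _; rewrite mulrDr lerD//.
      by apply: le_trans (hdot_CS _ _) _; rewrite mulrA ler_wpM2r.
    by apply: le_trans (hdot_CS _ _) _; rewrite mulrCA ler_wpM2l.
  move=> Y XY; have [N N0 YN] := bounded_operator_const (bX _ XY).
  have YB u v : Y (u - v) = Y u - Y v.
    by rewrite addrC -scaleN1r (bX _ XY).1 scaleN1r addrC.
  have lim0 (A : H -> H) : (forall e : R, 0 < e -> exists2 S, S \o Y = Y \o S & 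
      forall u, `|A u - S u| <= e%:C * `|u|) -> A \o Y = Y \o A.
    move=> AS; apply/funext => u /=; apply/eqP; rewrite -subr_eq0; apply/eqP.
    apply: (@le_eps0 _ _ (`|Y u| + N%:C * `|u|)).
      by rewrite addr_ge0// mulr_ge0// lecR.
    move=> e e0; have [S SY Se] := AS e e0.
    have SYu : S (Y u) = Y (S u) by exact: (congr1 (@^~ u) SY).
    have -> : A (Y u) - Y (A u) = (A (Y u) - S (Y u)) - Y (A u - S u).
      by rewrite YB SYu opprB addrA subrK.
    apply: le_trans (ler_normB _ _) _; rewrite mulrDr lerD//.
    by apply: le_trans (YN _) _; rewrite mulrCA ler_wpM2l// lecR.
  split; apply: lim0 => e e0; have [S [S' [_ SY TS TS']]] := TT' e e0;
    have [] := SY _ XY; [by exists S|by exists S'].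
Qed.

End HilbertOperators.

(** * Commuting measurements from joint projections *)

Section QuantumModel.
Variables (R : realType) (n k : nat) (H : hilbertSpace R).
Local Notation "''[' u , v ]" := (hdot H u v).

Lemma bounded_sum (I : Type) (r : seq I) (T : I -> H -> H) :
  (forall i, bounded_operator (T i)) ->
  bounded_operator (fun u => \sum_(i <- r) T i u).
Proof.
move=> bT; elim: r => [|i r IH].
  by under eq_fun do rewrite big_nil; exact: bounded_zero.
by under eq_fun do rewrite big_cons; exact: bounded_add.
Qed.

Variables (T : idx n k -> H -> H) (psi : H) (x0 y0 : 'I_n).
Hypothesis T_bounded : forall t, bounded_operator (T t).
Hypothesis T_proj : forall t, projection (T t).
Hypothesis T_ns : forall u, nonsignalling (fun t => T t u).
Hypothesis T_unit : forall u x y, \sum_a \sum_b T (a, b, x, y) u = u.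

Let T_sum (I : finType) (P : pred I) t (f : I -> H) :
  T t (\sum_(i | P i) f i) = \sum_(i | P i) T t (f i).
Proof.
have [lT _] := T_bounded t.
apply: (big_morph (T t)) => [u v|]; first by rewrite -[u]scale1r lT !scale1r.
by have := lT (-1) 0 0; rewrite scaler0 addr0 scaleN1r addNr.
Qed.

Let TT t u : T t (T t u) = T t u.
Proof. by have [/(congr1 (@^~ u))] := T_proj t. Qed.

Let T_dot t u : '[T t u, u] = '[T t u, T t u].
Proof. by have [_ TA] := T_proj t; rewrite -[in LHS]TT TA. Qed.

(** For v in the range of one projection, the squared norm of v is the sum of those of its images
    under all projections with inputs x, y. The projection fixing v already contributes
    everything. *)
Lemma model_orthogonal a b a' b' x y u : (a, b) != (a', b') ->
  T (a, b, x, y) (T (a', b', x, y) u) = 0.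
Proof.
move=> ab; set v := T (a', b', x, y) u.
pose f (c : 'I_k * 'I_k) := '[T (c.1, c.2, x, y) v, T (c.1, c.2, x, y) v].
have f_ge0 c : true -> 0 <= f c by rewrite /f -hdot_norm exprn_ge0.
have : '[v, v] = \sum_c f c.
  rewrite -[X in '[X, _] = _](T_unit v x y) pair_big/= linear_sumlz/=.
  by apply: eq_bigr => c _; rewrite T_dot.
have fv : f (a', b') = '[v, v] by rewrite /f/= [T _ v]TT.
rewrite (bigD1 (a', b'))//= fv => /esym/eqP.
rewrite -subr_eq0 [_ + _ - _]addrC addKr => /eqP f0.
have /(_ _ (a, b) ab) := psumr_eq0P _ f0;
  rewrite /f/= => /(_ (fun c _ => f_ge0 c isT)).
by move=> /eqP; rewrite -hdot_norm sqrf_eq0 normr_eq0 => /eqP.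
Qed.

(** These marginals do not depend on the auxiliary inputs [y0] and [x0]. Both can thus be expanded
    at common inputs x, y, where orthogonality shows that either product of [E x a] and [F y b] is
    [T (a, b, x, y)]; hence they commute. *)
Let E x a u := \sum_b T (a, b, x, y0) u.
Let F y b u := \sum_a T (a, b, x0, y) u.

Let EE x a u y : E x a u = \sum_b T (a, b, x, y) u.
Proof. by have [TL _] := T_ns u; apply: TL. Qed.

Let FE x y b u : F y b u = \sum_a T (a, b, x, y) u.
Proof. by have [_ TR] := T_ns u; apply: TR. Qed.

Let EF x a y b : E x a \o F y b = T (a, b, x, y).
Proof.
apply/funext => u /=; rewrite (EE _ _ _ y) (FE x) (bigD1 b)//= [X in _ + X]big1.
  rewrite addr0 T_sum (bigD1 a)//= TT big1 ?addr0// => a' aa.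
  by rewrite model_orthogonal// xpair_eqE [a == _]eq_sym (negPf aa).
move=> b' bb; rewrite T_sum big1// => a' _.
by rewrite model_orthogonal// xpair_eqE (negPf bb) andbF.
Qed.

Let FEc x a y b : F y b \o E x a = T (a, b, x, y).
Proof.
apply/funext => u /=; rewrite (EE _ _ _ y) (FE x) (bigD1 a)//= [X in _ + X]big1.
  rewrite addr0 T_sum (bigD1 b)//= TT big1 ?addr0// => b' bb.
  by rewrite model_orthogonal// xpair_eqE [b == _]eq_sym (negPf bb) andbF.
move=> a' aa; rewrite T_sum big1// => b' _.
by rewrite model_orthogonal// xpair_eqE (negPf aa).
Qed.

Let E_adj x a : adjoint_of (E x a) (E x a).
Proof.
move=> u v; rewrite /E linear_sumlz/= linear_sumr/=; apply: eq_bigr => b _.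
by have [_ ->] := T_proj (a, b, x, y0).
Qed.

Let F_adj y b : adjoint_of (F y b) (F y b).
Proof.
move=> u v; rewrite /F linear_sumlz/= linear_sumr/=; apply: eq_bigr => a _.
by have [_ ->] := T_proj (a, b, x0, y).
Qed.

Let E_bounded x a : bounded_operator (E x a). Proof. exact: bounded_sum. Qed.
Let F_bounded y b : bounded_operator (F y b). Proof. exact: bounded_sum. Qed.

Let E_sum x u : \sum_a E x a u = u. Proof. exact: T_unit. Qed.
Let F_sum y u : \sum_b F y b u = u. Proof. by rewrite exchange_big;
  apply: T_unit. Qed.

Let E_idem x a : E x a \o E x a = E x a.
Proof.
apply/funext => u /=; rewrite /E; apply: eq_bigr => b _.
rewrite T_sum (bigD1 b)//= TT big1 ?addr0// => b' bb.
by rewrite model_orthogonal// xpair_eqE [b == _]eq_sym (negPf bb) andbF.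
Qed.

Let F_idem y b : F y b \o F y b = F y b.
Proof.
apply/funext => u /=; rewrite /F; apply: eq_bigr => a _.
rewrite T_sum (bigD1 a)//= TT big1 ?addr0// => a' aa.
by rewrite model_orthogonal// xpair_eqE [a == _]eq_sym (negPf aa).
Qed.

Lemma C_qc_model (p : 'I_k -> 'I_k -> 'I_n -> 'I_n -> R) : correlation p ->
  '[psi, psi] = 1 ->
  (forall a b x y, (p a b x y)%:C = '[T (a, b, x, y) psi, psi]) -> C_qc p.
Proof.
move=> hp psi1 pT; split=> //.
(* Alice's algebra is the double commutant of the [E x a] and Bob's is their commutant, so the two
   commute by construction; the state is the vector state of [psi]. *)
pose X := [set S | exists x a, S = E x a]; pose B := commutant X.
have bX : X `<=` @bounded_operator R H by move=> _ [x [a ->]].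
have bB : B `<=` @bounded_operator R H by move=> S [].
exists H, (commutant B), B, E, F, (fun S => '[S psi, psi]); split.
- by split; apply: commutant_cstar.
- by move=> S S' [_ [S1 _ SB]] BS'; have [] := SB _ BS'.
- split=> z; split=> //.
  + move=> a; split=> //; exists (E z a) => // S [_ [S1 _ SX]].
    by have [//|<- _] := SX (E z a); [exists z, a|].
  + move=> b; split=> //; exists (F z b) => // _ [x [a ->]].
    by rewrite EF FEc.
- split=> [c S S' _ _|S _ Sp|]; last exact: psi1.
    by rewrite linearDl/= linearZl.
  exact: Sp.
- by move=> a b x y; rewrite EF pT.
Qed.

End QuantumModel.

(** * Maximal cones and towers *)

Section MaximalCone.
Variables (R : realType) (V : lmodType R[i]) (C : set V).
Hypothesis C0 : C 0.
Hypothesis CZ : forall (c : R) u, 0 <= c -> C u -> C (c%:C *: u).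
Local Notation D := (@Dmax R V C).

Lemma DmaxP m (X : 'M[V]_m) : D X <->
  exists (r : nat) (a : 'M[R[i]]_(r, m)) (v : 'I_r -> V),
    (forall s, C (v s)) /\
    X = \matrix_(i, j) \sum_s ((a s i)^*%C * a s j) *: v s.
Proof.
have sum_diag r (a : 'M[R[i]]_(r, m)) (v : 'rV[V]_r) :
    mx_compress a (diag_mx v) = \matrix_(i,
      j) \sum_s ((a s i)^*%C * a s j) *: v 0 s.
  apply/matrixP => i j; rewrite !mxE; apply: eq_bigr => s _.
  rewrite (bigD1 s)//= big1 ?addr0 ?mxE ?eqxx// => t ts.
  by rewrite mxE eq_sym (negPf ts) scaler0.
split=> -[r [a [v [Cv ->]]]].
  by exists r, a, (fun s => v 0 s); rewrite sum_diag.
exists r, a, (\row_s v s); split=> [s|]; first by rewrite mxE.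
rewrite sum_diag; apply/matrixP => i j; rewrite !mxE.
by apply: eq_bigr => s _; rewrite mxE.
Qed.

Lemma Dmax0 m : D (0 : 'M[V]_m).
Proof.
apply/DmaxP; exists 0%N, 0, (fun=> 0); split=> //.
by apply/matrixP => i j; rewrite !mxE big_ord0.
Qed.

Lemma DmaxD m (X Y : 'M[V]_m) : D X -> D Y -> D (X + Y).
Proof.
move=> /DmaxP[r [a [v [Cv ->]]]] /DmaxP[r' [b [w [Cw ->]]]]; apply/DmaxP.
exists (r + r')%N, (col_mx a b),
  (fun s => match fintype.split s with inl i => v i | inr j => w j end).
split=> [s|]; first by case: (fintype.split s).
apply/matrixP => i j; rewrite !mxE big_split_ord/=; congr (_ + _).
  apply: eq_bigr => s _; rewrite !col_mxEu.
  by have := unsplitK (inl s : 'I_r + 'I_r') => /= ->.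
apply: eq_bigr => s _; rewrite !col_mxEd.
by have := unsplitK (inr s : 'I_r + 'I_r') => /= ->.
Qed.

Lemma Dmax_sum m (I : Type) (r : seq I) (P : pred I) (X : I -> 'M[V]_m) :
  (forall i, P i -> D (X i)) -> D (\sum_(i <- r | P i) X i).
Proof. by move=> DX; elim/big_ind: _ => //; [exact: Dmax0|exact: DmaxD]. Qed.

(* This is the sum over c of [w_c^T w_c (x) v c], where the row [w_c] is the  *)
(* restriction of [w] to the class [f = c].                                   *)
Lemma Dmax_block m (f : 'I_m -> nat) (w : 'I_m -> R) (v : nat -> V) :
  (forall c, C (v c)) ->
  D (\matrix_(a, b) (((f a == f b)%:R * w a * w b)%:C *: v (f a))).
Proof.
move=> Cv; apply/DmaxP; pose B := (\max_a f a).+1.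
exists B, (\matrix_(c, a) ((f a == c)%:R * w a)%:C), (fun c => v c).
split=> //; apply/matrixP => a b; rewrite !mxE.
have fB : (f a < B)%N by rewrite ltnS leq_bigmax.
rewrite (bigD1 (Ordinal fB))//= big1 ?addr0.
  have fE : nat_of_ord (Ordinal fB) = f a by [].
  rewrite !mxE fE eqxx conjc_real -rmorphM; congr (_%:C *: _).
  by rewrite eq_sym mul1r mulrCA !mulrA.
move=> c cf; rewrite !mxE conjc_real -rmorphM/= eq_sym.
have /negPf -> : (c : nat) != f a by apply: contra_neq cf => e; apply: val_inj.
by rewrite mul0r mul0r scale0r.
Qed.

Lemma DmaxZ m (c : R) (X : 'M[V]_m) : 0 <= c -> D X ->
  D (\matrix_(i, j) (c%:C *: X i j)).
Proof.
move=> c0 /DmaxP[r [a [v [Cv ->]]]]; apply/DmaxP.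
exists r, a, (fun s => c%:C *: v s); split=> [s|]; first exact: CZ.
apply/matrixP => i j; rewrite !mxE scaler_sumr; apply: eq_bigr => s _.
by rewrite !scalerA mulrC.
Qed.

End MaximalCone.

Section Tower.
Variables (R : realType) (V : lmodType R[i]).

(* The first j of the M bits of a, the most significant bit coming first.     *)
Definition prefix M j a := (a %/ 2 ^ (M - j))%N.

Lemma prefix_lt M j a : (j <= M)%N -> (a < 2 ^ M)%N -> (prefix M j a < 2 ^ j)%N.
Proof. by move=> jM aM; rewrite ltn_divLR ?expn_gt0// -expnD subnKC. Qed.

Lemma prefix0 M a : (a < 2 ^ M)%N -> prefix M 0 a = 0%N.
Proof. by move=> aM; rewrite /prefix subn0 divn_small. Qed.

Lemma prefix_full M a : prefix M M a = a.
Proof. by rewrite /prefix subnn divn1. Qed.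

Lemma prefixS M j a : (j < M)%N -> prefix M j a = (prefix M j.+1 a)./2.
Proof. by move=> jM; rewrite -divn2 -divnMA -expnSr -subSn. Qed.

Lemma prefix_le M i j a b : (i <= j)%N -> (j <= M)%N ->
  prefix M j a = prefix M j b -> prefix M i a = prefix M i b.
Proof.
move=> ij jM ab; have pE c : prefix M i c = (prefix M j c %/ 2 ^ (j - i))%N.
  by rewrite -divnMA -expnD addnBA// subnK.
by rewrite !pE ab.
Qed.

Lemma kron_blockE m (u v : V) (a b : 'I_(m * (1 + 1))) :
  kronl 1%:M (block_mx u%:M 0 0 v%:M : 'M[V]_(1 + 1)) a b =
  (a == b)%:R *: (if odd a then v else u).
Proof.
rewrite !mxE; set x := mxtens_unindex a; set y := mxtens_unindex b.
have xE : nat_of_ord a = (x.1 * 2 + x.2)%N by rewrite /x/= -divn_eq.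
have yE : nat_of_ord b = (y.1 * 2 + y.2)%N by rewrite /y/= -divn_eq.
have abE : (a == b) = (x.1 == y.1) && (x.2 == y.2).
  by rewrite -(can_eq (@mxtens_unindexK m (1 + 1)))
    -xpair_eqE -!surjective_pairing.
rewrite abE xE oddD oddM andbF; clearbody x y; clear xE yE abE.
case: x y => [x1 x2] [y1 y2] /=; rewrite -[x2 == _]val_eqE/=.
by case: (fintype.splitP x2) => -[[|//] lt0] ->; rewrite !mxE;
  case: (fintype.splitP y2) => -[[|//] lt1] ->; rewrite !mxE;
  rewrite /= ?andbT ?andbF ?scaler0 ?scale0r ?mulr1n.
Qed.

(** The identity and the diagonal block force the first i + 1 bits to agree, the last of these bits
    selects the block, and the all-one factor ignores the remaining bits. *)
Lemma towerE M (i : 'I_M) (u v : V) (a b : 'I_(2 ^ M)) :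
  tower i u v a b = (prefix M i.+1 a == prefix M i.+1 b)%:R *:
     (if odd (prefix M i.+1 a) then v else u).
Proof.
by rewrite castmxE mxE mxE scale1r kron_blockE.
Qed.

End Tower.

(** * An order unit modulo the matrices Q_i *)

Section Perturbation.
Variables (R : realType) (V : lmodType R[i]) (C : set V) (e : V) (q : seq V).
Hypothesis C0 : C 0.
Hypothesis CZ : forall (c : R) u, 0 <= c -> C u -> C (c%:C *: u).
Hypothesis Ce : C e.
Hypothesis Cq : forall i, (i < size q)%N -> C q`_i /\ C (e - q`_i).
Local Notation D := (@Dmax R V C).
Local Notation M := (size q).
Local Notation pre := (prefix M).
Local Notation N := (1 * 2 ^ M)%N.
Local Notation kron1 c X := (@kronl R V 1 (2 ^ M) (c%:C)%:M X).

Definition branch i (b : bool) := if b then q`_i else e - q`_i.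

Definition Smx : 'M[V]_N := \sum_i kronl 1%:M (Qmx e (q := q) i).

Lemma kronl_towerE c (i : 'I_M) (u v : V) (a b : 'I_N) :
  kron1 c (tower i u v) a b =
  (c * (pre i.+1 a == pre i.+1 b)%:R)%:C *: (if odd (pre i.+1 a) then v else u).
Proof.
rewrite mxE towerE mxE !ord1 eqxx mulr1n scalerA rmorphM/= rmorph_nat.
have modE (z : 'I_N) : (z %% 2 ^ M)%N = z.
  by rewrite modn_small//; apply: leq_trans (ltn_ord z) _; rewrite mul1n.
by rewrite /= !modE.
Qed.

Lemma QmxE c i (a b : 'I_N) : kron1 c (Qmx e (q := q) i) a b =
  (c * (pre i.+1 a == pre i.+1 b)%:R)%:C *: branch i (odd (pre i.+1 a)).
Proof. exact: kronl_towerE. Qed.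

Lemma PmxE c i (a b : 'I_N) : kron1 c (Pmx e (q := q) i) a b =
  (c * (pre i.+1 a == pre i.+1 b)%:R)%:C *: branch i (~~ odd (pre i.+1 a)).
Proof. by rewrite kronl_towerE /branch; case: odd. Qed.

Lemma branch_C i b : (i < M)%N -> C (branch i b).
Proof. by move=> /Cq[]; case: b. Qed.

Lemma Dmax_prefix c i (g : nat -> bool) : (i < M)%N -> 0 <= c ->
  D (\matrix_(a, b) ((c * (pre i.+1 a == pre i.+1 b)%:R)%:C *:
     branch i (g (pre i.+1 a))) : 'M[V]_N).
Proof.
move=> iM c0; pose v z := c%:C *: branch i (g z).
have Cv z : C (v z) by apply: CZ => //; exact: branch_C.
have := Dmax_block (fun a : 'I_N => pre i.+1 a) (fun=> 1) Cv.
congr (D _); apply/matrixP => a b; rewrite !mxE !mulr1 /v scalerA -rmorphM/=.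
by rewrite mulrC.
Qed.

Lemma Qmx_D c i : 0 <= c -> D (kron1 c (Qmx e (q := q) i)).
Proof.
move=> c0; have := @Dmax_prefix c i odd (ltn_ord i) c0.
by congr (D _); apply/matrixP => a b; rewrite QmxE mxE.
Qed.

Lemma Pmx_D c i : 0 <= c -> D (kron1 c (Pmx e (q := q) i)).
Proof.
move=> c0; have := @Dmax_prefix c i (fun z => ~~ odd z) (ltn_ord i) c0.
by congr (D _); apply/matrixP => a b; rewrite PmxE mxE.
Qed.

Lemma SmxE (a b : 'I_N) : Smx a b =
  \sum_(i < M) ((pre i.+1 a == pre i.+1 b)%:R)%:C *: branch i (odd (pre i.+1
    a)).
Proof.
rewrite summxE; apply: eq_bigr => i _.
by have := QmxE 1 i a b; rewrite mul1r.
Qed.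

Lemma prefix_eqS j (a b : 'I_N) : (j < M)%N ->
  (pre j.+1 a == pre j.+1 b) =
  (pre j a == pre j b) && (odd (pre j.+1 a) == odd (pre j.+1 b)).
Proof.
move=> jM; rewrite !(prefixS _ jM); apply/eqP/andP => [->//|[/eqP h /eqP o]].
by rewrite -[LHS]odd_double_half -[RHS]odd_double_half h o.
Qed.

(* With [U_j] the Kronecker product of the identity on the first [j] bits, of *)
(* [e], and of the all-one matrix on the other bits, this is                  *)
(* [U_(j+1) <= 2 U_j + 3 Q_(j+1)]: on each pair of siblings the difference is *)
(* [(1,2)^T (1,2) (x) q + (2,1)^T (2,1) (x) (e - q)].                         *)
Lemma order_unit_step j (jM : (j < M)%N) :
  D (\matrix_(a, b) ((2 * (pre j a == pre j b)%:R)%:C *: e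
     + (3 * (pre j.+1 a == pre j.+1 b)%:R)%:C *: branch j (odd (pre j.+1 a))
     - ((pre j.+1 a == pre j.+1 b)%:R)%:C *: e) : 'M[V]_N).
Proof.
have [Cqj [r Crj rE]] : C q`_j /\ exists2 r, C r & e - q`_j = r.
  by have [? ?] := Cq jM; split=> //; exists (e - q`_j).
have eE : e = q`_j + r by rewrite -rE addrC subrK.
have Dq := Dmax_block (fun a : 'I_N => pre j a)
  (fun a => if odd (pre j.+1 a) then 2 else 1) (fun=> Cqj).
have Dr := Dmax_block (fun a : 'I_N => pre j a)
  (fun a => if odd (pre j.+1 a) then 1 else 2) (fun=> Crj).
have := DmaxD Dq Dr; congr (D _); apply/matrixP => a b; rewrite !mxE.
rewrite prefix_eqS// /branch rE eE !scalerDr opprD.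
case: (pre j a == pre j b) => /=; last first.
  by rewrite !mulr0 !mul0r scale0r !scale0r !add0r oppr0 addr0.
have comb (x y z x' y' s t : R) : x + x' - z = s -> y + y' - z = t ->
    s%:C *: q`_j + t%:C *: r = x%:C *: q`_j + y%:C *: r +
     (x'%:C *: q`_j + y'%:C *: r) + (- (z%:C *: q`_j) - z%:C *: r).
  move=> <- <-; rewrite !rmorphB !rmorphD/= !scalerBl !scalerDl.
  by rewrite [LHS]addrACA [X in X + _ = _]addrACA.
have cq (x : R) : x%:C *: q`_j = x%:C *: q`_j + (0 : R)%:C *: r by rewrite
  scale0r addr0.
have cr (x : R) : x%:C *: r = (0 : R)%:C *: q`_j + x%:C *: r by rewrite scale0r
  add0r.
case: (odd _) (odd _) => -[] /=; rewrite ?mulr1 ?mulr0 ?mul1r.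
- by rewrite [(3%:C) *: _]cq; apply: (comb 2 2 1 3 0); ring.
- by rewrite !scale0r !oppr0 !addr0.
- by rewrite !scale0r !oppr0 !addr0.
- by rewrite [(3%:C) *: _]cr; apply: (comb 2 2 1 0 3); ring.
Qed.

(** Iterating [order_unit_step] leads from J (x) e, where no bits have to agree, to I (x) e, where
    all bits do. *)
Lemma order_unit : exists K T : R, [/\ 0 <= K, 0 <= T &
  D (\matrix_(a, b) (K%:C *: e + T%:C *: Smx a b - ((a == b)%:R)%:C *: e))].
Proof.
suff H j : (j <= M)%N -> exists K T : R, [/\ 0 <= K, 0 <= T &
    D (\matrix_(a, b) (K%:C *: e + T%:C *: Smx a b - ((pre j a == pre j
      b)%:R)%:C *: e))].
  have [K [T [K0 T0 DKT]]] := H M (leqnn _); exists K, T; split=> //.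
  by move: DKT; congr (D _); apply/matrixP => a b; rewrite !mxE !prefix_full.
elim: j => [_|j IH jM].
  exists 1, 0; split=> //; have := Dmax0 C0 N; congr (D _).
  apply/matrixP => a b; rewrite !mxE !prefix0 ?eqxx ?scale0r ?addr0 ?subrr//;
   by rewrite -[X in (_ < X)%N]mul1n.
have [K [T [K0 T0 DKT]]] := IH (ltnW jM).
(* Twice the inductive relation is added to [order_unit_step]; the other Q_i, with coefficient 3,
   complete its single term to 3 [Smx]. *)
exists (2 * K), (2 * T + 3); split; rewrite ?mulr_ge0 ?addr_ge0 ?mulr_ge0//.
pose rest : 'M[V]_N := \sum_(i < M | i != Ordinal jM) kron1 (3 : R)
  (Qmx e (q := q) i).
have Drest : D rest by apply: Dmax_sum => // i _; apply: Qmx_D.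
have := DmaxD (DmaxD (@DmaxZ _ _ C CZ _ 2 _ (ler0n _ _) DKT)
  (order_unit_step jM)) Drest.
congr (D _); apply/matrixP => a b; rewrite !mxE.
have SE : (3 : R)%:C *: Smx a b = (3 * (pre j.+1 a == pre j.+1 b)%:R)%:C *:
    branch j (odd (pre j.+1 a)) + rest a b.
  rewrite SmxE scaler_sumr (bigD1 (Ordinal jM))//= scalerA -rmorphM/=;
    congr (_ + _).
  rewrite summxE; apply: eq_bigr => i _.
  by rewrite QmxE scalerA -rmorphM.
rewrite [(2 * T + 3)%:C]rmorphD/= scalerDl SE !rmorphM/= scalerBr scalerDr
  !scalerA.
set A := (_ * K%:C) *: e; set B := (_ * T%:C) *: _;
  set U := (_ *: e in X in _ - X).
rewrite -!addrA; congr (_ + (_ + _)).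
rewrite -[X in - U + (X + _)]/U addKr; congr (_ + _).
by rewrite addrC.
Qed.

Variable st : V -> V.
Hypothesis stD : forall u v, st (u + v) = st u + st v.
Hypothesis stZ : forall (c : R) u, st (c%:C *: u) = c%:C *: st u.
Hypothesis ste : st e = e.
Hypothesis stq : forall i, (i < M)%N -> st q`_i = q`_i.

Let st0 : st 0 = 0.
Proof. by rewrite -[X in st X](scale0r (0 : V)) -[0]/(0%:C) stZ scale0r. Qed.

Let st_branch i b : (i < M)%N -> st (branch i b) = branch i b.
Proof.
move=> iM; case: b; rewrite /= ?stq//.
have -> : - q`_i = (-1 : R)%:C *: q`_i by rewrite rmorphN1 scaleN1r.
by rewrite stD stZ ste stq.
Qed.

Lemma perturbE (X : 'M[V]_N) eps t a b : perturb e X eps t a b =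
  X a b + \sum_i (eps i * (pre i.+1 a == pre i.+1 b)%:R)%:C *: branch i (~~ odd
    (pre i.+1 a))
  + \sum_i (t i * (pre i.+1 a == pre i.+1 b)%:R)%:C *: branch i (odd (pre i.+1
    a)).
Proof.
rewrite !mxE !summxE; congr (_ + _ + _); apply: eq_bigr => i _.
  exact: PmxE.
exact: QmxE.
Qed.

Lemma perturb_Cmax (X : 'M[V]_N) (T : R) eps t : mx_star st X = X ->
  D (\matrix_(a, b) (X a b + T%:C *: Smx a b)) ->
  (forall i, 0 <= eps i) -> (forall i, T <= t i) ->
  Cmax st C e (perturb e X eps t).
Proof.
move=> sX DX eps0 tT; split.
  apply/matrixP => a b; rewrite [LHS]mxE !perturbE !stD.
  have -> : st (X b a) = X a b by rewrite -[in RHS]sX mxE.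
  have st_sum (F : 'I_M -> V) : st (\sum_i F i) = \sum_i st (F i).
    exact: (big_morph st stD st0).
  rewrite !st_sum; congr (_ + _ + _); apply: eq_bigr => i _;
    rewrite stZ st_branch// eq_sym; case: eqP => [->//|_];
    by rewrite mulr0 !scale0r.
move=> d d0.
have D1 : D (\sum_i kron1 (eps i) (Pmx e (q := q) i)).
  by apply: Dmax_sum => // i _; apply: Pmx_D.
have D2 : D (\sum_i kron1 (t i - T) (Qmx e (q := q) i)).
  by apply: Dmax_sum => // i _; apply: Qmx_D; rewrite subr_ge0.
have D3 : D ((d%:C *: e)%:M : 'M[V]_N).
  have := @Dmax_block _ _ C N (fun a => a) (fun=> 1) (fun=> d%:C *: e)
    (fun=> CZ (ltW d0) Ce).
  congr (D _); apply/matrixP => a b; rewrite !mxE !mulr1 -val_eqE/=.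
  by case: eqP => _; rewrite ?scale1r ?mulr1n ?scale0r ?mulr0n.
have := DmaxD (DmaxD (DmaxD DX D1) D2) D3; congr (D _).
apply/matrixP => a b; rewrite [LHS]mxE [RHS]mxE; congr (_ + _).
rewrite perturbE 3!mxE -!addrA; congr (_ + _); rewrite addrCA summxE.
congr (_ + _); first by apply: eq_bigr => i _; rewrite PmxE.
rewrite SmxE scaler_sumr summxE -big_split; apply: eq_bigr => i _ /=.
by rewrite QmxE scalerA -rmorphM/= -scalerDl -rmorphD/= -mulrDl addrC subrK.
Qed.

(** The P_i and Q_i lie in the maximal cone, so membership persists for all positive eps and all t
    above T. The replacement clause is then met by increasing t. *)
Lemma cone_of_intro (X : 'M[V]_N) (T : R) : mx_star st X = X ->
  D (\matrix_(a, b) (X a b + T%:C *: Smx a b)) ->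
  cone_of st (Cmax st C e) e X.
Proof.
move=> sX DX; split=> // eps eps0.
have T1 : T <= `|T| + 1 by rewrite (le_trans (ler_norm T))// lerDl.
exists (fun=> `|T| + 1); split.
- by move=> i; rewrite ltr_wpDl.
- by apply: perturb_Cmax sX DX _ _ => // i; rewrite ltW.
move=> i eps' /andP[e'0 _]; exists (`|T| + 1 + 1); split;
  first by rewrite ltrDl.
apply: perturb_Cmax sX DX _ _ => j /=; case: eqP => _ //;
  rewrite ?(ltW e'0) ?(ltW (eps0 _))//.
by rewrite (le_trans T1)// lerDl.
Qed.

End Perturbation.

(** * Moment matrices of a state *)

Section Extension.
Variables (R : realType) (Y : lmodType R).

(* [K y c] reads [f y <= c] for every functional [f] we are looking for.      *)
Definition cone_graph (K : Y -> R -> Prop) :=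
  [/\ K 0 0, forall y z c d, K y c -> K z d -> K (y + z) (c + d),
      forall a y c, 0 <= a -> K y c -> K (a *: y) (a * c) &
      forall c, K 0 c -> 0 <= c].

(** The one-dimensional step of Hahn-Banach: the value a at v is the infimum of its admissible upper
    bounds. The new graph bounds y through y + l v, after subtracting l a. *)
Lemma cone_graph_extend1 K v : cone_graph K ->
  (exists c, K v c) -> (exists c, K (- v) c) ->
  exists K', [/\ cone_graph K', forall y c, K y c -> K' y c &
    exists a, K' v a /\ K' (- v) (- a)].
Proof.
move=> [K0 KD KZ Kge] [c1 Kc1] [c2 Kc2].
pose a := inf [set c | K v c].
have lbN d : K (- v) d -> lbound [set c | K v c] (- d).
  by move=> Kd c /= Kc; rewrite -subr_ge0 opprK; apply: Kge;
    rewrite -(subrr v); apply: KD.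
have a_le c : K v c -> a <= c by move=> Kc; apply: ge_inf => //; exists (- c2);
  apply: lbN.
have a_ge d : K (- v) d -> - d <= a.
  by move=> Kd; apply: lb_le_inf; [exists c1|exact: lbN].
have aP l c : K (l *: v) c -> l * a <= c.
  move=> Kc; have [l0|l0|l0] := ltgtP l 0.
  - have := KZ (- l^-1) _ _ _ Kc; rewrite oppr_ge0 invr_le0 ltW// => /(_ isT).
    rewrite scalerA mulNr mulVf ?lt_eqF// scaleN1r => /a_ge.
    by rewrite mulNr opprK ler_ndivrMl.
  - have := KZ l^-1 _ _ _ Kc; rewrite invr_ge0 ltW// => /(_ isT).
    by rewrite scalerA mulVf ?gt_eqF// scale1r => /a_le; rewrite ler_pdivlMl.
  - by rewrite l0 mul0r; apply: Kge; rewrite l0 scale0r in Kc.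
exists (fun y c => exists l d, K (y + l *: v) d /\ c = d - l * a).
split; first split.
- by exists 0, 0; rewrite scale0r mul0r addr0 subr0.
- move=> y z c d [l [c' [Kc ->]]] [m [d' [Kd ->]]]; exists (l + m), (c' + d').
  by rewrite scalerDl addrACA; split; [exact: KD|ring].
- move=> b y c b0 [l [c' [Kc ->]]]; exists (b * l), (b * c').
  by rewrite -scalerA -scalerDr; split; [exact: KZ|ring].
- move=> c [l [d [Kd ->]]]; rewrite subr_ge0; apply: aP.
  by rewrite add0r in Kd.
- by move=> y c Kc; exists 0, c; rewrite scale0r mul0r addr0 subr0.
- exists a; split; first by exists (-1), 0;
  rewrite scaleN1r subrr mulN1r opprK add0r.
  by exists 1, 0; rewrite scale1r addNr mul1r sub0r.
Qed.

Lemma cone_graph_extend K (vs : seq Y) : cone_graph K ->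
  (forall v, v \in vs -> (exists c, K v c) /\ exists c, K (- v) c) ->
  exists K', [/\ cone_graph K', forall y c, K y c -> K' y c &
    forall v, v \in vs -> exists a, K' v a /\ K' (- v) (- a)].
Proof.
elim: vs K => [|v vs IH] K gK vsK; first by exists K; split.
have [[c Kc] [d Kd]] := vsK v (mem_head _ _).
have [K1 [gK1 KK1 [a [K1a K1Na]]]] :=
  cone_graph_extend1 gK (ex_intro _ c Kc) (ex_intro _ d Kd).
have [v' v'vs|K2 [gK2 K12 K2v]] := IH _ gK1.
  have [[c' Kc'] [d' Kd']] := vsK v' (mem_behead (s := v :: vs) v'vs).
  by split; [exists c'|exists d']; apply: KK1.
exists K2; split=> // [y b /KK1 /K12//|v']; rewrite inE => /orP[/eqP ->|/K2v//].
by exists a; split; apply: K12.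
Qed.

End Extension.

Section ConePair.
Variables (R : realType) (V : lmodType R[i]) (C : set V) (e : V).
Hypothesis C0 : C 0.
Hypothesis CZ : forall (c : R) u, 0 <= c -> C u -> C (c%:C *: u).
Hypothesis Ce : C e.
Local Notation D := (@Dmax R V C).

(** Half the sum of I (x) e - E_aa (x) u, of I (x) e - E_bb (x) u and of the rank-one matrix of the
    row delta_a - c delta_b tensored with u: as c is 1 or -1, the diagonal terms in u cancel. *)
Lemma Dmax_pair (u : V) m (a b : 'I_m) (c : R) : C u -> C (e - u) ->
  c ^+ 2 = 1 ->
  D (\matrix_(i < m, j < m) (((i == j)%:R)%:C *: e -
     (c / 2 * ((i == a)%:R * (j == b)%:R + (j == a)%:R * (i == b)%:R))%:C *:
       u)).
Proof.
move=> Cu Ceu c2.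
have Dd (z : 'I_m) : D (\matrix_(i,
  j) (((i == j)%:R)%:C *: (e - ((i == z)%:R)%:C *: u))).
  have Cv (w : nat) : C (e - ((w == z)%:R)%:C *: u).
    case: eqP => _; rewrite ?scale1r ?scale0r ?subr0; first exact: Ceu.
    exact: Ce.
  have := Dmax_block (fun i : 'I_m => i : nat) (fun=> 1) Cv.
  by congr (D _); apply/matrixP => i j; rewrite !mxE !mulr1 !val_eqE.
have Dr := @Dmax_block _ _ C m (fun=> 0%N) (fun i =>
  (i == a)%:R - c * (i == b)%:R)
  (fun=> u) (fun=> Cu).
have := @DmaxZ _ _ C CZ _ 2^-1 _ _ (DmaxD (DmaxD (Dd a) (Dd b)) Dr).
have h0 : 0 <= (2^-1 : R) by rewrite invr_ge0.
move=> /(_ h0); congr (D _); apply/matrixP => i j; rewrite !mxE.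
have eqM (z : 'I_m) : (i == j)%:R * (i == z)%:R = (i == z)%:R * (j == z)%:R :>
  R.
  case: (eqVneq i z) => [->|]; rewrite ?mulr0 ?mul0r// mulr1 mul1r.
  by rewrite eq_sym.
have comb (h x y z w : R[i]) : h *: (x *: (e - y *: u) + x *: (e - z *: u)
  + w *: u)
    = (h * (x + x)) *: e - (h * (x * y + x * z - w)) *: u.
  rewrite !scalerBr !scalerA addrACA -scalerDl -opprD -scalerDl -addrA.
  by rewrite -[w *: u]opprK -opprD -scalerBl scalerBr !scalerA.
rewrite comb -!(rmorphM (real_complex R)) -!(rmorphD (real_complex R)).
rewrite -(rmorphB (real_complex R)) -!(rmorphM (real_complex R)) !eqM.
congr (_%:C *: _ - _%:C *: _); [by lra|rewrite eqxx mul1r].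
by field: c2.
Qed.


Lemma Dmax_const m v : C v -> D (const_mx v : 'M[V]_m).
Proof.
move=> Cv; have := @Dmax_block _ _ C m (fun=> 0%N) (fun=> 1) (fun=> v)
  (fun=> Cv).
by congr (D _); apply/matrixP => a b; rewrite !mxE !mulr1 scale1r.
Qed.

Lemma Dmax_add_const m (x v : V) (F X : 'M[V]_m) : C v ->
  (forall a b, X a b = x + v) -> D (\matrix_(a, b) (x + F a b)) ->
  D (\matrix_(a, b) (X a b + F a b)).
Proof.
move=> Cv XE DF; have := DmaxD DF (Dmax_const m Cv); congr (D _).
by apply/matrixP => a b; rewrite !mxE XE addrAC.
Qed.

Lemma order_unit_pair (q : seq V) :
  (forall i, (i < size q)%N -> C q`_i /\ C (e - q`_i)) ->
  exists K T : R, forall u a b (c : R), C u -> C (e - u) -> c ^+ 2 = 1 ->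
  D (\matrix_(i, j) (K%:C *: e + T%:C *: Smx e q i j -
     (c / 2 * ((i == a)%:R * (j == b)%:R + (j == a)%:R * (i == b)%:R))%:C *:
       u)).
Proof.
move=> Cq; have [K [T [_ _ DT]]] := order_unit C0 CZ Cq.
exists K, T => u a b c Cu Ceu c2.
have := DmaxD DT (Dmax_pair a b Cu Ceu c2); congr (D _).
by apply/matrixP => i j; rewrite !mxE addrA subrK.
Qed.

End ConePair.

Lemma addrB_addrB (V : zmodType) (a b c a' b' c' : V) :
  a + b - c + (a' + b' - c') = a + a' + (b + b') - (c + c').
Proof. by rewrite opprD addrACA [X in X + _ = _]addrACA. Qed.

Section NonsignallingCone.
Variables (R : realType) (n k : nat).
Local Notation V := (Vns R n k).
Local Notation Qg := (@Qidx R n k).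
Local Notation e := (e_ns R n k).
Local Notation C := (@D_ns R n k).
Local Notation st := (@star R n k).

Definition real_comb (r : idx n k -> R) : V := \sum_t (r t)%:C *: Qg t.

Lemma real_combD r r' : real_comb (fun t =>
  r t + r' t) = real_comb r + real_comb r'.
Proof.
by rewrite /real_comb -big_split; apply: eq_bigr => t _;
  rewrite rmorphD scalerDl.
Qed.

Lemma real_combZ c r : real_comb (fun t => c * r t) = c%:C *: real_comb r.
Proof.
by rewrite /real_comb scaler_sumr; apply: eq_bigr => t _;
  rewrite rmorphM scalerA.
Qed.

Lemma real_comb1 t : real_comb (fun i => (i == t)%:R) = Qg t.
Proof.
rewrite /real_comb (bigD1 t)//= eqxx scale1r big1 ?addr0// => i it.
by rewrite (negPf it) scale0r.
Qed.

Lemma real_comb0 : real_comb (fun=> 0) = 0.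
Proof. by rewrite /real_comb big1// => t _; rewrite scale0r. Qed.

Lemma Dns_comb r : (forall t, 0 <= r t) -> C (real_comb r).
Proof. by move=> r0; exists r. Qed.

Lemma Dns0 : C 0. Proof. by rewrite -real_comb0; apply: Dns_comb. Qed.

Lemma DnsZ (c : R) u : 0 <= c -> C u -> C (c%:C *: u).
Proof.
move=> c0 [r [r0 ->]]; rewrite -!/(real_comb _) -real_combZ.
by apply: Dns_comb => t; rewrite mulr_ge0.
Qed.

Lemma Dns_Q t : C (Qg t).
Proof. by rewrite -real_comb1; apply: Dns_comb => i; rewrite ler0n. Qed.

Definition unit_coef (x y : 'I_n) (t : idx n k) : R :=
  ((t.1.2 == x) && (t.2 == y))%:R.

Lemma e_ns_comb x y : e = real_comb (unit_coef x y).
Proof.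
rewrite (e_nsE _ _ x y) /real_comb.
rewrite pair_big/=; rewrite [RHS](bigID (fun t : idx n k =>
  (t.1.2 == x) && (t.2 == y)))/=.
rewrite [X in _ = _ + X]big1 ?addr0; last first.
  by move=> t /negPf h; rewrite /unit_coef h scale0r.
rewrite (reindex_onto (fun c : 'I_k * 'I_k => (c, x, y) : idx n k) (fun t =>
  t.1.1))/=.
  apply: eq_big => [c|c _]; first by rewrite !eqxx.
  by rewrite /unit_coef/= !eqxx scale1r; case: c.
by move=> [[c x'] y'] /= /andP[/eqP -> /eqP ->].
Qed.

Lemma Dns_e_sub t : C (e - Qg t).
Proof.
rewrite (e_ns_comb t.1.2 t.2).
have -> : real_comb (unit_coef t.1.2 t.2) - Qg t =
    real_comb (fun i => unit_coef t.1.2 t.2 i + (-1) * (i == t)%:R).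
  by rewrite real_combD real_combZ real_comb1 rmorphN1 scaleN1r.
apply: Dns_comb => i; rewrite mulN1r subr_ge0 /unit_coef.
by case: eqP => [->|_]; rewrite ?eqxx ?ler0n.
Qed.

Lemma conjC_real (x : R) : Num.conj (x%:C : R[i]) = x%:C.
Proof. exact: conjc_real. Qed.

Lemma star_comb r : st (real_comb r) = real_comb r.
Proof. by rewrite starE; apply: eq_bigr => t _; rewrite conjC_real. Qed.

Lemma star_Dns v : C v -> st v = v.
Proof. by move=> [r [_ ->]]; apply: star_comb. Qed.

Lemma starD u v : st (u + v) = st u + st v.
Proof.
by rewrite -[u]pi_quotvK -[v]pi_quotvK -raddfD/= !star_pi conj_ffunD raddfD.
Qed.

Lemma starZ (c : R) v : st (c%:C *: v) = c%:C *: st v.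
Proof. by rewrite -[v]pi_quotvK -linearZ/= !star_pi conj_ffunZ conjC_real
  linearZ. Qed.

End NonsignallingCone.

(** * Extension of a state to moment matrices *)

Section MomentMatrices.
Variables (R : realType) (n k : nat) (n_gt0 : (0 < n)%N).
Local Notation V := (Vns R n k).
Local Notation e := (e_ns R n k).
Local Notation C := (@D_ns R n k).
Local Notation rc := (@real_comb R n k).
Local Notation D := (@Dmax R V C).

Lemma e_ns_Dns : C e.
Proof.
have x0 := Ordinal n_gt0; rewrite (e_ns_comb R k x0 x0).
by apply: Dns_comb => t; rewrite ler0n.
Qed.



Variables (q : seq V) (p : idx n k -> R).
Local Notation M := (size q).
Local Notation N := (1 * 2 ^ M)%N.
Local Notation S := (Smx e q).
Hypothesis q_Dns : forall i, (i < M)%N -> C q`_i /\ C (e - q`_i).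
Hypothesis p_ge0 : forall (r : idx n k -> R) (T : R),
  D (\matrix_(a, b) (rc r + T%:C *: S a b)) -> 0 <= \sum_t r t * p t.

(** A family y of real matrices stands for the symmetrised sum of the y_t (x) Q_t. It is bounded by
    the value of the state at r whenever r (x) J plus a multiple of [Smx] dominates it; [p_ge0]
    makes these bounds coherent. The order unit bounds each basis vector and its opposite, so the
    bounds extend to a linear functional, with matrix entries G. *)
Lemma moment_matrices : exists G : idx n k -> 'I_N -> 'I_N -> R,
  forall (y : idx n k -> 'I_N -> 'I_N -> R) (r : idx n k -> R) (T : R),
    D (\matrix_(a, b) (rc r + T%:C *: S a b -
        rc (fun t => (y t a b + y t b a) / 2))) ->
    \sum_t \sum_a \sum_b y t a b * G t a b <= \sum_t r t * p t.
Proof.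
pose I : finType := (idx n k * ('I_N * 'I_N))%type.
pose Y : lmodType R := {ffun I -> R^o}.
pose re (y : Y) (a b : 'I_N) := rc (fun t =>
  ((y (t, (a, b)) + y (t, (b, a))) / 2 : R)).
pose K (y : Y) (c : R) := exists (r : idx n k -> R) (T : R),
  D (\matrix_(a, b) (rc r + T%:C *: S a b - re y a b)) /\ c = \sum_t r t * p t.
have gK : cone_graph K.
  split.
  - exists (fun=> 0), 0; split; last by rewrite big1// => t _; rewrite mul0r.
    have := Dmax0 (@Dns0 R n k) N; congr (D _); apply/matrixP => a b;
      rewrite !mxE.
    rewrite real_comb0 scale0r add0r /re;
      under [fun t => _]eq_fun do rewrite !ffunE addr0 mul0r.
    by rewrite real_comb0 subr0.
  - move=> y z c d [r [T [DT ->]]] [r' [T' [DT' ->]]].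
    exists (fun t => r t + r' t), (T + T'); split; last first.
      by rewrite -big_split; apply: eq_bigr => t _; rewrite /= mulrDl.
    have := DmaxD DT DT'; congr (D _); apply/matrixP => a b; rewrite !mxE.
    have -> : re (y + z) a b = re y a b + re z a b.
      rewrite /re -real_combD; congr real_comb; apply/funext => t.
      by rewrite !ffunE -mulrDl addrACA.
    by rewrite addrB_addrB real_combD rmorphD scalerDl.
  - move=> c y d c0 [r [T [DT ->]]].
    exists (fun t => c * r t), (c * T); split; last first.
      by rewrite mulr_sumr; apply: eq_bigr => t _; rewrite mulrA.
    have := @DmaxZ _ _ C (@DnsZ R n k) _ c _ c0 DT; congr (D _).
    apply/matrixP => a b; rewrite !mxE.
    have -> : re (c *: y) a b = c%:C *: re y a b.
      rewrite /re -real_combZ; congr real_comb; apply/funext => t.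
      by rewrite !ffunE/= -mulrDr mulrA.
    by rewrite real_combZ rmorphM -scalerA scalerBr scalerDr.
  - move=> c [r [T [DT ->]]]; apply: (@p_ge0 r T); move: DT; congr (D _).
    apply/matrixP => a b; rewrite !mxE.
    rewrite /re; under [fun t => _]eq_fun do rewrite !ffunE addr0 mul0r.
    by rewrite real_comb0 subr0.
pose delta (z : I) : Y := [ffun i => (i == z)%:R].
have bK z (c : R) : c ^+ 2 = 1 -> exists d, K (c *: delta z) d.
  case: z => t [a b] c2; have x0 := Ordinal n_gt0.
  have [K0 [T DT]] := order_unit_pair (@Dns0 R n k) (@DnsZ R n k)
    e_ns_Dns q_Dns.
  exists (\sum_t K0 * unit_coef R x0 x0 t * p t), (fun t =>
    K0 * unit_coef R x0 x0 t), T.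
  split=> //; have := DT _ a b c (Dns_Q R t) (Dns_e_sub R t) c2; congr (D _).
  apply/matrixP => i j; rewrite [LHS]mxE [RHS]mxE.
  rewrite real_combZ -e_ns_comb; congr (_ - _).
  rewrite -real_comb1 -real_combZ; congr real_comb; apply/funext => t'.
  rewrite !ffunE /= !xpair_eqE; case: (t' == t) => /=;
    rewrite ?mulr0 ?addr0 ?mul0r//.
    by rewrite -!mulnb !natrM /GRing.scale/=; ring.
  by rewrite !scaler0 addr0 mul0r.
have [|K' [[K'0 K'D K'Z K'ge] KK' K'v]] :=
  @cone_graph_extend _ _ K [seq delta z | z <- enum I] gK.
  move=> _ /mapP[z _ ->]; split.
    by have [d] := bK z 1 (expr1n _ _); rewrite scale1r; exists d.
  by have [d] := bK z (-1) (etrans (sqrrN 1) (expr1n _ 2)); rewrite scaleN1r;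
    exists d.
have /choice [al alP] : forall z, exists a, K' (delta z) a /\
  K' (- delta z) (- a).
  by move=> z; apply: K'v; apply: map_f; rewrite mem_enum.
exists (fun t a b => al (t, (a, b))) => y r T DT.
pose y' : Y := [ffun z => y z.1 z.2.1 z.2.2].
have Ky : K y' (\sum_t r t * p t).
  exists r, T; split=> //; move: DT; congr (D _); apply/matrixP => a b;
    rewrite !mxE.
  by congr (_ - _); congr real_comb; apply/funext => t; rewrite !ffunE.
have KNy : K' (- y') (- \sum_z y' z * al z).
  have -> : - y' = \sum_z (- (y' z : R)) *: delta z.
    apply/ffunP => i; rewrite sum_ffunE (bigD1 i)//= big1.
      by rewrite addr0 !ffunE eqxx /GRing.scale/= mulr1.
    by move=> j ji; rewrite !ffunE eq_sym (negPf ji) scaler0.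
  rewrite -sumrN; elim/big_rec2: _ => [//|z d v _ Kdv]; apply: K'D Kdv.
  have [K1 K2] := alP z; have [y0|y0] := leP 0 (y' z : R).
    by have := K'Z _ _ _ y0 K2; rewrite scalerN scaleNr mulrN.
  have Ny0 : 0 <= - (y' z : R) by rewrite oppr_ge0 ltW.
  by have := K'Z _ _ _ Ny0 K1; rewrite mulNr.
have := K'D _ _ _ _ (KK' _ _ Ky) KNy; rewrite subrr => /K'ge.
rewrite subr_ge0; congr (_ <= _).
under [RHS]eq_bigr do rewrite pair_big/=.
by rewrite pair_big/=; apply: eq_bigr => -[t [a b]] _; rewrite ffunE.
Qed.

End MomentMatrices.

Section StateMoments.
Variables (R : realType) (n k : nat) (n_gt0 : (0 < n)%N).
Local Notation V := (Vns R n k).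
Local Notation Qg := (@Qidx R n k).
Local Notation e := (e_ns R n k).
Local Notation C := (@D_ns R n k).
Local Notation st := (@star R n k).
Local Notation rc := (@real_comb R n k).
Local Notation D := (@Dmax R V C).

Variables (s : seq (idx n k)) (L : nat).

Definition letters : seq V := flatten (nseq L [seq Qg i | i <- s]).

Lemma letters_Q i : (i < size letters)%N -> exists t, letters`_i = Qg t.
Proof.
move=> iM; have : letters`_i \in letters by apply: mem_nth.
by move=> /flattenP[z /nseqP[-> _] /mapP[t _ ->]]; exists t.
Qed.

Lemma letters_Dns i : (i < size letters)%N ->
  C letters`_i /\ C (e - letters`_i).
Proof. by move=> /letters_Q[t ->]; split; [exact: Dns_Q|exact: Dns_e_sub]. Qed.

Variables (p : idx n k -> R) (phi : {scalar V}).
Hypothesis L_gt0 : (0 < L)%N.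
Hypothesis phi_state : is_state (D_qc s) e phi.
Hypothesis phiQ : forall t, phi (Qg t) = (p t)%:C.

(** The hypothesis puts [rc r] in [D_qc]: the same L serves for every eps, as the surplus eps J (x)
    e is itself in the maximal cone. *)
Lemma state_ge0 (r : idx n k -> R) (T : R) :
  D (\matrix_(a, b) (rc r + T%:C *: Smx e letters a b)) ->
    0 <= \sum_t r t * p t.
Proof.
move=> DT; have phir : phi (rc r) = (\sum_t r t * p t)%:C.
  rewrite /real_comb linear_sum rmorph_sum; apply: eq_bigr => t _.
  by rewrite linearZ/= phiQ rmorphM.
rewrite -lecR -phir; apply: (phi_state.1) => eps eps0; exists L; split=> //.
set X := kronr _ _.
have XE a b : X a b = rc r + eps%:C *: e by rewrite !mxE !ord1 eqxx mulr1n
  scale1r.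
have ste : st e = e by apply: star_Dns; apply: e_ns_Dns.
have stq i : (i < size letters)%N -> st letters`_i = letters`_i.
  by move=> iM; apply: star_Dns; have [] := letters_Dns iM.
refine (@cone_of_intro R V C e letters (@Dns0 R n k) (@DnsZ R n k)
  (e_ns_Dns R k n_gt0) letters_Dns st (@starD R n k) (@starZ R n k)
    ste stq X T _ _).
  by apply/matrixP => a b; rewrite mxE !XE starD starZ ste star_comb.
pose F := (\matrix_(a, b) (T%:C *: Smx e letters a b)
  : 'M[V]_(1 * 2 ^ size letters)).
have Fe a b : F a b = T%:C *: Smx e letters a b by rewrite mxE.
under eq_mx do rewrite -Fe; apply: Dmax_add_const XE _.
  by apply: DnsZ (ltW eps0) _; exact: e_ns_Dns.
by under eq_mx do rewrite Fe.
Qed.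

End StateMoments.

(** * Moments of words *)

Section BilinearSums.
Variables (R : realType) (I : finType).
Implicit Types (P : I -> I -> R) (f g h : I -> R).

Definition bil P f g := \sum_a \sum_b f a * g b * P a b.

Lemma bilDl P f g h : bil P (fun a => f a + g a) h = bil P f h + bil P g h.
Proof.
rewrite /bil -big_split; apply: eq_bigr => a _; rewrite -big_split.
by apply: eq_bigr => b _; rewrite /= -!mulrDl.
Qed.

Lemma bilZl P c f h : bil P (fun a => c * f a) h = c * bil P f h.
Proof.
rewrite /bil mulr_sumr; apply: eq_bigr => a _; rewrite mulr_sumr.
by apply: eq_bigr => b _; rewrite !mulrA.
Qed.

Lemma bilC P f g : (forall a b, P a b = P b a) -> bil P f g = bil P g f.
Proof.
move=> PC; rewrite /bil exchange_big; apply: eq_bigr => a _.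
by apply: eq_bigr => b _; rewrite PC [f b * _]mulrC.
Qed.

Lemma eq_bil P f g f' g' : f =1 f' -> g =1 g' -> bil P f g = bil P f' g'.
Proof.
by move=> ff gg; apply: eq_bigr => a _; apply: eq_bigr => b _; rewrite ff gg.
Qed.

Lemma bil_suml (J : Type) (r : seq J) P (F : J -> I -> R) h :
  bil P (fun a => \sum_(j <- r) F j a) h = \sum_(j <- r) bil P (F j) h.
Proof.
rewrite /bil [RHS]exchange_big; apply: eq_bigr => a _.
rewrite [RHS]exchange_big; apply: eq_bigr => b _.
by rewrite !mulr_suml.
Qed.

Lemma bil_mat (J : Type) (r : seq J) (F : J -> I -> I -> R) (c : J -> R) f g :
  bil (fun a b => \sum_(j <- r) c j * F j a b) f g = \sum_(j <- r)
    c j * bil (F j) f g.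
Proof.
rewrite /bil; under [RHS]eq_bigr do rewrite mulr_sumr.
rewrite [RHS]exchange_big; apply: eq_bigr => a _.
under [RHS]eq_bigr do rewrite mulr_sumr.
rewrite [RHS]exchange_big; apply: eq_bigr => b _.
by rewrite mulr_sumr; apply: eq_bigr => j _; rewrite mulrCA.
Qed.

Definition psd P := (forall a b, P a b = P b a) /\ forall f, 0 <= bil P f f.

Lemma quad_ge0_lin0 (b c : R) : (forall l, 0 <= 2 * l * b + l ^+ 2 * c) ->
  b = 0.
Proof.
move=> H; have c0 : 0 <= c by have := H 1; have := H (-1); lra.
have c1 : 0 < c + 1 by lra.
(* Dividing by c + 1 instead of c also covers c = 0. *)
have := H (- b / (c + 1)).
have -> : 2 * (- b / (c + 1)) * b + (- b / (c + 1)) ^+ 2 * c =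
  - (b ^+ 2 * ((c + 2) / (c + 1) ^+ 2)) by field; rewrite gt_eqF.
rewrite oppr_ge0 pmulr_lle0 ?divr_gt0 ?exprn_gt0//; last by lra.
by move=> b2; apply/eqP; rewrite -sqrf_eq0 eq_le b2 sqr_ge0.
Qed.

Lemma psd_null P f : psd P -> bil P f f <= 0 -> forall g, bil P f g = 0.
Proof.
move=> [PC P0] ff0 g; apply: (quad_ge0_lin0 (c := bil P g g)) => l.
have := P0 (fun a => f a + l * g a).
rewrite bilDl bilZl (bilC f _ PC) (bilC g _ PC) !bilDl !bilZl (bilC g f PC).
lra.
Qed.

Lemma sum_ind (J : finType) (j : J) (F : J ->
  R) : \sum_i (i == j)%:R * F i = F j.
Proof.
rewrite (bigD1 j)//= eqxx mul1r big1 ?addr0// => i ij.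
by rewrite (negPf ij) mul0r.
Qed.

(* [P c] is the form on the block [h = c]; each of the blocks contributes a   *)
(* nonnegative amount to the sum, hence vanishes.                             *)
Lemma block_null (h : I -> nat) (P : nat -> I -> I -> R) :
  (forall c, psd (P c)) ->
  \sum_a \sum_b (h a == h b)%:R * P (h a) a b <= 0 ->
  forall (c : pred nat) (Q : I -> I -> R) f,
    (forall z, c z -> P z = Q) -> (forall a b, h a = h b -> f a = f b) ->
    forall g, bil Q (fun a => f a * (c (h a))%:R) g = 0.
Proof.
move=> Ppsd sum0 c Q f PQ fh g.
pose B := (\max_a h a).+1; have hB a : (h a < B)%N by rewrite ltnS leq_bigmax.
pose chi (z : 'I_B) a : R := (h a == z)%:R.
have chi_sum a (F : 'I_B -> R) : \sum_z chi z a * F z = F (Ordinal (hB a)).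
  by rewrite -[RHS]sum_ind; apply: eq_bigr => z _; rewrite /chi eq_sym.
have total : \sum_(z < B) bil (P z) (chi z) (chi z) <= 0.
  apply: le_trans sum0; rewrite /bil exchange_big; apply: ler_sum => a _.
  rewrite exchange_big; apply: ler_sum => b _.
  under eq_bigr do rewrite -mulrA.
  by rewrite chi_sum /chi/= eq_sym.
have chi0 (z : 'I_B) g' : bil (P z) (chi z) g' = 0.
  apply: psd_null => //; have P0 (z' : 'I_B) : true ->
    0 <= bil (P z') (chi z') (chi z').
    by move=> _; have [_] := Ppsd z'; apply.
  apply: le_trans total; rewrite (bigD1 z)//= lerDl sumr_ge0// => z' _.
  exact: P0.
pose f' z : R := if [pick a | h a == z] is Some a then f a * (c z)%:R else 0.
have fE a : f a * (c (h a))%:R = \sum_(z < B) f' z * chi z a.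
  under eq_bigr do rewrite mulrC; rewrite chi_sum /f' /=.
  by case: pickP => [a' /eqP /fh ->//|/(_ a)]; rewrite eqxx.
rewrite (eq_bil _ fE (fun=> erefl)) bil_suml big1// => z _; rewrite bilZl.
have [cz|cz] := boolP (c z); first by rewrite -(PQ z)// chi0 mulr0.
by rewrite /f'; case: pickP => [a _|_];
  rewrite ?mulr0 ?mul0r// (negPf cz) mulr0 mul0r.
Qed.

End BilinearSums.

Section Consistent.
Variables (R : realType) (n k : nat).
Local Notation rc := (@real_comb R n k).

(** The family respects all real linear relations between the generators, as the values of a linear
    functional do. *)
Definition consistent (f : idx n k -> R) :=
  forall c, rc c = 0 -> \sum_t c t * f t = 0.

Lemma real_comb_sum (I : finType) (f : I -> idx n k) :
  rc (fun t => \sum_i (t == f i)%:R) = \sum_i Qidx R (f i).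
Proof.
rewrite /real_comb; under eq_bigr do rewrite rmorph_sum scaler_suml.
by rewrite exchange_big; apply: eq_bigr => i _; apply: real_comb1.
Qed.

Lemma consistent_sum (f : idx n k -> R) (I J : finType) (g : I ->
  idx n k) (h : J -> idx n k) :
  consistent f -> \sum_i Qidx R (g i) = \sum_j Qidx R (h j) ->
  \sum_i f (g i) = \sum_j f (h j).
Proof.
move=> cf gh; apply/eqP; rewrite -subr_eq0; apply/eqP.
have sE (K : finType) (u : K -> idx n k) :
    \sum_i f (u i) = \sum_t (\sum_i (t == u i)%:R) * f t.
  under [RHS]eq_bigr do rewrite mulr_suml.
  by rewrite exchange_big; apply: eq_bigr => i _; rewrite sum_ind.
rewrite !sE -sumrB; under eq_bigr do rewrite -mulrBl.
apply: cf; under [X in real_comb X]eq_fun do rewrite -mulN1r.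
by rewrite real_combD real_combZ !real_comb_sum rmorphN1 scaleN1r gh subrr.
Qed.

Lemma consistent_nonsignalling f : consistent f -> nonsignalling f.
Proof.
have [QL QR] := Q_nonsignalling R n k.
by move=> cf; split=> [a x z w|b y z w]; apply: consistent_sum.
Qed.

Lemma sum_unit_coef (f : idx n k -> R) x y :
  \sum_t unit_coef R x y t * f t = \sum_a \sum_b f (a, b, x, y).
Proof.
rewrite pair_big/=; rewrite (bigID (fun t : idx n k =>
  (t.1.2 == x) && (t.2 == y)))/=.
rewrite [X in _ + X]big1 ?addr0; last first.
  by move=> t /negPf h; rewrite /unit_coef h mul0r.
rewrite (reindex_onto (fun c : 'I_k * 'I_k => (c, x, y) : idx n k) (fun t =>
  t.1.1))/=.
  apply: eq_big => [c|c _]; first by rewrite !eqxx.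
  by rewrite /unit_coef/= !eqxx mul1r; case: c.
by move=> [[c x'] y'] /= /andP[/eqP -> /eqP ->].
Qed.

End Consistent.

Section SmxMinus.
Variables (R : realType) (V : lmodType R[i]) (C : set V) (e : V) (q : seq V).
Hypothesis C0 : C 0.
Hypothesis CZ : forall (c : R) u, 0 <= c -> C u -> C (c%:C *: u).
Hypothesis Cq : forall i, (i < size q)%N -> C q`_i /\ C (e - q`_i).
Local Notation M := (size q).
Local Notation pre := (prefix M).

Lemma Smx_minus (i : 'I_M) : Dmax C (\matrix_(a, b) (Smx e q a b -
  ((pre i.+1 a == pre i.+1 b)%:R)%:C *: branch e q i (odd (pre i.+1 a)))).
Proof.
have Drest : Dmax C (\sum_(j < M | j != i) @kronl R V 1 (2 ^ M)
  ((1 : R)%:C)%:M (Qmx e (q := q) j)).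
  by apply: Dmax_sum => // j _; apply: Qmx_D.
move: Drest; congr (Dmax C _); apply/matrixP => a b.
rewrite [RHS]mxE summxE SmxE [X in _ = X - _](bigD1 i)//= addrAC subrr add0r.
by apply: eq_bigr => j _; rewrite QmxE mul1r.
Qed.

End SmxMinus.

(* The moments <w psi, w' psi> of words of length at most L in the generators. *)
Record truncated_moments (R : realType) n k (p : idx n k -> R) (L : nat)
    (m : seq (idx n k) -> seq (idx n k) -> R) : Prop := TruncatedMoments {
  tm_sym : forall w w', m w w' = m w' w;
  tm_ge0 : forall l, 0 <= kform m l l;
  tm_adj : forall w w' t, (size w < L)%N -> (size w' < L)%N ->
    m (t :: w) w' = m w (t :: w');
  tm_idem : forall w w' t, ((size w).+1 < L)%N ->
    m (t :: t :: w) w' = m (t :: w) w';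
  tm_consistent : forall w w', (size w < L)%N -> consistent (fun t =>
    m (t :: w) w');
  tm_unit : forall w w' x y, (size w < L)%N ->
    \sum_t unit_coef R x y t * m (t :: w) w' = m w w';
  tm_letter : forall t, (0 < L)%N -> m [:: t] [::] = p t;
  tm_nil : m [::] [::] = 1;
  tm_bound : forall w w', (size w <= L)%N -> (size w' <= L)%N -> `|m w w'| <= 1
}.

Section MomentProperties.
Variables (R : realType) (n k : nat) (n_gt0 : (0 < n)%N).
Local Notation V := (Vns R n k).
Local Notation Qg := (@Qidx R n k).
Local Notation e := (e_ns R n k).
Local Notation C := (@D_ns R n k).
Local Notation rc := (@real_comb R n k).
Local Notation D := (@Dmax R V C).
Variables (s : seq (idx n k)) (L : nat) (p : idx n k -> R).
Local Notation q := (letters R s L).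
Local Notation M := (size q).
Local Notation N := (1 * 2 ^ M)%N.
Local Notation S := (Smx e q).
Local Notation pre := (prefix M).
Variable G : idx n k -> 'I_N -> 'I_N -> R.
Hypothesis GP : forall (y : idx n k -> 'I_N -> 'I_N -> R) (r : idx n k ->
  R) (T : R),
  D (\matrix_(a, b) (rc r + T%:C *: S a b - rc (fun t =>
    (y t a b + y t b a) / 2))) ->
  \sum_t \sum_a \sum_b y t a b * G t a b <= \sum_t r t * p t.
Variable x0 : 'I_n.

Let sum0p : \sum_t 0 * p t = 0.
Proof. by rewrite big1// => t _; rewrite mul0r. Qed.

Let GPr (y : idx n k -> 'I_N -> 'I_N -> R) r T (X : 'M[V]_N) : D X ->
  (forall a b, rc (fun t => (y t a b + y t b a) / 2)
    = rc r + T%:C *: S a b - X a b) ->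
  \sum_t \sum_a \sum_b y t a b * G t a b <= \sum_t r t * p t.
Proof.
move=> DX yX; apply: (GP (T := T)); move: DX; congr (D _); apply/matrixP => a b.
by rewrite [RHS]mxE yX opprB addrC subrK.
Qed.

Let GP0 (y : idx n k -> 'I_N -> 'I_N -> R) :
  (forall a b, rc (fun t => (y t a b + y t b a) / 2) = 0) ->
  \sum_t \sum_a \sum_b y t a b * G t a b <= 0.
Proof.
move=> y0; have := @GPr y (fun=> 0) 0 0 (Dmax0 (@Dns0 R n k) N).
rewrite sum0p.
apply=> a b; rewrite y0 real_comb0 mxE -[0%:C]/(0 : R[i]).
by rewrite scale0r addr0 subr0.
Qed.

Let sum3 t0 (a0 b0 : 'I_N) (F : idx n k -> 'I_N -> 'I_N -> R) :
  \sum_t \sum_a \sum_b (t == t0)%:R * ((a == a0)%:R * (b == b0)%:R)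
    * F t a b = F t0 a0 b0.
Proof.
under eq_bigr do under eq_bigr do under eq_bigr do rewrite -!mulrA.
under eq_bigr do under eq_bigr do (rewrite -!mulr_sumr sum_ind).
by under eq_bigr do (rewrite -mulr_sumr sum_ind); rewrite sum_ind.
Qed.

(** A family that is antisymmetric in the matrix indices represents zero, so the functional is
    nonpositive on it and on its opposite. *)
Lemma G_sym t a b : G t a b = G t b a.
Proof.
suff le a' b' : G t a' b' <= G t b' a' by apply/le_anti; rewrite !le.
rewrite -subr_le0.
have := @GP0 (fun i c d => (i == t)%:R * ((c == a')%:R * (d == b')%:R)
    - (i == t)%:R * ((c == b')%:R * (d == a')%:R)).
under eq_bigr do under eq_bigr do (under eq_bigr do rewrite mulrBl;
  rewrite sumrB).
under eq_bigr do rewrite sumrB; rewrite sumrB !sum3; apply=> c d.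
rewrite -[RHS](real_comb0 R n k); congr rc; apply/funext => i.
by ring.
Qed.

Lemma G_consistent a b : consistent (fun t => G t a b).
Proof.
move=> c c0; suff le (c' : idx n k -> R) : rc c' = 0 ->
  \sum_t c' t * G t a b <= 0.
  apply/le_anti; rewrite le//= -oppr_le0 -sumrN.
  have := le (fun t => -1 * c t); rewrite real_combZ c0 scaler0 => /(_ erefl).
  by congr (_ <= _); apply: eq_bigr => t _; rewrite -mulrA mulN1r.
move=> c'0; have := @GP0 (fun i i' j' => c' i * ((i' == a)%:R * (j' == b)%:R)).
have -> : \sum_t \sum_i \sum_j c' t * ((i == a)%:R * (j == b)%:R) * G t i j =
    \sum_t c' t * G t a b.
  apply: eq_bigr => t _; under eq_bigr do under eq_bigr do rewrite -!mulrA.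
  under eq_bigr do (rewrite -!mulr_sumr sum_ind).
  by rewrite -mulr_sumr sum_ind.
apply=> i j; pose d : R := ((i == a)%:R * (j == b)%:R + (j == a)%:R * (i ==
  b)%:R) / 2.
rewrite -[RHS](scaler0 V d%:C) -c'0 -real_combZ; congr rc; apply/funext => t.
by rewrite /d; ring.
Qed.

(** The functional extends the state: c Q_t (x) J is bounded by c [p t] for c = 1 and for c = -1. *)
Lemma G_sum t : \sum_a \sum_b G t a b = p t.
Proof.
have H (c : R) : c * \sum_a \sum_b G t a b <= c * p t.
  have := @GPr (fun i _ _ => c * (i == t)%:R) (fun i => c * (i == t)%:R) 0 0
    (Dmax0 (@Dns0 R n k) N).
  have -> : \sum_i \sum_(a < N) \sum_(b < N)
    c * (i == t)%:R * G i a b = c * \sum_a \sum_b G t a b.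
    under eq_bigr do under eq_bigr do rewrite -mulr_sumr.
    under eq_bigr do rewrite -mulr_sumr -mulrA.
    by rewrite -mulr_sumr sum_ind.
  have -> : \sum_i c * (i == t)%:R * p i = c * p t.
    by under eq_bigr do rewrite -mulrA; rewrite -mulr_sumr sum_ind.
  apply=> a b; rewrite [0%:C *: _](scale0r (S a b)) addr0 [X in _ - X]mxE subr0.
  by congr rc; apply/funext => i; field.
by have := H 1; have := H (-1); rewrite !mulN1r !mul1r lerN2 => h1 h2;
  apply/le_anti/andP.
Qed.

Lemma G_psd t : psd (G t).
Proof.
split=> [a b|f]; first exact: G_sym.
rewrite -oppr_le0.
have Df := @Dmax_block _ _ C N (fun=> 0%N) f (fun=> Qg t) (fun=> Dns_Q R t).
have := @GPr (fun i a b => - ((i == t)%:R * (f a * f b))) (fun=> 0) 0 _ Df.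
have -> : \sum_i \sum_a \sum_b - ((i == t)%:R * (f a * f b))
  * G i a b = - bil (G t) f f.
  rewrite -[bil _ _ _](sum_ind t (fun t => bil (G t) f f)) -sumrN;
    apply: eq_bigr => i _.
  rewrite /bil mulr_sumr -sumrN; apply: eq_bigr => a _.
  rewrite mulr_sumr -sumrN; apply: eq_bigr => b _.
  by rewrite mulNr !mulrA.
rewrite sum0p.
apply=> a b; rewrite [0%:C *: _](scale0r (S a b))
  addr0 real_comb0 sub0r mxE mul1r.
rewrite -real_comb1 -real_combZ -scaleN1r -(rmorphN1 (real_complex R))
  -real_combZ.
by congr rc; apply/funext => i; field.
Qed.

(** The moment matrix of the unit, which serves as the Gram matrix of the basis vectors. *)
Definition Ge a b := \sum_t unit_coef R x0 x0 t * G t a b.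

Lemma Ge_E x y a b : Ge a b = \sum_a' \sum_b' G (a', b', x, y) a b.
Proof.
rewrite /Ge sum_unit_coef.
have ns := consistent_nonsignalling (@G_consistent a b).
exact: (nonsignalling_unit x0 x0 x y ns).
Qed.

Lemma Ge_sym a b : Ge a b = Ge b a.
Proof. by apply: eq_bigr => t _; rewrite G_sym. Qed.

Lemma bil_Ge f g x y : bil Ge f g = \sum_a \sum_b bil (G (a, b, x, y)) f g.
Proof.
rewrite -(sum_unit_coef (fun t => bil (G t) f g)) -bil_mat.
apply: eq_bigr => a _; apply: eq_bigr => b _; congr (_ * _).
by rewrite sum_unit_coef (Ge_E x y).
Qed.

Lemma G_le_Ge t f : bil (G t) f f <= bil Ge f f.
Proof.
case: t => [[[a b] x] y]; rewrite (bil_Ge _ _ x y) (bigD1 a)//= (bigD1 b)//=.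
rewrite -addrA lerDl addr_ge0 ?sumr_ge0// => i _.
  by have [_] := G_psd (a, i, x, y); apply.
by apply: sumr_ge0 => j _; have [_] := G_psd (i, j, x, y); apply.
Qed.

Lemma Ge_sub_psd t : psd (fun a b => Ge a b - G t a b).
Proof.
split=> [a b|f]; first by rewrite Ge_sym G_sym.
have -> : bil (fun a b => Ge a b - G t a b) f f = bil Ge f f - bil (G t) f f.
  rewrite /bil -sumrB; apply: eq_bigr => a _; rewrite -sumrB.
  by apply: eq_bigr => b _; rewrite mulrBr.
by rewrite subr_ge0 G_le_Ge.
Qed.

(** Multiples of [Smx] are free in the bounds. As [Smx] dominates Q_i, taking r = 0 and T = 1 makes
    the functional nonpositive on Q_i. *)
Lemma G_letter (i : 'I_M) t : q`_i = Qg t ->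
  \sum_(a < N) \sum_(b < N) (pre i.+1 a == pre i.+1 b)%:R *
     (if odd (pre i.+1 a) then G t a b else Ge a b - G t a b) <= 0.
Proof.
move=> qt; pose co (b : bool) j : R := if b then (j == t)%:R
  else unit_coef R x0 x0 j - (j == t)%:R.
have coE b : rc (co b) = branch e q i b.
  rewrite /branch qt /co; case: b; first exact: real_comb1.
  under [fun j => _]eq_fun do rewrite -mulN1r.
  by rewrite real_combD real_combZ real_comb1 -e_ns_comb rmorphN1 scaleN1r.
have := @GPr (fun j a b => (pre i.+1 a == pre i.+1 b)%:R * co (odd (pre i.+1 a))
  j)
  (fun=> 0) 1 _ (Smx_minus (@Dns0 R n k) (@DnsZ R n k) (@letters_Dns R n k s L)
    i).
rewrite sum0p.
have -> : \sum_j \sum_(a < N) \sum_(b < N)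
  (pre i.+1 a == pre i.+1 b)%:R * co (odd (pre i.+1 a)) j * G j a b
  = \sum_(a < N) \sum_(b < N) (pre i.+1 a == pre i.+1 b)%:R *
     (if odd (pre i.+1 a) then G t a b else Ge a b - G t a b).
  rewrite exchange_big; apply: eq_bigr => a _; rewrite exchange_big;
    apply: eq_bigr => b _.
  under eq_bigr do rewrite -mulrA; rewrite -mulr_sumr; congr (_ * _).
  rewrite /co; case: odd; first by rewrite sum_ind.
  under eq_bigr do rewrite mulrBl; rewrite sumrB sum_ind//.
apply=> a b; rewrite mxE -coE real_comb0 add0r scale1r opprB addrC subrK.
rewrite -real_combZ; congr rc; apply/funext => j.
rewrite [pre i.+1 b == _]eq_sym; case: eqP => [->|_]; rewrite ?mul1r ?mul0r.
  by field.
by rewrite addr0 mul0r.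
Qed.


Hypothesis s_all : forall t, t \in s.

Definition pos j (t : idx n k) := (j * size s + index t s)%N.

Lemma size_letters : M = (L * size s)%N.
Proof.
by rewrite /letters size_flatten /shape map_nseq size_map sumn_nseq mulnC.
Qed.

Lemma pos_ltS j t : (pos j t < j.+1 * size s)%N.
Proof. by rewrite /pos mulSn addnC ltn_add2r index_mem. Qed.

Lemma pos_lt j t : (j < L)%N -> (pos j t < M)%N.
Proof.
move=> jL; rewrite size_letters; apply: leq_trans (pos_ltS j t) _.
by rewrite leq_mul2r jL orbT.
Qed.

Lemma letters_pos j t : (j < L)%N -> q`_(pos j t) = Qg t.
Proof.
rewrite /letters; elim: L j => // L' IH [|j] jL /=.
  rewrite /pos mul0n nth_cat size_map index_mem s_all.
  by rewrite (nth_map t) ?index_mem// nth_index.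
by rewrite /pos mulSn -addnA nth_cat size_map ltnNge leq_addr addKn IH.
Qed.

(* A word, whose first letter acts last, is sent to the indicator of the       *)
(* indices whose bits select the letters of the word, the last letter being   *)
(* looked up in the first copy of [s], the one before in the second copy, and *)
(* so on.                                                                     *)
Fixpoint etaw (w : seq (idx n k)) (a : 'I_N) : R :=
  if w is t :: w' then etaw w' a * (~~ odd (pre (pos (size w')
    t).+1 a))%:R else 1.

Lemma etaw_prefix w i (a b : 'I_N) : (size w * size s <= i)%N -> (i <= M)%N ->
  pre i a = pre i b -> etaw w a = etaw w b.
Proof.
elim: w => //= t w IH wi iM ab; rewrite IH//; last first.
  by apply: leq_trans wi; rewrite leq_mul2r leqnSn orbT.
by rewrite (@prefix_le M (pos (size w) t).+1 i a b)// (leq_trans (pos_ltS _ _)).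
Qed.

(** By [G_letter] and [block_null], [G t] vanishes on the part of the vector of w where bit i is 1,
    and [Ge] minus [G t] on the part where it is 0. The vector of w must be constant on the blocks,
    which holds because its letters are read in earlier copies of [s]. *)
Lemma etaw_null w t : (size w < L)%N -> forall g,
  bil (G t) (etaw w) g = bil (G t) (etaw (t :: w)) g /\
  bil (G t) (etaw (t :: w)) g = bil Ge (etaw (t :: w)) g.
Proof.
move=> wL g; have iM := pos_lt t wL; set i := pos (size w) t in iM *.
have lt := letters_pos t wL; have sumP := G_letter (i := Ordinal iM) lt.
pose P c := if odd c then G t else fun a b => Ge a b - G t a b.
have Ppsd c : psd (P c) by rewrite /P; case: odd;
  [exact: G_psd|exact: Ge_sub_psd].
have dep (a b : 'I_N) : pre i.+1 a = pre i.+1 b -> etaw w a = etaw w b.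
  move=> ab; apply: (@etaw_prefix w i) => //; rewrite ?(ltnW iM)// ?leq_addr//.
  exact: prefix_le ab.
have null := @block_null _ _ (fun a : 'I_N => pre i.+1 a) P Ppsd.
have sumP' : \sum_(a < N) \sum_(b < N)
  (pre i.+1 a == pre i.+1 b)%:R * P (pre i.+1 a) a b <= 0.
  apply: le_trans sumP; apply: ler_sum => a _; apply: ler_sum => b _.
  by rewrite /P; case: odd.
have nodd := null sumP' odd (G t) _ _ dep g.
have neven := null sumP' (fun z => ~~ odd z) (fun a b =>
  Ge a b - G t a b) _ _ dep g.
split.
  have wE : etaw w =1 fun a =>
    etaw (t :: w) a + etaw w a * (odd (pre i.+1 a))%:R.
    by move=> a /=; case: odd; rewrite ?mulr0 ?mulr1 ?addr0 ?add0r.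
  rewrite (eq_bil _ wE (fun=> erefl)) bilDl nodd ?addr0//.
  by move=> z; rewrite /P => ->.
have -> : bil Ge (etaw (t :: w)) g = bil (fun a b =>
  Ge a b - G t a b) (etaw (t :: w)) g
    + bil (G t) (etaw (t :: w)) g.
  rewrite /bil -big_split; apply: eq_bigr => a _; rewrite -big_split.
  by apply: eq_bigr => b _; rewrite /= -mulrDr subrK.
by rewrite neven ?add0r// => z; rewrite /P => /negPf ->.
Qed.

Definition kern w w' := bil Ge (etaw w) (etaw w').

Lemma kern_cons w t w' : (size w < L)%N ->
  kern (t :: w) w' = bil (G t) (etaw w) (etaw w').
Proof. by move=> wL; have [-> ->] := etaw_null t wL (etaw w'). Qed.

Lemma kern_sym w w' : kern w w' = kern w' w.
Proof. exact/bilC/Ge_sym. Qed.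

Lemma kern_diag w : kern [::] [::] = 1 -> (size w <= L)%N -> 0 <= kern w w <= 1.
Proof.
move=> k1; elim: w => [_|t w IH wL]; first by rewrite k1 ler01 lexx.
have [_ PG] := G_psd t.
have -> : kern (t :: w) (t :: w) = bil (G t) (etaw w) (etaw w).
  have [e1 _] := etaw_null t wL (etaw w).
  by rewrite kern_cons// (bilC _ _ (G_sym t)) -e1.
rewrite PG/=; apply: le_trans (G_le_Ge _ _) _.
by have /andP[] := IH (ltnW wL).
Qed.

Hypothesis p_unit : \sum_t unit_coef R x0 x0 t * p t = 1.

Lemma kern_nil : kern [::] [::] = 1.
Proof.
rewrite /kern bil_mat -[RHS]p_unit; apply: eq_bigr => t _; congr (_ * _).
rewrite -G_sum; apply: eq_bigr => a _; apply: eq_bigr => b _.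
by rewrite !mul1r.
Qed.

(** Prefixing w by t replaces [Ge] by [G t] ([kern_cons]), so the relations between words reduce to
    symmetry, positivity and consistency of the [G t]. *)
Lemma kern_moments : truncated_moments p L kern.
Proof.
split.
- exact: kern_sym.
- move=> l; pose f a := \sum_(z <- l) z.1 * etaw z.2 a.
  have -> : kform kern l l = bil Ge f f.
    rewrite /f bil_suml; apply: eq_bigr => z _.
    rewrite bilZl (bilC _ _ Ge_sym) bil_suml mulr_sumr; apply: eq_bigr => z' _.
    by rewrite bilZl (bilC _ _ Ge_sym) mulrA.
  by rewrite /Ge bil_mat sumr_ge0// => t _; rewrite mulr_ge0 ?ler0n//;
    have [_] := G_psd t; apply.
- move=> w w' t wL wL'; rewrite kern_cons// kern_sym kern_cons//.
  exact/bilC/G_sym.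
- move=> w w' t wL; rewrite kern_cons//.
  by have [_ ->] := etaw_null t (ltnW wL) (etaw w').
- move=> w w' wL c c0; under eq_bigr do rewrite kern_cons//.
  rewrite -bil_mat /bil big1// => a _; rewrite big1// => b _.
  by rewrite (G_consistent a b c0) mulr0.
- move=> w w' x y wL; under eq_bigr do rewrite kern_cons//.
  rewrite -bil_mat; apply: eq_bigr => a _; apply: eq_bigr => b _; congr (_ * _).
  by rewrite sum_unit_coef -(Ge_E x y).
- move=> t L0; rewrite kern_cons// -G_sum; apply: eq_bigr => a _;
  apply: eq_bigr => b _.
  by rewrite !mul1r.
- exact: kern_nil.
move=> w w' wL wL'.
have /andP[_ k1] := kern_diag kern_nil wL;
  have /andP[_ k2] := kern_diag kern_nil wL'.
have Ge_ge0 f : 0 <= bil Ge f f.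
  rewrite /Ge bil_mat sumr_ge0// => t _; rewrite mulr_ge0 ?ler0n//.
  by have [_] := G_psd t; apply.
(* Positivity at c = 1 and c = -1 bounds 2 |kern w w'| by the sum of the two diagonal values, each
   at most 1. *)
have expand c : bil Ge (fun a => etaw w a + c * etaw w' a) (fun a =>
  etaw w a + c * etaw w' a)
    = kern w w + 2 * c * kern w w' + c ^+ 2 * kern w' w'.
  rewrite bilDl bilZl (bilC (etaw w) _ Ge_sym) (bilC (etaw w') _ Ge_sym)
    !bilDl !bilZl.
  by rewrite -![bil Ge _ _]/(kern _ _) (kern_sym w' w); ring.
have := Ge_ge0 (fun a => etaw w a + 1 * etaw w' a).
have := Ge_ge0 (fun a => etaw w a + -1 * etaw w' a).
by rewrite !expand => h1 h2; rewrite ler_norml; apply/andP; split; lra.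
Qed.

End MomentProperties.

Lemma state_moments (R : realType) (n k : nat) (x0 : 'I_n) (s : seq (idx n k))
    (p : idx n k -> R) (phi : {scalar (Vns R n k)}) (L : nat) :
  (forall t, t \in s) -> (0 < L)%N -> is_state (D_qc s) (e_ns R n k) phi ->
  (forall t, phi (Qidx R t) = (p t)%:C) ->
  \sum_t unit_coef R x0 x0 t * p t = 1 ->
  exists m, truncated_moments p L m.
Proof.
move=> s_all L0 phi_state phiQ p1;
  have n0 := leq_ltn_trans (leq0n x0) (ltn_ord x0).
have [G GP] := moment_matrices n0 (@letters_Dns R n k s L)
  (@state_ge0 R n k n0 s L p phi L0 phi_state phiQ).
exact: (ex_intro _ _ (kern_moments GP s_all p1)).
Qed.

(** * Ultrafilter limit of truncated moments *)

Section MomentLimit.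
Variables (R : realType) (n k : nat) (p : idx n k -> R).
Local Notation W := (seq (idx n k)).

Lemma ultra_bounded_cvg (T : Type) (U : set_system T) (u : T -> R) :
  UltraFilter U -> U [set x | `|u x| <= 1] ->
    exists l : R, u x @[x --> U] --> l.
Proof.
move=> UU U1.
have FA : (u @ U) `[-1, 1]%classic.
  suff : U [set x | u x \in `[-1, 1]] by [].
  by apply: filterS U1 => x /=; rewrite in_itv/= -ler_norml.
have [l [_ cl]] := @segment_compact R (-1) 1 (u @ U) _ FA.
exists l => B Bl; have [//|UB] := in_ultra_setVsetC (u @^-1` B) UU.
by have [y [/= yB By]] := cl (~` B) B UB Bl.
Qed.

(** The bounds by 1 give a limit for each pair of words along a nonprincipal ultrafilter. Every
    required relation involves finitely many moments and holds at all large levels, so it survives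
    in the limit. *)
Lemma moments_limit : (forall L, (0 < L)%N ->
  exists m, truncated_moments p L m) ->
  exists m, forall L, (0 < L)%N -> truncated_moments p L m.
Proof.
move=> Hm; have /choice[mL mLP] : forall L, exists m,
  truncated_moments p L.+1 m.
  by move=> L; apply: Hm.
have [U [UU ooU]] := @ultraFilterLemma nat \oo _.
have Uge (P : nat -> Prop) : (exists L0, forall L, (L0 <= L)%N -> P L) ->
  U [set L | P L].
  by move=> [L0 LP]; apply: ooU; exists L0.
have /choice[m mP] : forall z : W * W, exists l : R,
  mL L z.1 z.2 @[L --> U] --> l.
  move=> [w w']; apply: ultra_bounded_cvg; apply: Uge.
  exists (maxn (size w) (size w')) => L; rewrite geq_max => /andP[wL w'L].
  by apply: (tm_bound (mLP L)); apply: leqW.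
have cvg_comb (r : seq (R * (W * W))) (c : R) :
    c + \sum_(z <- r) z.1 * mL L z.2.1 z.2.2 @[L --> U] --> c + \sum_(z <- r)
      z.1 * m z.2.
  apply: cvgD; first exact: cvg_cst.
  elim: r => [|z r IH].
    by under eq_cvg do rewrite big_nil; rewrite big_nil; exact: cvg_cst.
  under eq_cvg do rewrite big_cons; rewrite big_cons; apply: cvgD IH.
  by apply: cvgMl_tmp; apply: mP.
have lim_ge0 r c : (exists L0, forall L, (L0 <= L)%N ->
      0 <= c + \sum_(z <- r) z.1 * mL L z.2.1 z.2.2) ->
    0 <= c + \sum_(z <- r) z.1 * m z.2.
  by move=> /Uge H; apply: (cvgr_to_ge (cvg_comb r c)).
have lim_eq0 r c : (exists L0, forall L, (L0 <= L)%N ->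
      c + \sum_(z <- r) z.1 * mL L z.2.1 z.2.2 = 0) ->
    c + \sum_(z <- r) z.1 * m z.2 = 0.
  move=> [L0 H]; apply/le_anti/andP; split; last first.
    by apply: lim_ge0; exists L0 => L /H ->.
  have neg (g : W * W -> R) :
      \sum_(z <- [seq (- z.1, z.2) | z <- r]) z.1 * g z.2 = - \sum_(z <- r)
        z.1 * g z.2.
    by rewrite big_map -sumrN; apply: eq_bigr => z _; rewrite mulNr.
  rewrite -oppr_ge0 opprD -(neg m); apply: lim_ge0; exists L0 => L /H e.
  by rewrite (neg (fun z => mL L z.1 z.2)) -opprD e oppr0.
have lim_eq2 (z z' : W * W) : (exists L0, forall L, (L0 <= L)%N ->
    mL L z.1 z.2 = mL L z'.1 z'.2) -> m z = m z'.
  move=> [L0 H]; have := @lim_eq0 [:: (1, z); (-1, z')] 0.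
  rewrite !big_cons big_nil/= !mul1r mulN1r add0r addr0 => H'.
  apply/eqP; rewrite -subr_eq0; apply/eqP/H'; exists L0 => L /H e.
  by rewrite !big_cons big_nil/= e !mul1r mulN1r add0r addr0 subrr.
have lim_sum (f : idx n k -> W * W) (d : idx n k -> R) (c : R) :
    (exists L0, forall L, (L0 <= L)%N ->
      \sum_t d t * mL L (f t).1 (f t).2 = c) ->
    \sum_t d t * m (f t) = c.
  move=> [L0 H]; have := @lim_eq0 [seq (d t, f t) | t <- index_enum _] (- c).
  rewrite big_map/= => H'; apply/eqP; rewrite -subr_eq0 addrC; apply/eqP/H'.
  by exists L0 => L /H e; rewrite big_map/= e addNr.
exists (fun w w' => m (w, w')) => L L0; split.
- by move=> w w'; apply: lim_eq2; exists 0%N => L' _; apply: (tm_sym (mLP L')).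
- move=> l; have := @lim_ge0 [seq (z.1 * z'.1, (z.2, z'.2)) | z <- l,
  z' <- l] 0.
  rewrite big_allpairs_dep/= add0r; apply; exists 0%N => L' _.
  by rewrite big_allpairs_dep/= add0r; apply: (tm_ge0 (mLP L')).
- move=> w w' t wL wL'; apply: lim_eq2; exists L => L' LL'.
  by apply: (tm_adj (mLP L')); rewrite ltnS (leq_trans _ LL')// ltnW.
- move=> w w' t wL; apply: lim_eq2; exists L => L' LL'.
  by apply: (tm_idem (mLP L')); rewrite ltnS (leq_trans _ LL')// ltnW.
- move=> w w' wL c c0; apply: (lim_sum (fun t => (t :: w, w')));
  exists L => L' LL'.
  by apply: (tm_consistent (mLP L')) => //;
    rewrite ltnS (leq_trans _ LL')// ltnW.
- move=> w w' x y wL.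
  have := @lim_eq0 ((-1, (w, w')) :: [seq (unit_coef R x y t, (t :: w,
    w')) | t <- index_enum _]) 0.
  rewrite big_cons big_map/= add0r mulN1r addrC => H.
  apply/eqP; rewrite -subr_eq0; apply/eqP/H; exists L => L' LL'.
  rewrite big_cons big_map/= add0r mulN1r (tm_unit (mLP L')) ?addNr//.
  by rewrite ltnS (leq_trans _ LL')// ltnW.
- move=> t _; have := @lim_eq0 [:: (1, ([:: t], [::]))] (- p t).
  rewrite big_seq1/= mul1r => H; apply/eqP; rewrite -subr_eq0 addrC;
    apply/eqP/H.
  by exists 0%N => L' _; rewrite big_seq1/= mul1r (tm_letter (mLP L'))// addNr.
- have := @lim_eq0 [:: (1, ([::], [::]))] (- 1).
  rewrite big_seq1/= mul1r => H; apply/eqP; rewrite -subr_eq0 addrC;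
    apply/eqP/H.
  by exists 0%N => L' _; rewrite big_seq1/= mul1r (tm_nil (mLP L'))// addNr.
move=> w w' wL wL'; have bd (c : R) : `|c| = 1 -> c * m (w, w') <= 1.
  move=> c1; have := @lim_ge0 [:: (- c, (w, w'))] 1.
  rewrite big_seq1/= mulNr subr_ge0; apply; exists L => L' LL'.
  rewrite big_seq1/= mulNr subr_ge0 (le_trans (ler_norm _))// normrM c1 mul1r.
  by apply: (tm_bound (mLP L')); apply: leqW; apply: leq_trans LL'.
rewrite ler_norml; have := bd 1 (normr1 _); have := bd (-1) (normrN1 _).
by rewrite mulN1r mul1r lerNl => -> ->.
Qed.

End MomentLimit.

(** * From moments to a quantum commuting model *)

Section KernelOperators.
Variables (R : realType) (W : Type) (m : psd_kernel R W).
Local Notation K := (kform m).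
Local Notation E := (rkhs m).

Lemma rkhs_ext (g h : E) : (forall w, g w = h w) -> g = h.
Proof. by move=> gh; apply/val_inj/funext. Qed.

Lemma rkhs_sum (I : Type) (r : seq I) (F : I -> E) w :
  (\sum_(i <- r) F i) w = \sum_(i <- r) F i w.
Proof. by apply: (big_morph (fun g : E => g w)). Qed.

Lemma kform_sum l l' : K l l' = \sum_(z <- l') z.1 * K l [:: (1, z.2)].
Proof.
rewrite /kform exchange_big; apply: eq_bigr => z _; rewrite mulr_sumr.
by apply: eq_bigr => z' _; rewrite big_seq1/= mulr1 mulrCA mulrA.
Qed.

(** All multiples of a null combination have zero seminorm, so boundedness of g forces the value to
    be 0. Relations between moments thereby become pointwise relations between functions in the
    space. *)
Lemma rkhs_null (g : E) l : (forall w, K l [:: (1, w)] = 0) -> leval l g = 0.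
Proof.
move=> l0; have Kl : K l l = 0 by rewrite kform_sum big1// => z _;
  rewrite l0 mulr0.
have ub c : 2 * c * leval l g <= rsq g.
  by have := rkhs_ub g (lscale c l);
    rewrite kformZl kformZr Kl !mulr0 subr0 leval_scale mulrA.
apply/eqP; apply: contraT => x0.
have := ub ((rsq g + 1) / (2 * leval l g)).
have -> : 2 * ((rsq g + 1) / (2 * leval l g)) * leval l g = rsq g + 1 by field.
by rewrite gerDl ler10.
Qed.

Definition kvec_fun l : W -> R^o := fun w => K l [:: (1, w)].

Lemma leval_kvec l l' : leval l' (kvec_fun l) = K l l'.
Proof. by rewrite [RHS]kform_sum. Qed.

Lemma kvec_bound l : kbound m (kvec_fun l) (K l l).
Proof.
move=> l'; rewrite leval_kvec; have := kform_ge0 m (l ++ lscale (-1) l').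
rewrite kformDl !kformDr !kformZl !kformZr (kformC _ l' l); lra.
Qed.

Definition kvec l : E := Rkhs (kboundedI (kvec_bound l)).

Lemma rsq_kvec l : rsq (kvec l) = K l l.
Proof.
apply/le_anti; rewrite (ksq_le (kvec_bound l))/=.
by have := rkhs_ub (kvec l) l; rewrite leval_kvec; lra.
Qed.

Lemma kvecD l l' : kvec l + kvec l' = kvec (l ++ l').
Proof. by apply/val_inj/funext => w; rewrite /= /kvec_fun kformDl. Qed.

Lemma kvecB l l' : kvec l - kvec l' = kvec (l ++ lscale (-1) l').
Proof.
by apply/val_inj/funext => w; rewrite /= /kvec_fun kformDl kformZl mulN1r.
Qed.

Lemma rdot_kvec l l' : @rdot R (rkhs_hilbert m) (kvec l) (kvec l') = K l l'.
Proof.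
rewrite /= /polar kvecD kvecB !rsq_kvec.
rewrite !kformDl !kformDr !kformZl !kformZr (kformC _ l' l).
by field.
Qed.

Definition pushl (f : W -> W) (l : seq (R * W)) := [seq (z.1, f z.2) | z <- l].

Lemma leval_push f l (g : W -> R) : leval (pushl f l) g = leval l (g \o f).
Proof. by rewrite /leval big_map. Qed.

Section Shift.
Variable f : W -> W.
Hypothesis f_contr : forall l, K (pushl f l) (pushl f l) <= K l l.

(** Composition with f is the transpose of [pushl f], so a contraction of combinations gives a
    contraction of functions. *)
Lemma shift_bound (g : E) : kbound m (g \o f) (rsq g).
Proof.
move=> l; rewrite -leval_push; apply: le_trans (rkhs_ub g (pushl f l)).
by rewrite lerD2l lerN2.
Qed.

Definition shift (g : E) : E := Rkhs (kboundedI (shift_bound g)).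

Lemma shiftD g h : shift (g + h) = shift g + shift h.
Proof. exact: val_inj. Qed.

Lemma shiftZ c g : shift (c *: g) = c *: shift g.
Proof. exact: val_inj. Qed.

Lemma rsq_shift g : rsq (shift g) <= rsq g.
Proof. exact/ksq_le/shift_bound. Qed.

End Shift.

End KernelOperators.

Section RealProjection.
Variables (R : realType) (E : real_hilbert R) (A : E -> E).
Local Notation r := (@rdot R E).
Hypothesis AD : forall g h, A (g + h) = A g + A h.
Hypothesis AZ : forall c g, A (c *: g) = c *: A g.
Hypothesis A_contr : forall g, r (A g) (A g) <= r g g.
Hypothesis A_idem : forall g, A (A g) = A g.

Lemma projection_selfadjoint g h : r (A g) h = r g (A h).
Proof.
have orth x y : r (A x) (y - A y) = 0.
  have : A (y - A y) = 0 by rewrite -scaleN1r AD AZ A_idem scaleN1r subrr.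
  (* [A x + c v] has the same image [A x] for all [c], so [v] is orthogonal *)
  (* to [A x]. *)
  move: (y - A y) => v Av; apply: (@quad_ge0_lin0 _ _ (r v v)) => c.
  have := A_contr (A x + c *: v); rewrite AD AZ Av scaler0 addr0 A_idem.
  rewrite !rdotE (rdotC v); lra.
have e1 := orth g h; have e2 := orth h g.
rewrite !rdotE in e1 e2; rewrite [RHS]rdotC.
have := rdotC (A g) (A h); lra.
Qed.

Definition cplx_op (u : cplx E) : cplx E := (A u.1, A u.2).

Lemma cplx_op_projection : @projection R (cplx_hilbert E) cplx_op.
Proof.
split; first by apply/funext => -[x y]; rewrite /cplx_op/= !A_idem.
by move=> u v; rewrite /= /cdot/= !projection_selfadjoint.
Qed.

Lemma cplx_op_bounded : @bounded_operator R (cplx_hilbert E) cplx_op.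
Proof.
split.
  move=> c u v; rewrite /cplx_op; congr pair => /=.
    by rewrite !AD -scaleN1r !AZ scaleN1r.
  by rewrite !AD !AZ.
exists 1 => u; rewrite mul1r !cnormE lecR ler_wsqrtr// /csq lerD//;
  exact: A_contr.
Qed.

End RealProjection.

Lemma hdot_real (R : realType) (E : real_hilbert R) (x y : E) :
  hdot (cplx_hilbert E) (x, 0) (y, 0) = (rdot x y)%:C.
Proof.
have r0l (z : E) : rdot 0 z = 0 by rewrite -(scale0r (0 : E)) rdotZl mul0r.
have r0r (z : E) : rdot z 0 = 0 by rewrite rdotC r0l.
by rewrite [LHS]/(cdot _ _) /cdot !r0l !r0r subrr addr0.
Qed.

Section FromMoments.
Variables (R : realType) (n k : nat) (n_gt0 : (0 < n)%N).
Variables (p : 'I_k -> 'I_k -> 'I_n -> 'I_n -> R).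
Local Notation W := (seq (idx n k)).
Variable m0 : W -> W -> R.
Hypothesis mP : forall L, (0 < L)%N ->
  truncated_moments (fun t => p t.1.1.1 t.1.1.2 t.1.2 t.2) L m0.

Let m := PsdKernel (tm_sym (mP (ltn0Sn 0))) (tm_ge0 (mP (ltn0Sn 0))).
Local Notation K := (kform m).
Local Notation E := (rkhs m).

Let m_adj w w' t : m0 (t :: w) w' = m0 w (t :: w').
Proof.
apply: (tm_adj (mP (ltn0Sn (size w + size w')))); rewrite ltnS ?leq_addr//.
exact: leq_addl.
Qed.

Let m_idem w w' t : m0 (t :: t :: w) w' = m0 (t :: w) w'.
Proof. exact: (tm_idem (mP (ltn0Sn (size w).+1))). Qed.

Let K_adj t l l' : K (pushl (cons t) l) l' = K l (pushl (cons t) l').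
Proof.
rewrite /kform big_map; apply: eq_bigr => z _; rewrite big_map.
by apply: eq_bigr => z' _; rewrite /= m_adj.
Qed.

Let K_idem t l l' : K (pushl (cons t) (pushl (cons t) l))
  l' = K (pushl (cons t) l) l'.
Proof.
rewrite /kform !big_map; apply: eq_bigr => z _.
by apply: eq_bigr => z' _; rewrite /= m_idem.
Qed.

(** Prefixing by t is selfadjoint and idempotent for the form, so the squared seminorm of l minus
    its image is exactly the difference of the two sides. *)
Let K_contr t l : K (pushl (cons t) l) (pushl (cons t) l) <= K l l.
Proof.
have e : K (pushl (cons t) l) (pushl (cons t) l) = K (pushl (cons t) l) l.
  by rewrite -K_adj K_idem.
have := kform_ge0 m (l ++ lscale (-1) (pushl (cons t) l)).
rewrite !kformDl !kformDr !kformZl !kformZr (kformC _ l) e; lra.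
Qed.

Let A t : E -> E := shift (K_contr t).

Let leval_enum (c : idx n k -> R) (f : idx n k -> W) (g : W -> R) :
  leval [seq (c t, f t) | t <- index_enum _] g = \sum_t c t * g (f t).
Proof. by rewrite /leval big_map. Qed.

Let K1 (l : seq (R * W)) w : K l [:: (1, w)] = \sum_(z <- l) z.1 * m0 z.2 w.
Proof. by rewrite /kform; apply: eq_bigr => z _; rewrite big_seq1/= mulr1. Qed.

Let A_idem t g : A t (A t g) = A t g.
Proof.
apply/val_inj/funext => w /=; apply/eqP; rewrite -subr_eq0; apply/eqP.
have := @rkhs_null _ _ m g [:: (1, t :: t :: w); (-1, t :: w)].
rewrite /leval !big_cons big_nil/= mul1r mulN1r addr0; apply=> w'.
by rewrite K1 !big_cons big_nil/= mul1r mulN1r addr0 m_idem subrr.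
Qed.

Let g_consistent (g : E) w : consistent (fun t => g (t :: w)).
Proof.
move=> c c0; rewrite -(leval_enum c (fun t => t :: w)); apply: rkhs_null => w'.
rewrite K1 big_map; exact: (tm_consistent (mP (ltn0Sn (size w)))).
Qed.

Let g_unit (g : E) w x y : \sum_t unit_coef R x y t * g (t :: w) = g w.
Proof.
apply/eqP; rewrite -subr_eq0 addrC; apply/eqP.
have := @rkhs_null _ _ m g ((-1, w) ::
   [seq (unit_coef R x y t, t :: w) | t <- index_enum _]).
rewrite /leval big_cons big_map/= mulN1r; apply=> w'.
rewrite K1 big_cons big_map/= mulN1r.
by rewrite (tm_unit (mP (ltn0Sn (size w)))) ?addNr.
Qed.

Let Hr := rkhs_hilbert m.
Let H := cplx_hilbert Hr.

Let AD t g h : A t (g + h) = A t g + A t h. Proof. exact: shiftD. Qed.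
Let AZ t c g : A t (c *: g) = c *: A t g. Proof. exact: shiftZ. Qed.

Let rdot_rsq (g : E) : @rdot R Hr g g = rsq g.
Proof. by apply: polarxx => *; apply: ksqZ. Qed.

Let A_contr t (g : Hr) : @rdot R Hr (A t g) (A t g) <= @rdot R Hr g g.
Proof. by rewrite !rdot_rsq; apply: rsq_shift. Qed.

Let T t : H -> H := @cplx_op R Hr (A t).

Let psi : H := (kvec m [:: (1, [::])], 0).

Let cplx_sum (I : Type) (r : seq I) (F : I -> cplx Hr) :
  \sum_(i <- r) F i = (\sum_(i <- r) (F i).1, \sum_(i <- r) (F i).2).
Proof.
by elim: r => [|i r IH]; rewrite ?big_nil// !big_cons IH.
Qed.

Let T_ns (u : H) : nonsignalling (fun t => T t u).
Proof.
have ns (g : E) w := consistent_nonsignalling (@g_consistent g w).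
split=> [a x z w|b y z w]; rewrite !cplx_sum /=;
  congr pair; apply: rkhs_ext => v; rewrite !rkhs_sum.
- by have [TL _] := ns u.1 v; apply: TL.
- by have [TL _] := ns u.2 v; apply: TL.
- by have [_ TR] := ns u.1 v; apply: TR.
- by have [_ TR] := ns u.2 v; apply: TR.
Qed.

Let T_unit (u : H) x y : \sum_a \sum_b T (a, b, x, y) u = u.
Proof.
have un (g : E) : \sum_a \sum_b A (a, b, x, y) g = g.
  apply: rkhs_ext => w; rewrite rkhs_sum -[RHS](g_unit g w x y) sum_unit_coef.
  by apply: eq_bigr => a _; rewrite rkhs_sum.
under eq_bigr do rewrite cplx_sum; rewrite cplx_sum/=.
by rewrite !un; case: u.
Qed.

Lemma C_qc_moments : correlation p -> C_qc p.
Proof.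
move=> hp; have x0 := Ordinal n_gt0.
apply: (@C_qc_model R n k H T psi x0 x0) => //.
- move=> t; apply: cplx_op_bounded; [exact: AD|exact: AZ|exact: A_contr].
- move=> t; apply: cplx_op_projection;
  [exact: AD|exact: AZ|exact: A_contr|exact: A_idem].
- rewrite hdot_real rdot_kvec K1 big_seq1 mul1r.
  by rewrite (tm_nil (mP (ltn0Sn 0))).
move=> a b x y; set t := (a, b, x, y).
have -> : T t psi = (kvec m [:: (1, [:: t])], 0).
  rewrite /T /cplx_op /psi/=; congr pair; last first.
    by rewrite -(scale0r (0 : Hr)) AZ !scale0r.
  apply/val_inj/funext => w; rewrite /= /kvec_fun !K1 !big_seq1/=.
  by rewrite -m_adj.
rewrite hdot_real rdot_kvec K1 big_seq1 mul1r.
by rewrite (tm_letter (mP (ltn0Sn 0)) t).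
Qed.

End FromMoments.

(** * From a quantum commuting model to a state *)

Lemma pos_limit (R : realType) (z w : R[i]) : (forall d : R, 0 < d ->
  0 <= z + d%:C * w) -> 0 <= z.
Proof.
case: z w => a b [c d] zw.
have H (x : R) : 0 < x -> b + x * d = 0 /\ 0 <= a + x * c.
  move=> /zw; rewrite lecE/= !mul0r subr0 addr0 => /andP[/eqP bd ac];
    split=> //.
have [b1 _] := H 1 ltr01; have [b2 _] := H 2 (ltr0Sn _ 1).
rewrite lecE/=; apply/andP; split; first by apply/eqP; lra.
rewrite leNgt; apply/negP => a0; have c1 : 0 < `|c| + 1 by rewrite ltr_wpDl.
have Na : 0 < - a by rewrite oppr_gt0.
(* With a negative, this choice keeps the perturbation below - a / 2, too small to compensate a. *)
have [_] := H (- a / (2 * (`|c| + 1))) (divr_gt0 Na (mulr_gt0 (ltr0Sn _ 1) c1)).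
apply/negP; rewrite -ltNge; apply: le_lt_trans (_ : a + - a / 2 < 0);
  last by lra.
rewrite lerD2l; set l := - a / (2 * _).
have l0 : 0 <= l by rewrite divr_ge0 ?(ltW Na)// mulr_ge0// ltW.
have -> : - a / 2 = l * (`|c| + 1) by rewrite /l; field; rewrite gt_eqF.
by rewrite ler_wpM2l// (le_trans (ler_norm c))// lerDl.
Qed.

Section Soundness.
Variables (R : realType) (n k : nat) (H : hilbertSpace R).
Local Notation "''[' u , v ]" := (hdot H u v).
Local Notation V := (Vns R n k).
Local Notation Qg := (@Qidx R n k).
Local Notation e := (e_ns R n k).
Local Notation C := (@D_ns R n k).
Variables (T : idx n k -> H -> H) (x0 : 'I_n).
Hypothesis T_bounded : forall t, bounded_operator (T t).
Hypothesis T_proj : forall t, projection (T t).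
Hypothesis T_ns : forall u, nonsignalling (fun t => T t u).
Hypothesis T_unit : forall u x y, \sum_a \sum_b T (a, b, x, y) u = u.

(** By [rep_lift] this is the linear map sending each generator to its projection, whichever
    representative is chosen. *)
Definition rep (v : V) (u : H) : H := \sum_t (repr v : Vtilde R n k) t *: T t u.

Lemma rep_lift u : exists2 f : V ->
  H, linear f & (forall t, f (Qg t) = T t u) /\ rep^~ u =1 f.
Proof.
have [f linf fQ] := Vns_lift (T_ns u); exists f => //; split=> // v.
pose F : {linear V -> H} := HB.pack f (GRing.isLinear.Build _ _ _ _ f linf).
rewrite [in RHS](Vns_expand v) -[f _]/(F _) linear_sum; apply: eq_bigr => t _.
by rewrite linearZ -(fQ t).
Qed.

Lemma rep_linear c v w u : rep (c *: v + w) u = c *: rep v u + rep w u.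
Proof. by have [f linf [_ fE]] := rep_lift u; rewrite !fE linf. Qed.

Lemma rep_Q t u : rep (Qg t) u = T t u.
Proof. by have [f _ [fQ fE]] := rep_lift u; rewrite fE fQ. Qed.

Lemma repD v w u : rep (v + w) u = rep v u + rep w u.
Proof. by rewrite -[v]scale1r rep_linear !scale1r. Qed.

Lemma rep0 u : rep 0 u = 0.
Proof.
by have := rep_linear (-1) 0 0 u; rewrite scaler0 addr0 scaleN1r addNr.
Qed.

Lemma repZ c v u : rep (c *: v) u = c *: rep v u.
Proof. by rewrite -[c *: v]addr0 rep_linear rep0 addr0. Qed.

Lemma repB v w u : rep (v - w) u = rep v u - rep w u.
Proof. by rewrite addrC -scaleN1r rep_linear scaleN1r addrC. Qed.

Lemma rep_sum (I : Type) (r : seq I) (F : I -> V) u :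
  rep (\sum_(i <- r) F i) u = \sum_(i <- r) rep (F i) u.
Proof. exact: (big_morph (rep^~ u) (fun v w => repD v w u) (rep0 u)). Qed.

Lemma repDr v u w : rep v (u + w) = rep v u + rep v w.
Proof.
rewrite /rep -big_split; apply: eq_bigr => t _.
have [lT _] := T_bounded t; rewrite -[u]scale1r lT !scale1r scalerDr//.
Qed.

Lemma repZr c v u : rep v (c *: u) = c *: rep v u.
Proof.
rewrite /rep scaler_sumr; apply: eq_bigr => t _; have [lT _] := T_bounded t.
have T0 : T t 0 = 0.
  by have := lT (-1) 0 0; rewrite scaler0 addr0 scaleN1r addNr.
by rewrite -[c *: u]addr0 lT T0 addr0 !scalerA mulrC.
Qed.

Lemma rep0r v : rep v 0 = 0.
Proof. by rewrite -[in LHS](scale0r (0 : H)) repZr scale0r. Qed.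

Lemma rep_sumr (I : Type) (r : seq I) (F : I -> H) v :
  rep v (\sum_(i <- r) F i) = \sum_(i <- r) rep v (F i).
Proof. exact: (big_morph (rep v) (repDr v) (rep0r v)). Qed.

Lemma rep_e u : rep e u = u.
Proof.
rewrite (e_nsE _ _ x0 x0) rep_sum -[RHS](T_unit u x0 x0); apply: eq_bigr => a _.
by rewrite rep_sum; apply: eq_bigr => b _; rewrite (rep_Q (a, b, x0, x0)).
Qed.

Lemma rep_Dns v u : C v -> 0 <= '[rep v u, u].
Proof.
move=> [r [r0 ->]]; rewrite rep_sum linear_sumlz/= sumr_ge0// => t _.
rewrite repZ rep_Q linearZl/= mulr_ge0 ?lecR//.
have [/(congr1 (@^~ u)) /= TT TA] := T_proj t.
by rewrite -TT TA -hdot_norm exprn_ge0.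
Qed.

Definition mxform m (X : 'I_m -> 'I_m -> V) (xi : 'I_m -> H) :=
  \sum_a \sum_b '[rep (X a b) (xi b), xi a].

Lemma mxformD m (X Y : 'I_m -> 'I_m -> V) xi :
  mxform (fun a b => X a b + Y a b) xi = mxform X xi + mxform Y xi.
Proof.
rewrite /mxform -big_split; apply: eq_bigr => a _; rewrite -big_split.
by apply: eq_bigr => b _; rewrite repD linearDl.
Qed.

Lemma mxformZ m c (X : 'I_m -> 'I_m -> V) xi :
  mxform (fun a b => c *: X a b) xi = c * mxform X xi.
Proof.
rewrite /mxform mulr_sumr; apply: eq_bigr => a _; rewrite mulr_sumr.
by apply: eq_bigr => b _; rewrite repZ linearZl.
Qed.

Lemma mxform_sum m (I : Type) (r : seq I) (X : I -> 'I_m -> 'I_m -> V) xi :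
  mxform (fun a b => \sum_(i <- r) X i a b) xi = \sum_(i <- r) mxform (X i) xi.
Proof.
rewrite /mxform [RHS]exchange_big; apply: eq_bigr => a _.
rewrite [RHS]exchange_big; apply: eq_bigr => b _.
by rewrite rep_sum linear_sumlz.
Qed.

Lemma eq_mxform m (X Y : 'I_m -> 'I_m -> V) xi : (forall a b, X a b = Y a b) ->
  mxform X xi = mxform Y xi.
Proof. by move=> XY; apply: eq_bigr => a _; apply: eq_bigr => b _;
  rewrite XY. Qed.

Lemma mxform_Dmax m (X : 'M[V]_m) xi : Dmax C X -> 0 <= mxform X xi.
Proof.
move=> /DmaxP[r [al [v [Cv ->]]]].
have -> : mxform (\matrix_(i, j) \sum_s0 ((al s0 i)^*%C * al s0 j) *: v s0) xi =
    \sum_s0 '[rep (v s0) (\sum_b al s0 b *: xi b), \sum_b al s0 b *: xi b].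
  transitivity (mxform (fun i j =>
    \sum_s0 ((al s0 i)^*%C * al s0 j) *: v s0) xi).
    by apply: eq_mxform => a b; rewrite mxE.
  rewrite mxform_sum; apply: eq_bigr => s0 _.
  rewrite linear_sumr/=; apply: eq_bigr => a _.
  rewrite rep_sumr linear_sumlz/=; apply: eq_bigr => b _.
  by rewrite repZ repZr !linearZl/= linearZr/= mulrA [al _ _ * _]mulrC.
by apply: sumr_ge0 => s0 _; apply: rep_Dns.
Qed.

Section Words.
Variable q : seq V.
Hypothesis q_Q : forall i, (i < size q)%N -> exists t, q`_i = Qg t.
Local Notation M := (size q).
Local Notation N := (1 * 2 ^ M)%N.
Local Notation pre := (prefix M).
Variable u : H.

(* [zeta j c] is the product, over the first j letters, of the projections    *)
(* chosen by the bits of c (0 selects q_i and 1 selects e - q_i), applied to  *)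
(* u.                                                                         *)
Fixpoint zeta j (c : nat) : H :=
  if j is i.+1 then rep (branch e q i (~~ odd c)) (zeta i c./2) else u.

Definition xi (a : 'I_N) := zeta M a.

Lemma rep_q_idem i w : (i < M)%N -> rep q`_i (rep q`_i w) = rep q`_i w.
Proof.
by move=> /q_Q[t ->]; rewrite !rep_Q; have [/(congr1 (@^~ w))] := T_proj t.
Qed.

Lemma rep_branch_null i b w : (i < M)%N ->
  rep (branch e q i b) (rep (branch e q i (~~ b)) w) = 0.
Proof.
have repBr v w1 w2 : rep v (w1 - w2) = rep v w1 - rep v w2.
  by rewrite -scaleN1r repDr repZr scaleN1r.
move=> iM; case: b; rewrite /= repB rep_e.
  by rewrite repBr rep_q_idem// subrr.
by rewrite rep_q_idem// subrr.
Qed.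

Lemma rep_branch_sum i b w : rep (branch e q i b) w + rep (branch e q i (~~ b))
  w = w.
Proof. by rewrite -repD /branch; case: b;
  rewrite /= ?subrK ?[q`_i + _]addrC ?subrK rep_e. Qed.

(** The two branches at each letter add up to the identity, so summing over the bits after the first
    j removes the corresponding factors. *)
Lemma zeta_sum j c : (j <= M)%N -> (c < 2 ^ j)%N ->
  \sum_(a < N) ((pre j a == c)%:R : R[i]) *: xi a = zeta j c.
Proof.
move=> jM; rewrite -(subKn jM); move: (leq_subr j M).
elim: (M - j)%N c => [|d IH] c dM cj.
  rewrite subn0 in cj *; have cN : (c < N)%N by rewrite mul1n.
  rewrite (bigD1 (Ordinal cN))//= prefix_full eqxx scale1r big1 ?addr0//.
  move=> a ac; rewrite prefix_full; case: eqP => [e1|_];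
    last by rewrite scale0r.
  by move/eqP: ac; case; apply: val_inj.
set i := (M - d.+1)%N in cj *.
have iM : (i < M)%N by rewrite /i ltn_subrL/= (leq_ltn_trans _ dM).
have iS : (M - d)%N = i.+1 by rewrite /i -subSn.
have h2 (z : nat) : (z./2 == c)%:R = (z == c.*2)%:R + (z == c.*2.+1)%:R :> R[i].
  by case: (z./2 =P c) (z =P c.*2) (z =P c.*2.+1) => [?|?] [?|?] [?|?];
     rewrite ?addr0 ?add0r//; lia.
under eq_bigr do rewrite (prefixS _ iM) h2 scalerDl.
rewrite big_split/= -iS !IH ?(ltnW dM)// ?iS.
- rewrite /= odd_double /= uphalf_double doubleK.
  by have := rep_branch_sum i true (zeta i c).
- by rewrite expnS mul2n -doubleS leq_double.
by rewrite expnS mul2n ltn_double.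
Qed.

Lemma mxform_const v : mxform (fun _ _ : 'I_N => v) xi = '[rep v u, u].
Proof.
have xu : \sum_a xi a = u.
  rewrite -[RHS](@zeta_sum 0 0)//; apply: eq_bigr => a _.
  by rewrite prefix0 ?eqxx ?scale1r//; apply: leq_trans (ltn_ord a) _;
    rewrite mul1n.
rewrite -[in RHS]xu linear_sumr/=; apply: eq_bigr => a _.
by rewrite rep_sumr linear_sumlz.
Qed.

(** Summing over b leaves a vector whose last factor is the branch complementary to the one
    occurring in Q_i, and q_i (e - q_i) acts as zero. *)
Lemma mxform_Q (i : 'I_M) (t : R) :
  mxform (fun a b : 'I_N => (t * (pre i.+1 a == pre i.+1 b)%:R)%:C *:
     branch e q i (odd (pre i.+1 a))) xi = 0.
Proof.
rewrite /mxform big1// => a _.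
have aN : (a < 2 ^ M)%N by apply: leq_trans (ltn_ord a) _; rewrite mul1n.
have sumb := zeta_sum (ltn_ord i) (prefix_lt (ltn_ord i) aN).
transitivity (t%:C * '[rep (branch e q i (odd (pre i.+1 a)))
  (zeta i.+1 (pre i.+1 a)), xi a]).
  rewrite -sumb rep_sumr linear_sumlz/= mulr_sumr; apply: eq_bigr => b _.
  rewrite repZ repZr !linearZl/= rmorphM/= rmorph_nat eq_sym.
  by rewrite mulrA.
by rewrite /= rep_branch_null// linear0l mulr0.
Qed.

End Words.

(** On the vectors [xi u] the Q_i terms vanish however large their coefficients are. The number d
    serves both as all the eps_i and as the Archimedean perturbation of the maximal cone; first d
    and then eps tend to 0. *)
Lemma rep_Dqc (s : seq (idx n k)) v u : (0 < n)%N -> D_qc s v ->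
  0 <= '[rep v u, u].
Proof.
move=> n0 Dv; apply: (@pos_limit _ _ '[u, u]) => eps eps0.
have [L [L0 [_ cX]]] := Dv eps eps0.
pose q := letters R s L; pose M := size q.
have q_Q i : (i < size q)%N -> exists t, q`_i = Qg t by apply: letters_Q.
have uE : '[rep v u, u] + eps%:C * '[u, u] = '[rep (v + eps%:C *: e) u, u].
  by rewrite repD repZ rep_e linearDl/= linearZl.
rewrite uE; set x := v + _.
pose Pf := \sum_(i < M) mxform (fun a b : 'I_(1 * 2 ^ M) =>
  ((prefix M i.+1 a == prefix M i.+1 b)%:R)%:C *:
     branch e q i (~~ odd (prefix M i.+1 a))) (xi u).
pose Df := mxform (fun a b : 'I_(1 * 2 ^ M) =>
  ((a == b)%:R : R[i]) *: e) (xi u).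
apply: (@pos_limit _ _ (Pf + Df)) => d d0.
have [t [_ [_ /(_ d d0) Dt] _]] := cX (fun=> d) (fun=> d0).
have := mxform_Dmax (xi (q := q) u) Dt; congr (0 <= _).
rewrite -(mxform_const q u x) mulrDr addrA.
have -> : d%:C * Df = mxform (fun a b : 'I_(1 * 2 ^ M) =>
  (d%:C * (a == b)%:R) *: e) (xi u).
  by rewrite -mxformZ; apply: eq_mxform => a b; rewrite scalerA.
have -> : d%:C * Pf = mxform (fun a b : 'I_(1 * 2 ^ M) =>
    \sum_(i < M) (d * (prefix M i.+1 a == prefix M i.+1 b)%:R)%:C *:
     branch e q i (~~ odd (prefix M i.+1 a))) (xi u).
  rewrite mxform_sum mulr_sumr; apply: eq_bigr => i _; rewrite -mxformZ.
  by apply: eq_mxform => a b; rewrite scalerA -rmorphM.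
have Q0 : mxform (fun a b : 'I_(1 * 2 ^ M) =>
    \sum_(i < M) (t i * (prefix M i.+1 a == prefix M i.+1 b)%:R)%:C *:
     branch e q i (odd (prefix M i.+1 a))) (xi u) = 0.
  by rewrite mxform_sum big1// => i _; apply: mxform_Q.
rewrite -[X in _ = X + _]addr0 -[X in _ = _ + X + _]Q0 -!mxformD;
  apply: eq_mxform => a b.
rewrite mxE perturbE; congr (_ + _ + _ + _); last first.
  by rewrite mxE; case: eqP => _;
    rewrite ?mulr1n ?mulr1 // mulr0n mulr0 scale0r.
by rewrite !mxE !ord1 eqxx mulr1n scale1r.
Qed.

End Soundness.

Lemma C_qc_state (R : realType) (n k : nat) (s : seq (idx n k))
    (p : 'I_k -> 'I_k -> 'I_n -> 'I_n -> R) : (0 < n)%N -> C_qc p ->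
  exists phi : {scalar (Vns R n k)}, is_state (D_qc s) (e_ns R n k) phi /\
    forall a b x y, (p a b x y)%:C = phi (Q R a b x y).
Proof.
move=> n0 [hp [H [A [B [E [F [phi [[cA cB] AB [EA FB] [philin phipos phi1]
  pE]]]]]]]].
have x0 := Ordinal n0.
pose T (t : idx n k) : H -> H := E t.1.2 t.1.1.1 \o F t.2 t.1.1.2.
have AE x a : A (E x a) by have [+ _ _] := EA x.
have BF y b : B (F y b) by have [+ _ _] := FB y.
have bE x a : bounded_operator (E x a) by apply: (cstar_bounded cA).
have bF y b : bounded_operator (F y b) by apply: (cstar_bounded cB).
have comm x a y b u : E x a (F y b u) = F y b (E x a u).
  exact: (congr1 (@^~ u) (AB _ _ (AE x a) (BF y b))).
have Tb t : bounded_operator (T t) by apply: bounded_comp.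
have Tp t : projection (T t).
  have [_ /(_ t.1.1.1) [EE EA'] _] := EA t.1.2;
    have [_ /(_ t.1.1.2) [FF FA'] _] := FB t.2.
  split; last by move=> u v; rewrite /T/= EA' FA' comm.
  apply/funext => u; rewrite /T/= -comm.
  by rewrite (congr1 (@^~ _) EE : E _ _ (E _ _ _) = _) (congr1 (@^~ _)
    FF : F _ _ (F _ _ _) = _).
have lin_sum (S : H -> H) : bounded_operator S -> forall (f : 'I_k -> H),
    S (\sum_b f b) = \sum_b S (f b).
  move=> [lS _] f; apply: (big_morph S) => [u v|];
    first by rewrite -[u]scale1r lS !scale1r.
  by have := lS (-1) 0 0; rewrite scaler0 addr0 scaleN1r addNr.
have sumE x u : \sum_a E x a u = u by have [_ _] := EA x; apply.
have sumF y u : \sum_b F y b u = u by have [_ _] := FB y; apply.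
have ns u : nonsignalling (fun t => T t u).
  split=> [a x z w|b y z w]; rewrite /T/=; last by rewrite !sumE.
  by rewrite -!lin_sum// !sumF.
have unit u x y : \sum_a \sum_b T (a, b, x, y) u = u.
  rewrite /T/=; under eq_bigr do rewrite -lin_sum// sumF.
  exact: sumE.
pose pi v : H -> H := rep T v.
(* Each image is a finite combination of the products [E x a \o F y b], hence lies in the domain of
   the state, where positivity and linearity of [phi] apply. *)
have piAB v : cstar_prod A B (pi v).
  move=> D [cD GD]; rewrite /pi /rep.
  elim: (index_enum _) => [|t r IH].
    by under eq_fun do rewrite big_nil; exact: (cstar0 cD).
  under eq_fun do rewrite big_cons; apply: (cstarD cD) => //;
    apply: (cstarZ cD).
  by apply: GD; exists (E t.1.2 t.1.1.1); [exact: AE|exists (F t.2 t.1.1.2)].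
pose f v := phi (pi v).
have linf : linear_for *%R f.
  move=> c v w; rewrite /f -philin//; congr phi; apply/funext => u.
  exact: rep_linear.
pose F' : {scalar (Vns R n k)} :=
  HB.pack f (GRing.isLinear.Build _ _ _ _ f linf).
exists F'; split; last first.
  move=> a b x y; rewrite pE; congr phi; apply/funext => u.
  by rewrite -[RHS]/(rep T (Qidx R (a, b, x, y)) u) rep_Q.
split=> [v Dv|].
  by apply: phipos => // u; apply: rep_Dqc Dv.
rewrite -phi1; congr phi; apply/funext => u; exact: (rep_e x0).
Qed.

Theorem theorem1p1 (R : realType) (n k : nat) (hn : (0 < n)%N) (hk : (0 < k)%N)
    (s : seq (idx n k)) (hs : perm_eq s (enum (idx n k)))
    (p : 'I_k -> 'I_k -> 'I_n -> 'I_n -> R) (hp : correlation p) :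
  (C_qc p <->
     exists phi : {scalar (Vns R n k)},
       is_state (D_qc s) (e_ns R n k) phi /\
       forall a b x y, (p a b x y)%:C = phi (Q R a b x y)) /\
  (C_ns p <->
     exists phi : {scalar (Vns R n k)},
       is_state (@D_ns R n k) (e_ns R n k) phi /\
       forall a b x y, (p a b x y)%:C = phi (Q R a b x y)).
Proof.
split; last exact: C_nsP.
split=> [|[phi [phi_state phiQ]]]; first exact: C_qc_state.
have x0 := Ordinal hn; pose p' (t : idx n k) := p t.1.1.1 t.1.1.2 t.1.2 t.2.
have s_all t : t \in s by rewrite (perm_mem hs) mem_enum.
have phiQ' t : phi (Qidx R t) = (p' t)%:C by case: t => [[[a b] x] y]; rewrite -phiQ.
have p1 : \sum_t unit_coef R x0 x0 t * p' t = 1.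
  by rewrite sum_unit_coef; have [_ ->] := hp.
have [m mP] := moments_limit (fun L L0 => state_moments s_all L0 phi_state phiQ' p1).
exact: (C_qc_moments hn mP hp).
Qed.
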